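(* Let $h\colon TM\to M$ be a tame algebra over the tangent functor monad, let $x\in M$, and let $\gamma\colon[0,1]\to M$ be a smooth path with values in $L_x=h(T_xM)$ and with $\gamma(0)=x$. Then there is a piecewise smooth path $\tilde\gamma\colon[0,1]\to T_xM$ such that $\tilde\gamma(0)=0$ and $h(x,\tilde\gamma(t))=\gamma(t)$ for all $t\in[0,1]$.
   Context: Manifolds are smooth paracompact Hausdorff manifolds modelled on real or complex separable Banach spaces. An algebra over the tangent functor monad on $M$ is a smooth map $h\colon TM\to M$ with $h(x,0)=x$ for all $x\in M$ and $h\circ Th=h\circ\mu_M$, where $\mu_M\colon T^2M\to TM$, $\mu_M(\xi)=\tau_{TM}(\xi)+T\tau_M(\xi)$ with $\tau$ the tangent bundle projection; in charts, $h\big(h(x,v),h'(x,v)(\dot x,\dot v)\big)=h(x,v+\dot x)$. For $x\in M$ put $h_x=h|_{T_xM}\colon T_xM\to M$. The algebra $h$ is tame if for every $x\in M$ the map $h_x$ is a subimmersion at the origin, i.e. on a neighbourhood of $0\in T_xM$ it factors as a submersion followed by an immersion. (For a tame algebra, the sets $L_x$ are the leaves of a singular foliation of $M$ and are initial submanifolds, so a smooth path in $M$ with values in $L_x$ is smooth as a path in $L_x$.) Piecewise smooth paths are continuous by convention. *)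

(* Defs.v *)
From HB Require Import structures.
From mathcomp Require Import all_boot all_order all_algebra.
From mathcomp Require Import complex.
From mathcomp Require Import all_classical all_reals all_analysis.

Set Implicit Arguments.
Unset Strict Implicit.
Unset Printing Implicit Defensive.

Import Order.TTheory GRing.Theory Num.Theory.
Import numFieldNormedType.Exports.

Local Open Scope classical_set_scope.
Local Open Scope ring_scope.

(* The ground field: R[i] if c, R otherwise. *)
Definition ground_field (R : realType) (c : bool) : numFieldType :=
  if c then (complex R : numFieldType) else (R : numFieldType).

Definition real_to_ground (R : realType) (c : bool) : R -> ground_field R c :=
  if c return R -> ground_field R c then real_complex R else id.

(* The C^k tower is iterated through the tangent map (x, v) |-> (f x, f'(x) v)
   instead of through f' with values in a normed space of operators.  At a
   finite level k this only asks for joint continuity of (x, v) |-> f'(x) v,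
   but both towers define the same maps at level infinity. Differentiability
   is Fréchet differentiability over K (so smooth means holomorphic when
   K is the complex field). *)
Fixpoint Ck (K : numFieldType) (k : nat) (E F : normedModType K)
    (U : set E) (f : E -> F) {struct k} : Prop :=
  match k with
  | 0 => forall x, U x -> {for x, continuous f}
  | n.+1 => (forall x, U x -> differentiable f x) /\
            Ck n (U `*` [set: E]) (fun p : E * E => (f p.1, 'd f (p.1) p.2))
  end.

Definition smooth (K : numFieldType) (E F : normedModType K)
    (U : set E) (f : E -> F) : Prop :=
  forall k, Ck k U f.

Section smooth_theory.
Context {K : numFieldType}.
Implicit Types E F G : normedModType K.

Lemma open_setXT E (U : set E) : open U -> open (U `*` [set: E]).
Proof.
move=> oU; rewrite openE => -[x v] [/= Ux _].
exists (U, setT) => //; split=> /=; last exact: filterT.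
exact: open_nbhs_nbhs.
Qed.

Lemma near_diff_eq E F (f g : E -> F) (x : E) :
  (\forall y \near x, f y = g y) -> differentiable f x ->
  differentiable g x /\ 'd g x = 'd f x :> (E -> F).
Proof.
move=> fg df.
have fgx : f x = g x by exact: nbhs_singleton fg.
have [dfc dfe] := (diff_locallyP _ _).1 df.
have e : g \o shift x = cst (g x) + 'd f x +o_ (0 : E) id.
  apply/eqaddoP => eps eps0.
  have /eqaddoP/(_ eps eps0) := dfe.
  have fg0 : \forall h \near (0 : E), f (h + x) = g (h + x).
    by move: fg; rewrite (near_shift 0) subr0.
  apply: filterS2 fg0 => h fgh.
  by rewrite /= !fctE /= fgh fgx.
have dgE : 'd g x = 'd f x :> (E -> F) by exact: diff_unique dfc e.
by split=> //; apply/diff_locallyP; rewrite dgE.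
Qed.

Lemma eq_Ck k E F (U : set E) (f g : E -> F) :
  open U -> (forall x, U x -> f x = g x) -> Ck k U f -> Ck k U g.
Proof.
elim: k E F U f g => [|k IH] E F U f g oU fg /=.
  move=> cf x Ux; have fgx : \forall y \near x, f y = g y.
    by apply: filterS (open_nbhs_nbhs (conj oU Ux)) => y; exact: fg.
  rewrite /prop_for /continuous_at -(fg x Ux).
  exact: cvg_trans (near_eq_cvg fgx) (cf x Ux).
move=> [df Tf].
have fgn x : U x -> \forall y \near x, f y = g y.
  by move=> Ux; apply: filterS (open_nbhs_nbhs (conj oU Ux)) => y; exact: fg.
split=> [x Ux|]; first by have [] := near_diff_eq (fgn x Ux) (df x Ux).
apply: IH Tf => [|[x v] [/= Ux _]].
  exact: open_setXT.
by rewrite fg //; have [_ ->] := near_diff_eq (fgn x Ux) (df x Ux).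
Qed.

Lemma Ck_id k E (U : set E) : open U -> Ck k U (@idfun E).
Proof.
elim: k E U => [|k IH] E U oU /=; first by move=> x _; exact: cvg_id.
split=> [x _|]; first exact: ex_diff.
have oT := open_setXT oU.
apply: eq_Ck (IH _ _ oT) => // -[x v] _ /=.
by rewrite diff_val.
Qed.

Lemma smooth_tangent E F (U : set E) (f : E -> F) : smooth U f ->
  smooth (U `*` [set: E]) (fun p : E * E => (f p.1, 'd f (p.1) p.2)).
Proof. by move=> sf k; have [] := sf k.+1. Qed.

Lemma smooth_differentiable E F (U : set E) (f : E -> F) x :
  smooth U f -> U x -> differentiable f x.
Proof. by move=> /(_ 1%N)[+ _]; exact. Qed.

Lemma diff_fst E F (p : E * F) :
  differentiable (fst : E * F -> E) p /\
  'd (fst : E * F -> E) p = fst :> (E * F -> E).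
Proof.
have c1 : continuous (fst : E * F -> E) by move=> y; exact: cvg_fst.
by split; [exact: linear_differentiable|exact: diff_lin].
Qed.

End smooth_theory.

Section complete_prod.
Context {K : numFieldType} {E F : completeNormedModType K}.

HB.instance Definition _ := NormedModule.on (E * F)%type.

Let prod_cauchy_cvg (G : set_system (E * F)) :
  ProperFilter G -> cauchy G -> cvg G.
Proof.
move=> GG cG.
have c1 : cauchy (fst @ G).
  move=> A entA; have [] := cG [set xy | A (xy.1.1, xy.2.1)].
    have := prod_entP entA (@entourageT F).
    by apply: filterS => xy [].
  move=> [P Q] /= [GP GQ] PQ.
  exists (fst @` P, fst @` Q).
    split; [apply: filterS GP|apply: filterS GQ] => z ?; by exists z.
  by move=> [_ _] [/= [x Px <-] [y Qy <-]]; have := PQ (x, y); apply.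
have c2 : cauchy (snd @ G).
  move=> A entA; have [] := cG [set xy | A (xy.1.2, xy.2.2)].
    have := prod_entP (@entourageT E) entA.
    by apply: filterS => xy [].
  move=> [P Q] /= [GP GQ] PQ.
  exists (snd @` P, snd @` Q).
    split; [apply: filterS GP|apply: filterS GQ] => z ?; by exists z.
  by move=> [_ _] [/= [x Px <-] [y Qy <-]]; have := PQ (x, y); apply.
have h1 : fst @ G --> lim (fst @ G) by exact: cauchy_cvg c1.
have h2 : snd @ G --> lim (snd @ G) by exact: cauchy_cvg c2.
apply/cvg_ex; exists (lim (fst @ G), lim (snd @ G)) => /= A [[P Q] /= [P1 Q2] PQ].
have a1 : G (fst @^-1` P) := h1 _ P1.
have a2 : G (snd @^-1` Q) := h2 _ Q2.
by apply: filterS (filterI a1 a2) => -[a b] [/= ? ?]; exact: (PQ (a, b)).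
Qed.

HB.instance Definition _ := Uniform_isComplete.Build (E * F)%type
  prod_cauchy_cvg.

End complete_prod.

(* A set with a smooth atlas. The model space may depend on the chart;
   pm_param i is the inverse of the chart i (with irrelevant values outside of
   its image), and pm_at x is a preferred chart around x, which is used to
   represent the tangent space at x. *)
Record premanifold (K : numFieldType) := Premanifold {
  pm_pt : Type ;
  pm_idx : Type ;
  pm_model : pm_idx -> completeNormedModType K ;
  pm_dom : pm_idx -> set pm_pt ;
  pm_chart : forall i, pm_pt -> pm_model i ;
  pm_param : forall i, pm_model i -> pm_pt ;
  pm_at : pm_pt -> pm_idx ;
  pm_atP : forall x, pm_dom (pm_at x) x ;
  pm_chartK : forall i x, pm_dom i x -> pm_param (pm_chart i x) = x ;
  pm_open : forall i j, open (pm_chart i @` (pm_dom i `&` pm_dom j)) ;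
  pm_smooth : forall i j, smooth (pm_chart i @` (pm_dom i `&` pm_dom j))
    (fun a => pm_chart j (pm_param a))
}.

(* An alias of pm_pt M, carrying the topology for which the charts are
   homeomorphisms onto open sets. *)
Definition mspace (K : numFieldType) (M : premanifold K) : Type := pm_pt M.

Coercion mspace : premanifold >-> Sortclass.

Section topology.
Context {K : numFieldType} (M : premanifold K).

HB.instance Definition _ := gen_eqMixin (mspace M).
HB.instance Definition _ := gen_choiceMixin (mspace M).

Definition pm_open_set (A : set M) : Prop :=
  forall i, open (@pm_chart K M i @` (@pm_dom K M i `&` A)).

Let open_setT : pm_open_set setT.
Proof. by move=> i; rewrite setIT; have := pm_open i i; rewrite setIid. Qed.

Let open_setI : setI_closed pm_open_set.
Proof.
move=> A B oA oB i; have := openI (oA i) (oB i); congr open.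
apply/seteqP; split=> [_ [[x [ix Ax] <-] [y [iy By] yx]]|_ [x [ix [Ax Bx]] <-]].
  have xy : x = y by rewrite -(pm_chartK ix) -yx (pm_chartK iy).
  by exists x => //; split=> //; split=> //; rewrite xy.
by split; exists x.
Qed.

Let open_bigU (I : Type) (f : I -> set M) :
  (forall i, pm_open_set (f i)) -> pm_open_set (\bigcup_i f i).
Proof.
move=> of_ i; rewrite setI_bigcupr image_bigcup.
by apply: bigcup_open => j _; exact: of_.
Qed.

HB.instance Definition _ :=
  isOpenTopological.Build (mspace M) open_setT open_setI open_bigU.

End topology.

Definition paracompact (T : topologicalType) : Prop :=
  forall C : set (set T), C `<=` open -> \bigcup_(A in C) A = setT ->
  exists D : set (set T),
    [/\ D `<=` open,
        \bigcup_(A in D) A = setT,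
        forall B, D B -> exists2 A, C A & B `<=` A &
        forall x : T, exists2 W, nbhs x W &
          finite_set [set B | D B /\ B `&` W !=set0]].

Definition separable_space (T : topologicalType) : Prop :=
  exists2 D : set T, countable D & dense D.

Definition manifold (K : numFieldType) (M : premanifold K) : Prop :=
  [/\ hausdorff_space (mspace M),
      paracompact (mspace M) &
      forall i, separable_space (@pm_model K M i)].

Section tangent.
Context {K : numFieldType}.
Implicit Types M N P : premanifold K.

(* T_x M, read in the preferred chart at x. *)
Definition tangent_space M (x : M) : completeNormedModType K :=
  pm_model (pm_at x).

Definition local_expr M N (f : M -> N) i j : @pm_model K M i -> @pm_model K N j :=
  fun a => pm_chart j (f (pm_param a)).

Definition tangent_map_at M N (f : M -> N) (x : M) :
    tangent_space x -> tangent_space (f x) :=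
  'd (@local_expr M N f (pm_at x) (pm_at (f x))) (pm_chart (pm_at x) x).

Definition tangent_pt M : Type := {x : M & tangent_space x}.

Definition coord_change M i j : @pm_model K M i -> @pm_model K M j := @local_expr M M id i j.
Definition coord_diff M i j (a : @pm_model K M i) : @pm_model K M i -> @pm_model K M j :=
  'd (@coord_change M i j) a.

Lemma coord_diffK M i j k (x : M) v : pm_dom i x -> pm_dom j x -> pm_dom k x ->
  @coord_diff M j k (pm_chart j x) (@coord_diff M i j (pm_chart i x) v) =
  @coord_diff M i k (pm_chart i x) v.
Proof.
move=> ix jx kx.
have dij : differentiable (@coord_change M i j) (pm_chart i x).
  by apply: smooth_differentiable (@pm_smooth K M i j) _; exists x.
have djk : differentiable (@coord_change M j k) (@coord_change M i j (pm_chart i x)).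
  rewrite /coord_change /local_expr pm_chartK //.
  by apply: smooth_differentiable (@pm_smooth K M j k) _; exists x.
have tx : @coord_change M i j (pm_chart i x) = pm_chart j x.
  by rewrite /coord_change /local_expr pm_chartK.
have := diff_comp dij djk; rewrite tx => /(congr1 (fun g => g v)) /= dc.
rewrite /coord_diff -dc.
have djki := differentiable_comp dij djk.
have [|_ ->//] := @near_diff_eq _ _ _ (@coord_change M j k \o @coord_change M i j)
  (@coord_change M i k) (pm_chart i x) _ djki.
have nx : nbhs (pm_chart i x) (@pm_chart K M i @` (@pm_dom K M i `&` @pm_dom K M j)).
  by apply: open_nbhs_nbhs; split; [exact: pm_open|exists x].
by apply: filterS nx => _ [y [iy jy] <-]; rewrite /= /coord_change /local_expr !pm_chartK.
Qed.

Lemma coord_diff_id M i (x : M) v : pm_dom i x -> @coord_diff M i i (pm_chart i x) v = v.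
Proof.
move=> ix; rewrite /coord_diff.
have [||_ ->] := @near_diff_eq _ _ _ idfun (@coord_change M i i) (pm_chart i x).
- have nx : nbhs (pm_chart i x) (@pm_chart K M i @` (@pm_dom K M i `&` @pm_dom K M i)).
    by apply: open_nbhs_nbhs; split; [exact: pm_open|exists x].
  by apply: filterS nx => _ [y [iy _] <-]; rewrite /coord_change /local_expr pm_chartK.
- exact: ex_diff.
- by rewrite diff_val.
Qed.

Section bundle.
Variable M : premanifold K.

Definition tangent_model (i : pm_idx M) : completeNormedModType K :=
  (pm_model i * pm_model i)%type.
Definition tangent_dom (i : pm_idx M) : set (tangent_pt M) := [set p | pm_dom i (projT1 p)].
Definition tangent_chart i (p : tangent_pt M) : tangent_model i :=
  (pm_chart i (projT1 p),
   @coord_diff M _ i (pm_chart (pm_at (projT1 p)) (projT1 p)) (projT2 p)).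
Definition tangent_param i (q : tangent_model i) : tangent_pt M :=
  existT _ (pm_param q.1 : M) (@coord_diff M i _ q.1 q.2).
Definition tangent_at (p : tangent_pt M) : pm_idx M := pm_at (projT1 p).

Lemma tangent_atP p : tangent_dom (tangent_at p) p.
Proof. exact: pm_atP. Qed.

Lemma tangent_chartK i p : tangent_dom i p -> tangent_param (tangent_chart i p) = p.
Proof.
case: p => x v; rewrite /tangent_dom /tangent_param /tangent_chart /= => ix.
have H (y : M) : y = x -> existT (fun x : M => tangent_space x) y
    (@coord_diff M i (pm_at y) (pm_chart i x)
      (@coord_diff M (pm_at x) i (pm_chart (pm_at x) x) v)) = existT _ x v.
  by move=> ->; congr existT; rewrite coord_diffK ?coord_diff_id //; exact: pm_atP.
exact/H/pm_chartK.
Qed.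

Lemma tangent_image i j : tangent_chart i @` (tangent_dom i `&` tangent_dom j) =
  (@pm_chart K M i @` (@pm_dom K M i `&` @pm_dom K M j)) `*` setT.
Proof.
apply/seteqP; split=> [_ [[x v] /= [ix jx] <-]|[_ w] [/= [x [ix jx] <-] _]].
  by split=> //=; exists x.
exists (existT _ (x : M) (@coord_diff M i (pm_at x) (pm_chart i x) w)) => //.
by rewrite /tangent_chart /= coord_diffK ?coord_diff_id //; exact: pm_atP.
Qed.

Lemma tangent_open i j : open (tangent_chart i @` (tangent_dom i `&` tangent_dom j)).
Proof. by rewrite tangent_image; apply/open_setXT/pm_open. Qed.

Lemma tangent_smooth i j : smooth (tangent_chart i @` (tangent_dom i `&` tangent_dom j))
  (fun q => tangent_chart j (tangent_param q)).
Proof.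
move=> k; have := @tangent_open i j; rewrite tangent_image => oT.
apply: eq_Ck oT _ (smooth_tangent (@pm_smooth K M i j) k).
move=> [_ w] [/= [x [ix jx] <-] _]; rewrite /tangent_chart /tangent_param /=; congr pair.
have H (y : M) : y = x -> @coord_diff M i j (pm_chart i x) w =
    @coord_diff M (pm_at y) j (pm_chart (pm_at y) y)
      (@coord_diff M i (pm_at y) (pm_chart i x) w).
  by move=> ->; rewrite coord_diffK //; exact: pm_atP.
exact/H/pm_chartK.
Qed.

(* The chart of TM over the chart i sends (x, v) to (x_i, v_i), where v_i is
   obtained from v, given in the preferred chart at x, by the derivative of the
   coordinate change. The preferred chart of TM at (x, v) is the one over the
   preferred chart at x, so T_(x,v) TM = T_x M * T_x M. *)
Definition tangent_bundle : premanifold K :=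
  Premanifold tangent_atP tangent_chartK tangent_open tangent_smooth.

End bundle.

Definition tangent_vec M (x : M) (v : tangent_space x) : tangent_bundle M :=
  existT _ x v.

Definition tangent_proj M : tangent_bundle M -> M := fun p => projT1 p.

Definition tangent_map M N (f : M -> N) : tangent_bundle M -> tangent_bundle N :=
  fun p => tangent_vec (@tangent_map_at M N f (projT1 p) (projT2 p)).

(* mu xi = tau_TM xi + T tau_M xi; both terms are tangent vectors to M at
   tau_M (tau_TM xi). *)
Definition tangent_mu M (xi : tangent_bundle (tangent_bundle M)) :
    tangent_bundle M :=
  @tangent_vec M (tangent_proj (tangent_proj xi))
    (projT2 (tangent_proj xi) + projT2 (tangent_map (@tangent_proj M) xi)).

Lemma tangent_muE M (x : M) (u v w : tangent_space x) :
  tangent_mu (@tangent_vec (tangent_bundle M) (tangent_vec u) (v, w)) =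
  tangent_vec (u + v).
Proof.
rewrite /tangent_mu; congr existT; congr GRing.add => /=.
rewrite /tangent_map_at /=.
set q := (X in 'd _ X).
have [||_ ->] := @near_diff_eq _ _ _ fst (@local_expr (tangent_bundle M) M
  (@tangent_proj M) (pm_at x) (pm_at x)) q.
- have nx := open_nbhs_nbhs (conj (@pm_open K (tangent_bundle M) (pm_at x)
    (pm_at x)) (ex_intro2 _ _ (tangent_vec u) (conj (pm_atP x) (pm_atP x)) erefl)).
  apply: filterS nx => _ [[y z] [/= iy _] <-].
  by rewrite /local_expr /= /tangent_proj /= pm_chartK.
- exact: (diff_fst q).1.
- exact: (congr1 (fun f => f (v, w)) (diff_fst q).2).
Qed.

(* The openness of the domains of the local expressions is the continuity of f
   on U. *)
Definition smooth_map_on M N (U : set M) (f : M -> N) : Prop :=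
  forall i j, let D := @pm_chart K M i @`
      [set x | [/\ pm_dom i x, U x & pm_dom j (f x)]] in
    open D /\ smooth D (@local_expr M N f i j).

Definition smooth_map M N (f : M -> N) : Prop := smooth_map_on setT f.

Definition closed_subspace (E : normedModType K) (F : set E) : Prop :=
  [/\ closed F, F 0, forall u v, F u -> F v -> F (u + v) &
      forall (c : K) u, F u -> F (c *: u)].

Definition splits (E : normedModType K) (F : set E) : Prop :=
  closed_subspace F /\ exists G : set E,
    [/\ closed_subspace G, F `&` G = [set 0] &
        forall u, exists v w, [/\ F v, G w & u = v + w]].

Definition submersive_at M N (f : M -> N) (x : M) : Prop :=
  (forall w, exists v, @tangent_map_at M N f x v = w) /\
  splits [set v | @tangent_map_at M N f x v = 0].

Definition immersive_at M N (f : M -> N) (x : M) : Prop :=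
  injective (@tangent_map_at M N f x) /\
  splits (range (@tangent_map_at M N f x)).

Definition subimmersion_at M N (f : M -> N) (x : M) : Prop :=
  exists (U : set M) (P : premanifold K) (s : M -> P) (i : P -> N),
    [/\ open_nbhs x U,
        manifold P,
        smooth_map_on U s /\ (forall y, U y -> submersive_at s y),
        smooth_map i /\ (forall z, immersive_at i z) &
        forall y, U y -> f y = i (s y)].

Section vector.
Variable E : completeNormedModType K.

Lemma vector_open (i j : unit) : open ((@idfun E) @` (setT `&` setT)).
Proof. by rewrite setIT image_id; exact: openT. Qed.

Lemma vector_smooth (i j : unit) : smooth ((@idfun E) @` (setT `&` setT)) (@idfun E).
Proof. by move=> k; apply: Ck_id; exact: (@vector_open i j). Qed.

Definition vector_manifold : premanifold K :=
  @Premanifold K E unit (fun=> E) (fun=> setT) (fun=> idfun) (fun=> idfun)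
    (fun=> tt) (fun=> I) (fun _ _ _ => erefl) vector_open vector_smooth.

End vector.

Definition tangent_algebra M (h : tangent_bundle M -> M) : Prop :=
  [/\ smooth_map h,
      forall x : M, h (@tangent_vec M x 0) = x &
      forall xi, h (tangent_map h xi) = h (tangent_mu xi)].

Definition fiber_map M (h : tangent_bundle M -> M) (x : M) :
  vector_manifold (tangent_space x) -> M := fun v => h (@tangent_vec M x v).

Definition tame M (h : tangent_bundle M -> M) : Prop :=
  forall x : M,
    subimmersion_at (@fiber_map M h x) (0 : tangent_space x).

Definition leaf M (h : tangent_bundle M -> M) (x : M) : set M :=
  range (@fiber_map M h x).

End tangent.

Section paths.
Context {R : realType} {c : bool}.
Local Notation K := (ground_field R c).

(* g has derivatives of all orders on A, the limits of the difference quotients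
   being taken within A. The derivatives are with respect to the real parameter,
   including when E is a complex space. *)
Definition smooth_curve (E : normedModType K) (A : set R) (g : R -> E) : Prop :=
  exists d : nat -> R -> E,
    (forall t, A t -> d 0%N t = g t) /\
    forall n t, A t ->
      (real_to_ground c (s - t))^-1 *: (d n s - d n t)
        @[s --> within A t^'] --> d n.+1 t.

Definition smooth_path (M : premanifold K) (a b : R) (g : R -> M) : Prop :=
  forall t, a <= t <= b -> exists i (e : R),
    let A := `[a, b]%classic `&` ball t e in
    [/\ 0 < e, (forall s, A s -> @pm_dom K M i (g s)) &
        smooth_curve A (fun s => @pm_chart K M i (g s))].

Definition piecewise_smooth (E : normedModType K) (a b : R) (g : R -> E) : Prop :=
  {within `[a, b], continuous g} /\
  exists2 s : seq R, itv_partition a b s &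
    forall k, (k < size s)%N ->
      smooth_curve `[nth b (a :: s) k, nth b s k]%classic g.

End paths.

(* Main.v *)
(* Write h_x for the restriction of h to T_x M and P_x for the differential of
   h_x at 0.  The algebra law says that h_x (v + w) = h_y (A w) for y = h_x v and
   a linear map A; conversely h_y w = h_x (v + B w) for a linear map B, because
   B A is the identity modulo the range of P_x and h_x is invariant under
   translation by that range.  Hence the leaves partition M, and lifts of pieces
   of gamma to various tangent spaces can be glued: it is enough to write gamma
   near each t as h (b, beta s) with b fixed and beta smooth.

   Tameness gives P_a tau P_a = P_a for some bounded tau, so P_a is bounded below
   modulo its kernel for every a.  By Baire's theorem on the closure of the leaf,
   this lower bound is uniform for the points of the leaf near some point a1 of
   the leaf.  There (z |-> h (a1 + pi z, tau z)), with pi = 1 - P tau, is a local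
   diffeomorphism, and the uniform bound forces the range of P_y, for y in the
   leaf, to be tangent to its slices pi z = constant.  Since T_x M is separable,
   the leaf meets only countably many slices, so a curve in the leaf near a1 stays
   in a single slice, which is a smooth lift.  A curve elsewhere in the leaf is
   first moved near a1 by s |-> h (gamma s, v) for a fixed coordinate vector v.

   In the complex case everything is done over the real numbers, by restriction
   of scalars. *)
Require Import Defs.
From HB Require Import structures.
From mathcomp Require Import all_boot all_order all_algebra.
From mathcomp Require Import complex ring lra.
From mathcomp Require Import all_classical all_reals all_analysis.

Set Implicit Arguments.
Unset Strict Implicit.
Unset Printing Implicit Defensive.

Import Order.TTheory GRing.Theory Num.Theory.
Import numFieldNormedType.Exports.

Local Open Scope classical_set_scope.
Local Open Scope ring_scope.

(** * Differentials and smooth maps *)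

(** Tameness concerns one fibre at a time and does not control how the kernel and the range of P_y
    vary with y. For y near a1 the range of P_y contains a copy of the range of P_a1, but could be
    strictly larger, and then the leaf would not follow the slices. The uniform lower bound excludes
    this: a vector of ker P_a1 has a small image under P_y, so up to an error this is also the image
    of a small vector, and iteration leaves only the copy ([transversal_approx]). A leaf need not be
    closed, hence the passage to its closure; for the same reason the lower bound is stated with
    errors, which lets it pass to limits.

    Countability comes from u |-> h (x, u): its derivative at u takes values in the range of P_y, y
    = h (x, u), so the slice coordinate is locally constant on a separable space.

    The second argument xi of the local diffeomorphism serves the way back. Translation by v lifts
    only the translated curve, and a vector om over that curve must be carried along to return to
    gamma. When om is the horizontal image of xi, the law gives gamma s = h (b, tau z + xi), with b
    the same along the whole slice. *)

Section differential.
Context {K : numFieldType}.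
Implicit Types E F G : normedModType K.

Lemma diff_near E F (f : E -> F) x e : differentiable f x -> 0 < e ->
  \forall y \near x, `|f y - f x - 'd f x (y - x)| <= e * `|y - x|.
Proof.
move=> /diff_locallyP[_ /eqaddoP H] e0; have := H e e0.
rewrite (near_shift 0 x) subr0; apply: filterS => y /=.
by rewrite !fctE /= addrK opprD addrA.
Qed.

Lemma near_differentiable E F (f : E -> F) x (L : {linear E -> F}) :
  continuous L ->
  (forall e, 0 < e -> \forall y \near x, `|f y - f x - L (y - x)| <= e * `|y - x|) ->
  differentiable f x /\ 'd f x = L :> (E -> F).
Proof.
move=> cL H.
have e : f \o shift x = cst (f x) + L +o_ (0 : E) id.
  apply/eqaddoP => eps e0; have := H _ e0.
  rewrite (near_shift 0 x) subr0; apply: filterS => y /=.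
  by rewrite !fctE /= addrK opprD addrA.
have dE : 'd f x = L :> (E -> F) by exact: diff_unique cL e.
by split=> //; apply/diff_locallyP; rewrite dE.
Qed.

Lemma diff_lipschitz E F (f : E -> F) x : differentiable f x ->
  exists2 k, 0 < k & forall v, `|'d f x v| <= k * `|v|.
Proof. by move=> df; apply: linear_lipschitz; exact: diff_continuous. Qed.

Lemma lipschitz_linear_continuous E F (f : {linear E -> F}) k : 0 < k ->
  (forall v, `|f v| <= k * `|v|) -> continuous f.
Proof.
move=> k0 H; apply: bounded_linear_continuous; apply/linear_boundedP.
exists k; split=> [|r kr v]; first by rewrite gtr0_real.
by apply: le_trans (H v) _; rewrite ler_wpM2r// ltW.
Qed.

Definition inl0 E F (v : E) : E * F := (v, 0).
Definition inr0 E F (v : F) : E * F := (0, v).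

Fact inl0_linear E F : linear (@inl0 E F).
Proof. by move=> k u v; rewrite /inl0 -[RHS]/(_, _) /= scaler0 addr0. Qed.
Fact inr0_linear E F : linear (@inr0 E F).
Proof. by move=> k u v; rewrite /inr0 -[RHS]/(_, _) /= scaler0 addr0. Qed.
HB.instance Definition _ E F :=
  GRing.isLinear.Build K E (E * F)%type _ (@inl0 E F) (@inl0_linear E F).
HB.instance Definition _ E F :=
  GRing.isLinear.Build K F (E * F)%type _ (@inr0 E F) (@inr0_linear E F).

Lemma norm_pair E F (p : E * F) : `|p| = Num.max `|p.1| `|p.2|.
Proof. by []. Qed.

Lemma norm_fst E F (p : E * F) : `|p.1| <= `|p|.
Proof.
by rewrite norm_pair comparable_le_max ?real_comparable ?normr_real ?lexx.
Qed.

Lemma norm_snd E F (p : E * F) : `|p.2| <= `|p|.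
Proof.
by rewrite norm_pair comparable_le_max ?real_comparable ?normr_real ?lexx ?orbT.
Qed.

Lemma norm_pair_le E F (p : E * F) : `|p| <= `|p.1| + `|p.2|.
Proof.
by rewrite norm_pair comparable_ge_max ?real_comparable ?normr_real//
  lerDl lerDr !normr_ge0.
Qed.

Lemma norm_inl0 E F (v : E) : `|inl0 F v| = `|v|.
Proof.
rewrite norm_pair /= normr0 max_l //.
Qed.
Lemma norm_inr0 E F (v : F) : `|inr0 E v| = `|v|.
Proof.
by rewrite norm_pair /= normr0 max_r.
Qed.

Lemma inl0_continuous E F : continuous (@inl0 E F).
Proof.
by apply: (@lipschitz_linear_continuous _ _ _ 1) => // v; rewrite norm_inl0 mul1r.
Qed.
Lemma inr0_continuous E F : continuous (@inr0 E F).
Proof.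
by apply: (@lipschitz_linear_continuous _ _ _ 1) => // v; rewrite norm_inr0 mul1r.
Qed.

Lemma diff_affine E F (L : {linear E -> F}) (b : F) x : continuous L ->
  differentiable (fun y => b + L y) x /\ 'd (fun y => b + L y) x = L :> (E -> F).
Proof.
move=> cL; apply: near_differentiable => // e e0; apply: nearW => y.
rewrite opprD addrACA subrr add0r linearB subrr normr0.
by rewrite mulr_ge0 // ltW.
Qed.

Lemma differentiable_affine_comp E F G (L : {linear E -> F}) (b : F) (f : F -> G) x :
  continuous L -> differentiable f (b + L x) ->
  differentiable (fun y => f (b + L y)) x /\
  forall v, 'd (fun y => f (b + L y)) x v = 'd f (b + L x) (L v).
Proof.
move=> cL df; have [dA dAE] := diff_affine b x cL.
split=> [|v]; first exact: (differentiable_comp dA).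
by rewrite (@diff_comp _ _ _ _ (fun y => b + L y) f x) //= dAE.
Qed.

Lemma diff_inr E F G (f : E * F -> G) a u : differentiable f (a, u) ->
  differentiable (fun w => f (a, w)) u /\
  forall v, 'd (fun w => f (a, w)) u v = 'd f (a, u) (0, v).
Proof.
move=> df.
have e w : (a, 0) + inr0 E w = (a, w) by rewrite -[LHS]/(_, _) /= addr0 add0r.
have := @differentiable_affine_comp _ _ _ (@inr0 E F) (a, 0) f u (@inr0_continuous E F).
by rewrite e (_ : (fun y => _) = fun w => f (a, w)) //;
  [apply|apply/funext => w; rewrite e].
Qed.

Lemma diff_inl E F G (f : E * F -> G) a u : differentiable f (a, u) ->
  differentiable (fun w => f (w, u)) a /\
  forall v, 'd (fun w => f (w, u)) a v = 'd f (a, u) (v, 0).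
Proof.
move=> df.
have e w : (0, u) + inl0 F w = (w, u) by rewrite -[LHS]/(_, _) /= addr0 add0r.
have := @differentiable_affine_comp _ _ _ (@inl0 E F) (0, u) f a (@inl0_continuous E F).
by rewrite e (_ : (fun y => _) = fun w => f (w, u)) //;
  [apply|apply/funext => w; rewrite e].
Qed.

Lemma diff_lin_comp E F G (f : E -> F) (L : {linear F -> G}) x :
  continuous L -> differentiable f x ->
  differentiable (fun y => L (f y)) x /\
  forall v, 'd (fun y => L (f y)) x v = L ('d f x v).
Proof.
move=> cL df; have dL : differentiable L (f x) by exact: linear_differentiable.
split=> [|v]; first exact: (differentiable_comp df dL).
by rewrite (@diff_comp _ _ _ _ f L x) //= diff_lin.
Qed.

Lemma fst_continuous E F : continuous (fst : E * F -> E).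
Proof. by move=> p; exact: cvg_fst. Qed.
Lemma snd_continuous E F : continuous (snd : E * F -> F).
Proof. by move=> p; exact: cvg_snd. Qed.

Lemma diff_split E F G (f : E * F -> G) p v : differentiable f p ->
  'd f p v = 'd f p (v.1, 0) + 'd f p (0, v.2).
Proof. by move=> df; rewrite -linearD -[X in _ = 'd f p X]/(_, _) /= addr0 add0r; case: v. Qed.

Lemma Ck_sub k E F (U V : set E) (f : E -> F) : V `<=` U -> Ck k U f -> Ck k V f.
Proof.
elim: k E F U V f => [|k IH] E F U V f VU /=; first by move=> H x /VU; exact: H.
move=> [df cf]; split=> [x /VU|]; first exact: df.
by apply: IH cf => -[x v] [/= /VU].
Qed.

Lemma smooth_sub E F (U V : set E) (f : E -> F) : V `<=` U -> smooth U f -> smooth V f.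
Proof. by move=> VU sf k; exact: Ck_sub VU (sf k). Qed.

(** [LL] is the tangent map of [L], which the [Ck] recursion meets after one step. *)
Lemma linear_double E F (L : {linear E -> F}) : continuous L ->
  exists2 LL : {linear (E * E)%type -> (F * F)%type},
    continuous LL & forall p, LL p = (L p.1, L p.2).
Proof.
move=> cL; have [k k0 Lk] := linear_lipschitz cL.
have LLl : linear (fun p : E * E => (L p.1, L p.2)) by move=> r u v /=; rewrite !linearP.
pose LL : {linear (E * E)%type -> (F * F)%type} :=
  HB.pack (fun p : E * E => (L p.1, L p.2)) (GRing.isLinear.Build _ _ _ _ _ LLl).
exists LL => //.
apply: (@lipschitz_linear_continuous _ _ _ k) => // v /=.
rewrite norm_pair comparable_ge_max ?real_comparable ?normr_real//=.
by rewrite !(le_trans (Lk _))// ler_wpM2l ?norm_fst ?norm_snd// ltW.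
Qed.

(** The tangent map of an affine map is again affine, with constant part [(b, 0)], so the induction
    closes without a chain rule for general [Ck] maps. *)
Lemma Ck_affine_comp k E F G (L : {linear E -> F}) (b : F) U (f : F -> G) :
  continuous L -> open U -> Ck k U f ->
  Ck k [set y | U (b + L y)] (fun y => f (b + L y)).
Proof.
elim: k E F G L b U f => [|k IH] E F G L b U f cL oU /=.
  move=> cf x Ux; apply: (@continuous_comp _ _ _ (fun y => b + L y) f).
    by apply: differentiable_continuous; have [] := diff_affine b x cL.
  exact: cf.
have cA : continuous (fun y => b + L y).
  by move=> y; apply: differentiable_continuous; have [] := diff_affine b y cL.
move=> [df cf]; split=> [x Ux|].
  by have [] := differentiable_affine_comp cL (df _ Ux).
have [LL cLL LLE] := linear_double cL.
have oU2 : open [set y | U (b + L y)] by apply: open_comp => // y _; exact: cA.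
have := IH _ _ _ LL (b, 0) _ _ cLL (open_setXT oU) cf.
have -> : [set y | (U `*` [set: F]) ((b, 0) + LL y)] = [set y | U (b + L y)] `*` setT.
  by apply/seteqP; split=> y; rewrite /= LLE => -[].
apply: eq_Ck; first exact: open_setXT.
move=> [x v] [/= Ux _] /=; rewrite LLE /= add0r.
by have [_ ->] := differentiable_affine_comp cL (df _ Ux).
Qed.

Lemma smooth_affine_comp E F G (L : {linear E -> F}) (b : F) U (f : F -> G) :
  continuous L -> open U -> smooth U f ->
  smooth [set y | U (b + L y)] (fun y => f (b + L y)).
Proof. by move=> cL oU sf k; exact: Ck_affine_comp. Qed.

Lemma Ck_lin_comp k E F G (L : {linear F -> G}) U (f : E -> F) :
  continuous L -> open U -> Ck k U f -> Ck k U (fun y => L (f y)).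
Proof.
elim: k E F G L U f => [|k IH] E F G L U f cL oU /=.
  by move=> cf x Ux; apply: (@continuous_comp _ _ _ f L); [exact: cf|exact: cL].
move=> [df cf]; split=> [x Ux|].
  by have [] := diff_lin_comp cL (df _ Ux).
have [LL cLL LLE] := linear_double cL.
have := IH _ _ _ LL _ _ cLL (open_setXT oU) cf.
apply: eq_Ck; first exact: open_setXT.
move=> [x v] [/= Ux _]; rewrite LLE /=.
by have [_ ->] := diff_lin_comp cL (df _ Ux).
Qed.

Lemma smooth_lin_comp E F G (L : {linear F -> G}) U (f : E -> F) :
  continuous L -> open U -> smooth U f -> smooth U (fun y => L (f y)).
Proof. by move=> cL oU sf k; exact: Ck_lin_comp. Qed.

Lemma smooth_diff E F (U : set E) (f : E -> F) : open U -> smooth U f ->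
  smooth (U `*` setT) (fun p : E * E => 'd f (p.1) p.2).
Proof.
move=> oU sf; have := smooth_lin_comp (@snd_continuous F F) (open_setXT oU) (smooth_tangent sf).
exact.
Qed.

(** Since ['d f y 0 = 0] for every [y], the second derivative of [f] contributes nothing along the
    zero section. *)
Lemma diff_diff0 E F (U : set E) (f : E -> F) x a b : open U -> smooth U f -> U x ->
  'd (fun p : E * E => 'd f (p.1) p.2) (x, 0) (a, b) = 'd f x b.
Proof.
move=> oU sf Ux.
have dd : differentiable (fun p : E * E => 'd f (p.1) p.2) (x, 0).
  by apply: smooth_differentiable (smooth_diff oU sf) _.
rewrite diff_split //=.
have [_ <-] := diff_inl dd; have [_ <-] := diff_inr dd.
rewrite /= (_ : (fun w => _) = cst 0); last by apply/funext => w; rewrite linear0.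
rewrite diff_cst add0r /=.
have -> : (fun w => 'd f x w) = 'd f x :> (E -> F) by [].
by rewrite diff_lin //; apply: diff_continuous; exact: smooth_differentiable Ux.
Qed.

(** The [Ck] tower provides only joint continuity of [(y, v) |-> 'd f y v]. Continuity in operator
    norm follows from the differentiability of this map at [(x, 0)], because homogeneity in [v]
    makes the remainder estimate uniform. *)
Lemma diff_near_norm E F (U : set E) (f : E -> F) x e :
  open U -> smooth U f -> U x -> 0 < e ->
  \forall y \near x, forall v, `|'d f y v - 'd f x v| <= e * `|v|.
Proof.
move=> oU sf Ux e0.
have dd : differentiable (fun p : E * E => 'd f (p.1) p.2) (x, 0).
  by apply: smooth_differentiable (smooth_diff oU sf) _.
have := diff_near dd e0; rewrite /= => /nbhs_ballP[d /= d0 dH].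
apply/nbhs_ballP; exists (d / 2); first by rewrite /= divr_gt0.
move=> y xy v; have [->|v0] := eqVneq v 0; first by rewrite (linear0 ('d f y)) (linear0 ('d f x)) subrr !normr0 mulr0.
have nv : 0 < `|v| by rewrite normr_gt0.
(* The rescaled vector has norm [d / 2], which dominates [|y - x|]; the norm of the increment is
   then exactly [d / 2]. *)
pose c := d / 2 / `|v|; have c0 : 0 < c by rewrite !divr_gt0.
have ncv : `|c *: v| = d / 2.
  by rewrite normrZ gtr0_norm // /c divfK // gt_eqF.
have d2 : d / 2 < d by rewrite ltr_pdivrMr // ltr_pMr // ltr1n.
have yE : (y, c *: v) - (x, 0) = (y - x, c *: v) :> E * E.
  by rewrite -[LHS]/(_, _) /= subr0.
have bH : ball (x, 0) d (y, c *: v).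
  split; first by apply: le_ball xy; exact: ltW.
  by rewrite /= -ball_normE /= sub0r normrN ncv.
have := dH _ bH; rewrite /= yE linear0 subr0 (diff_diff0 _ _ oU sf Ux).
have -> : `|(y - x, c *: v)| = d / 2.
  rewrite norm_pair /= ncv max_r //.
  by move: xy; rewrite -ball_normE /= distrC => /ltW.
rewrite (linearZZ ('d f y)) (linearZZ ('d f x)) -scalerBr normrZ (gtr0_norm c0) -ler_pdivlMl // mulrC => /le_trans; apply.
by rewrite /c invfM invrK -[X in X <= _]mulrA mulVKf ?gt_eqF// divr_gt0.
Qed.

End differential.

(** * Mean value inequality, separability and countable images *)

Section real_analysis.
Context {R : realType}.
Implicit Types E F : normedModType R.

(** The supremum of the good points cannot stay below 1. The step jumps from a point on the left of
    [t] to one on its right, so [Q] need not be known at the supremum itself. *)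
Lemma real_induction (Q : R -> Prop) : Q 0 ->
  (forall t, 0 <= t <= 1 -> exists2 d, 0 < d & forall s s', 0 <= s ->
    t - d < s -> s <= t -> t <= s' -> s' < t + d -> s' <= 1 -> Q s -> Q s') ->
  Q 1.
Proof.
move=> Q0 step; pose S := [set t | 0 <= t <= 1 /\ Q t].
have S0 : S 0 by split=> //; rewrite lexx ler01.
have supS : has_sup S.
  by split; [exists 0|exists 1 => t [/andP[]]].
pose T := sup S.
have T0 : 0 <= T by apply: sup_upper_bound.
have T1 : T <= 1 by apply: ge_sup; [exists 0|move=> t [/andP[]]].
have [d d0 dP] : exists2 d, 0 < d & forall s s', 0 <= s ->
    T - d < s -> s <= T -> T <= s' -> s' < T + d -> s' <= 1 -> Q s -> Q s'.
  by apply: step; rewrite T0.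
have [s [/andP[s0 s1] Qs] sT] := sup_adherent d0 supS.
have sT' : s <= T by apply: sup_upper_bound => //; split=> //; rewrite s0.
pose s' := Order.min 1 (T + d / 2).
have Ts' : T <= s' by rewrite le_min T1 lerDl divr_ge0 // ltW.
have s'd : s' < T + d.
  by rewrite gt_min ltrD2l ltr_pdivrMr // ltr_pMr // ltr1n orbT.
have s'1 : s' <= 1 by rewrite ge_min lexx.
have Qs' : Q s' by apply: (dP s).
have : s' <= T.
  by apply: sup_upper_bound => //; split=> //; rewrite s'1 (le_trans T0).
rewrite ge_min => /orP[T1'|]; last by rewrite gerDl leNgt divr_gt0.
by move: Qs'; rewrite /s' min_l // (le_trans T1') // lerDl divr_ge0 // ltW.
Qed.

Lemma ball_segment E (x y z : E) r t : ball x r y -> ball x r z ->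
  0 <= t <= 1 -> ball x r (y + t *: (z - y)).
Proof.
rewrite -!ball_normE /= => xy xz /andP[t0 t1].
have -> : x - (y + t *: (z - y)) = (1 - t) *: (x - y) + t *: (x - z).
  have -> : z - y = (x - y) - (x - z) by rewrite opprB [RHS]addrC subrKA.
  by rewrite scalerBr scalerBl scale1r opprD opprB addrA addrA addrAC.
apply: le_lt_trans (ler_normD _ _) _; rewrite !normrZ ger0_norm ?subr_ge0// (ger0_norm t0).
have [->|tn0] := eqVneq t 0; first by rewrite subr0 mul0r addr0 mul1r.
have -> : r = (1 - t) * r + t * r by rewrite -mulrDl subrK mul1r.
rewrite ler_ltD// ?ler_wpM2l ?subr_ge0// ?ltW// ltr_pM2l//.
by rewrite lt_def tn0.
Qed.

(** Mean value inequality for vector values: real induction along the segment, with the slope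
    relaxed to [M + eta] so that the slack absorbs the remainder of differentiability. *)
Lemma lipschitz_diff E F (f : E -> F) x r (M : R) : 0 <= M ->
  (forall y, ball x r y -> differentiable f y) ->
  (forall y, ball x r y -> forall v, `|'d f y v| <= M * `|v|) ->
  forall y z, ball x r y -> ball x r z -> `|f z - f y| <= M * `|z - y|.
Proof.
move=> M0 df bd y z xy xz; apply/ler_addgt0Pr => e e0.
have nz : 0 < `|z - y| + 1 by rewrite ltr_wpDl.
(* The added 1 keeps the denominator positive; the total slack [eta * |z - y|] is then at most
   [e]. *)
pose eta := e / (`|z - y| + 1); have eta0 : 0 < eta by rewrite divr_gt0.
apply: (@le_trans _ _ ((M + eta) * `|z - y|)); last first.
  by rewrite mulrDl lerD2l /eta mulrAC ler_pdivrMr // ler_wpM2l ?lerDl // ltW.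
pose p t := y + t *: (z - y).
have : `|f (p 1) - f (p 0)| <= (M + eta) * (1 * `|z - y|); last first.
  by rewrite /p scale1r scale0r addr0 mul1r [y + _]addrC subrK.
have Me0 : 0 <= M + eta by rewrite addr_ge0 // ltW.
apply: (@real_induction (fun t => `|f (p t) - f (p 0)| <= (M + eta) * (t * `|z - y|))).
  by rewrite subrr normr0 mul0r mulr0.
move=> t t01.
have bp : ball x r (p t) by exact: ball_segment.
have /nbhs_ballP[d /= d0 dP] := diff_near (df _ bp) eta0.
have pB a b : p a - p b = (a - b) *: (z - y).
  by rewrite /p opprD addrACA subrr add0r scalerBl.
have near_p s : `|s - t| < d / (`|z - y| + 1) ->
    `|f (p s) - f (p t)| <= (M + eta) * (`|s - t| * `|z - y|).
  move=> st; have : ball (p t) d (p s).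
    rewrite -ball_normE /= pB normrZ distrC.
    apply: le_lt_trans (_ : `|s - t| * (`|z - y| + 1) < _).
      by rewrite ler_wpM2l // lerDl.
    by rewrite -ltr_pdivlMr.
  move=> /dP; rewrite pB normrZ => H.
  rewrite -[f _ - _](subrK ('d f (p t) ((s - t) *: (z - y)))) mulrDl addrC.
  apply: le_trans (ler_normD _ _) _; apply: lerD => //.
  by apply: le_trans (bd _ bp _) _; rewrite normrZ.
exists (d / (`|z - y| + 1)); first by rewrite divr_gt0.
move=> s s' s0 ds st ts' ds' s'1 Qs.
have h1 := near_p s; have h2 := near_p s'.
have {}h1 : `|f (p s) - f (p t)| <= (M + eta) * ((t - s) * `|z - y|).
  rewrite -[t - s]ger0_norm ?subr_ge0// [`|t - s|]distrC; apply: h1.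
  by rewrite distrC ger0_norm ?subr_ge0// ltrBlDr -ltrBlDl.
have {}h2 : `|f (p s') - f (p t)| <= (M + eta) * ((s' - t) * `|z - y|).
  rewrite -[s' - t]ger0_norm ?subr_ge0//; apply: h2.
  by rewrite ger0_norm ?subr_ge0// ltrBlDl.
have -> : f (p s') - f (p 0) =
    (f (p s') - f (p t)) + ((f (p t) - f (p s)) + (f (p s) - f (p 0))).
  by rewrite addrA subrKA subrKA.
apply: le_trans (ler_normD _ _) _.
apply: (@le_trans _ _ ((M + eta) * ((s' - t) * `|z - y|) +
   ((M + eta) * ((t - s) * `|z - y|) + (M + eta) * (s * `|z - y|)))).
  apply: lerD => //; apply: le_trans (ler_normD _ _) _; apply: lerD => //.
  by rewrite distrC.
by rewrite -!mulrDr -!mulrDl subrK subrK.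
Qed.

Lemma diff0_locally_constant E F (f : E -> F) U x : open U -> U x ->
  (forall y, U y -> differentiable f y) ->
  (forall y, U y -> forall v, 'd f y v = 0) -> \forall y \near x, f y = f x.
Proof.
move=> oU Ux df d0.
have /nbhs_ballP[r /= r0 rP] := open_nbhs_nbhs (conj oU Ux).
apply/nbhs_ballP; exists r => // y xy; apply/eqP; rewrite -subr_eq0 -normr_le0.
rewrite -(mul0r `|y - x|); apply: (@lipschitz_diff _ _ _ x r) => //.
- by move=> z /rP; exact: df.
- by move=> z /rP Uz v; rewrite d0 // normr0 mul0r.
- exact: ballxx.
Qed.

(** Each level set is open in [U], hence meets the countable dense set. *)
Lemma locally_constant_countable (T : topologicalType) (S : Type) (f : T -> S) U :
  separable_space T -> open U ->
  (forall x, U x -> \forall y \near x, f y = f x) -> countable (f @` U).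
Proof.
move=> [D cD dD] oU lc.
suff -> : f @` U = f @` (D `&` U).
  apply: sub_countable (card_image_le _ _) _; apply: sub_countable cD.
  by apply: subset_card_le; exact: subIsetl.
apply/seteqP; split=> [_ [x Ux <-]|_ [x [_ Ux] <-]]; last by exists x.
have : nbhs x (U `&` [set y | f y = f x]).
  by apply: filterI; [exact: open_nbhs_nbhs|exact: lc].
rewrite nbhsE => -[V [oV Vx] VU].
have [y [Vy Dy]] : V `&` D !=set0 by apply: dD => //; exists x.
by have [Uy yx] := VU _ Vy; exists y.
Qed.

Lemma separable_prod (S T : topologicalType) :
  separable_space S -> separable_space T -> separable_space (S * T)%type.
Proof.
move=> [D cD dD] [D' cD' dD']; exists (D `*` D'); first exact: countableX.
move=> O [[x y] Oxy] oO.
have /= [[P Q] [/= Px Qy] PQ] := open_nbhs_nbhs (conj oO Oxy).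
move: Px Qy; rewrite !nbhsE => -[P' [oP P'x] P'P] [Q' [oQ Q'y] Q'Q].
have [a [Pa Da]] : P' `&` D !=set0 by apply: dD => //; exists x.
have [b [Qb Db]] : Q' `&` D' !=set0 by apply: dD' => //; exists y.
by exists (a, b); split => //; apply: PQ; split; [exact: P'P|exact: Q'Q].
Qed.

(** Otherwise the distance to [phi a] would, by the intermediate value theorem, fill an interval of
    positive Lebesgue measure with countably many values. *)
Lemma countable_continuous_constant E (phi : R -> E) (a b : R) :
  a <= b -> {within `[a, b], continuous phi} -> countable (phi @` `[a, b]) ->
  phi b = phi a.
Proof.
move=> ab cphi cI.
pose n t := `|phi t - phi a|.
have cn : {within `[a, b], continuous n}.
  by move=> t; apply: cvg_norm; apply: cvgB; [exact: cphi|exact: cvg_cst].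
apply/eqP; rewrite -subr_eq0 -normr_eq0 -/(n b); apply/negP => /negP nb0.
have nb : 0 < n b by rewrite lt_def nb0 normr_ge0.
have na : n a = 0 by rewrite /n subrr normr0.
have sub : `[0, n b]%classic `<=` (fun y => `|y - phi a|) @` (phi @` `[a, b]).
  move=> v /=; rewrite in_itv /= => vb.
  have [|t tab <-] := @IVT R n a b v ab cn.
    by rewrite na min_l ?max_r // ltW.
  by exists (phi t) => //; exists t.
have := countable_lebesgue_measure0 (sub_countable (subset_card_le sub) (sub_countable (card_image_le _ _) cI)).
rewrite lebesgue_measure_itv /= lte_fin nb oppr0 adde0 => -[nb'].
by rewrite nb' ltxx in nb.
Qed.
End real_analysis.

(** * Baire category and the closed graph theorem *)

Section completeness.
Context {R : realType}.

Lemma exists_geometric_lt (c e : R) : 0 < e -> exists n, c * 2^-1 ^+ n < e.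
Proof.
move=> e0; have [c0|c0] := ltP 0 c; last first.
  by exists 0%N; rewrite expr0 mulr1; exact: le_lt_trans e0.
exists (Num.truncn (c / e)).+1.
rewrite exprVn ltr_pdivrMr ?exprn_gt0// mulrC -ltr_pdivrMr//.
apply: lt_trans (truncnS_gt _) _.
by rewrite -natrX ltr_nat ltn_expl.
Qed.

Lemma closed_approx (T : normedModType R) (A : set T) p : closed A ->
  (forall e, 0 < e -> exists2 q, A q & `|p - q| < e) -> A p.
Proof.
move=> cA H; apply: cA => B /nbhs_ballP[e /= e0 eB].
by have [q Aq pq] := H e e0; exists q; split=> //; apply: eB; rewrite -ball_normE.
Qed.

Lemma dominated_sequence_limit (T : completeNormedModType R) (a : nat -> T) (r : nat -> R) :
  (forall n m, (n <= m)%N -> `|a n - a m| <= r n) ->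
  (forall e, 0 < e -> exists n, r n < e) ->
  exists l, forall n, `|a n - l| <= r n.
Proof.
move=> ar r0.
have : cvg (a @ \oo).
  suff : cauchy_ex (a @ \oo) by move=> ?; apply: cauchy_cvg; exact: cauchy_exP.
  move=> e e0; have [n rn] := r0 _ e0.
  exists (a n); rewrite /fmapE -ball_normE; exists n => // m /= nm.
  exact: le_lt_trans (ar _ _ nm) rn.
rewrite cvg_ex => -[l /cvgrPdist_lt Hl]; exists l => n.
apply/ler_addgt0Pr => e e0; have [m _ mP] := Hl e e0.
have h := mP _ (leq_maxr n m).
rewrite -[a n - l](subrKA (a (maxn n m))) (le_trans (ler_normD _ _))// lerD //.
  by apply: ar; exact: leq_maxl.
by rewrite distrC ltW.
Qed.

(** Baire's theorem relative to [C]. If no [N n] contained a relatively open piece of [C], there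
    would be shrinking nested closed balls centred in [C], the successive ones avoiding [N 0],
    [N 1], and so on; the limit of the centres lies in [C] and in no [N n]. *)
Lemma Baire_closed (T : completeNormedModType R) (C : set T) (N : nat -> set T) :
  closed C -> C !=set0 -> (forall n, closed (N n)) -> C `<=` \bigcup_n N n ->
  exists n a r, [/\ C a, 0 < r & ball a r `&` C `<=` N n].
Proof.
move=> cC [c0 Cc0] cN CN; apply: contrapT => H.
(* A pair is a centre and a radius: the closed ball [q] lies in the closed ball [p] and misses
   [N n]. *)
pose P n (p q : T * R) := [/\ C q.1, 0 < q.2, q.2 < n.+1%:R^-1 &
  forall z, `|q.1 - z| <= q.2 -> `|p.1 - z| <= p.2 /\ ~ N n z].
have step (np : nat * (T * R)) : exists q, C np.2.1 -> 0 < np.2.2 -> P np.1 np.2 q.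
  case: np => n [a r] /=; have [Ca|] := pselect (C a); last by exists (a, r).
  have [r0|] := ltP 0 r; last by exists (a, r).
  have [y [[ay Cy] nNy]] : exists y, (ball a r `&` C) y /\ ~ N n y.
    apply: contrapT => H'; apply: H; exists n, a, r; split=> // y Hy.
    by apply: contrapT => nNy; apply: H'; exists y.
  have : nbhs y (ball a r `&` ~` N n).
    apply: filterI; last by apply: open_nbhs_nbhs; split => //; exact: closed_openC.
    by apply: open_nbhs_nbhs; split => //; exact: ball_open.
  move=> /nbhs_ballP[d /= d0 dP].
  exists (y, Order.min (d / 2) (n.+2%:R^-1)) => _ _; split=> //=.
  - by rewrite lt_min divr_gt0 //= invr_gt0.
  - by rewrite gt_min ltf_pV2 ?posrE ?ltr_nat ?ltnSn ?orbT.
  - move=> z; rewrite le_min => /andP[yz _].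
    have [] : (ball a r `&` ~` N n) z.
      apply: dP; rewrite -ball_normE /=; apply: le_lt_trans yz _.
      by rewrite ltr_pdivrMr // ltr_pMr // ltr1n.
    by rewrite -ball_normE /= => /ltW.
have [f fP] := choice step.
pose s := fix s n := if n is m.+1 then f (m, s m) else (c0, 1).
have sP n : C (s n).1 /\ 0 < (s n).2.
  by elim: n => [|n [h1 h2]] //=; have [] := fP (n, s n) h1 h2.
have sS n : P n (s n) (s n.+1) by have [h1 h2] := sP n; exact: (fP (n, s n)).
have nest n m : (n <= m)%N -> forall z, `|(s m).1 - z| <= (s m).2 -> `|(s n).1 - z| <= (s n).2.
  elim: m => [|m IH]; first by rewrite leqn0 => /eqP ->.
  rewrite leq_eqVlt => /orP[/eqP -> //|/IH h z hz]; apply: h.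
  by have [_ _ _ /(_ z hz)[]] := sS m.
have [|e e0|l lP] := @dominated_sequence_limit _ (fun n => (s n).1) (fun n => (s n).2).
- by move=> n m nm /=; apply: (nest _ _ nm); rewrite subrr normr0 ltW; case: (sP m).
- have [n ne] : exists n, n.+1%:R^-1 < e.
    exists (Num.truncn e^-1).
    by rewrite -ltf_pV2 ?(posrE,invr_gt0)// invrK truncnS_gt.
  by exists n.+1; have [_ _ h _] := sS n; exact: lt_trans h ne.
have Cl : C l.
  apply: closed_approx => // e e0.
  have [n ne] : exists n, n.+1%:R^-1 < e.
    exists (Num.truncn e^-1).
    by rewrite -ltf_pV2 ?(posrE,invr_gt0)// invrK truncnS_gt.
  exists (s n.+1).1; first by case: (sP n.+1).
  rewrite distrC; apply: le_lt_trans (lP n.+1) _.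
  by have [_ _ h _] := sS n; exact: lt_trans h ne.
have [n _ Nl] := CN _ Cl.
by have [_ _ _ /(_ l (lP n.+1))[]] := sS n.
Qed.

(** By Baire, some closure [A n] contains a ball. Hence every [x] is approximated within half its
    norm by some [x'] with [f x'] bounded by a multiple of [|x|]. Summing the successive
    approximations bounds the limit of the images, and the closed graph identifies this limit with
    [f x]. *)
Theorem closed_graph (E F : completeNormedModType R) (f : {linear E -> F}) :
  closed [set p : E * F | p.2 = f p.1] -> continuous f.
Proof.
move=> cf.
pose A (n : nat) := closure [set x | `|f x| <= n%:R].
have [||||n [a [r [_ r0 rP]]]] := @Baire_closed E setT A.
- exact: closedT.
- by exists 0.
- by move=> n; exact: closed_closure.
- move=> x _; exists (Num.truncn `|f x|).+1 => //; apply: subset_closure => /=.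
  by rewrite ltW // truncnS_gt.
(* The approximation is a difference of two points of the set defining [A n], whence [2 * n%:R],
   scaled by [2 / r] times the norm of [x]; the added 1 makes [K] positive. *)
pose K := (2 * n%:R + 1) * (2 / r).
have K0 : 0 < K by rewrite mulr_gt0 ?divr_gt0// ltr_wpDl// mulr_ge0.
have half x : exists x', `|x - x'| <= `|x| * 2^-1 /\ `|f x'| <= K * `|x|.
  have [->|x0] := eqVneq x 0.
    by exists 0; rewrite (linear0 f) subrr !normr0 mul0r mulr0.
  have nx : 0 < `|x| by rewrite normr_gt0.
  pose c := r / 2 / `|x|; have c0 : 0 < c by rewrite !divr_gt0.
  have ncx : `|c *: x| = r / 2 by rewrite normrZ gtr0_norm // /c divfK // gt_eqF.
  have approx y d : 0 < d -> ball a r y -> exists2 u, `|f u| <= n%:R & `|y - u| < d.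
    move=> d0 ay; have /(_ (ball y d))[] := rP y (conj ay I).
      by apply/nbhs_ballP; exists d.
    by move=> u [fu]; rewrite -ball_normE; exists u.
  have d0 : 0 < c * `|x| / 4 by apply: divr_gt0; [exact: mulr_gt0|rewrite ltr0n].
  have [|u fu au] := approx (a + c *: x) _ d0.
    rewrite -ball_normE /= opprD addNKr normrN ncx.
    by rewrite ltr_pdivrMr // ltr_pMr // ltr1n.
  have [u' fu' au'] := approx a _ d0 (ballxx _ r0).
  exists (c^-1 *: (u - u')); split.
    have cn0 : c != 0 by rewrite gt_eqF.
    rewrite -[x in `|x - _|](scalerK cn0) -scalerBr normrZ gtr0_norm ?invr_gt0//.
    rewrite ler_pdivrMl //.
    have -> : c *: x - (u - u') = (a + c *: x - u) - (a - u').
      by rewrite [in RHS]opprD opprK addrACA [a + _]addrC addrK opprB [- u + _]addrC.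
    apply: le_trans (ler_normB _ _) _.
    apply: le_trans (lerD (ltW au) (ltW au')) _.
    rewrite -mulrDr mulrA ler_wpM2l //; first by rewrite mulr_ge0 // ltW.
    by rewrite -[X in X + X]mul1r -mulrDl -[4]/(2 * 2)%:R natrM invfM mulrA mulfV // mul1r.
  rewrite linearZZ normrZ gtr0_norm ?invr_gt0// ler_pdivrMl//.
  have -> : c * (K * `|x|) = 2 * n%:R + 1.
    by rewrite /c /K; field; rewrite !gt_eqF.
  rewrite linearB (le_trans (ler_normB _ _))// (le_trans (lerD fu fu'))//.
  by rewrite mulr_natl mulr2n lerDl.
clearbody K; have [g gP] := choice half.
apply: (@lipschitz_linear_continuous _ _ _ _ (2 * K)); first by rewrite mulr_gt0.
move=> x.
(* [s k] is the remainder after [k] corrections, so [t k] is the image of the partial sum. *)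
pose s := fix s k := if k is m.+1 then s m - g (s m) else x.
have sb k : `|s k| <= `|x| * 2^-1 ^+ k.
  elim: k => [|k IH] /=; first by rewrite expr0 mulr1.
  apply: le_trans (gP _).1 _; rewrite exprSr mulrA.
  by rewrite ler_wpM2r // invr_ge0.
pose t k := f (x - s k).
have tS k : `|t k - t k.+1| <= (K * `|x|) * 2^-1 ^+ k.
  rewrite /t -linearB /=; have -> : x - s k - (x - (s k - g (s k))) = - g (s k).
    by rewrite opprB addrC subrKA addrAC subrr sub0r.
  rewrite linearN normrN -mulrA; apply: le_trans (gP _).2 _.
  by rewrite ler_wpM2l // ltW.
have tb n' m : (n' <= m)%N -> `|t n' - t m| <= 2 * K * `|x| * 2^-1 ^+ n'.
  move=> nm; rewrite -(subnKC nm).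
  suff H j : `|t n' - t (n' + j)%N| <= 2 * K * `|x| * (2^-1 ^+ n' - 2^-1 ^+ (n' + j)).
    apply: le_trans (H _) _; rewrite ler_wpM2l //; first by rewrite !mulr_ge0 // ltW.
    by rewrite gerBl exprn_ge0 // invr_ge0.
  elim: j => [|j IH]; first by rewrite addn0 !subrr normr0 mulr0.
  rewrite addnS -[t n' - _](subrKA (t (n' + j)%N)) (le_trans (ler_normD _ _))//.
  apply: le_trans (lerD IH (tS _)) _.
  by rewrite exprS le_eqVlt; apply/orP; left; apply/eqP; field.
have [||l lP] := @dominated_sequence_limit _ t (fun k => 2 * K * `|x| * 2^-1 ^+ k).
- exact: tb.
- by move=> e; exact: exists_geometric_lt.
have -> : f x = l.
  suff : [set p : E * F | p.2 = f p.1] (x, l) by move=> /= ->.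
  apply: closed_approx cf _ => e e0.
  have [n1 n1P] := exists_geometric_lt (2 * K * `|x|) e0.
  have [n2 n2P] := exists_geometric_lt `|x| e0.
  exists (x - s (maxn n1 n2), t (maxn n1 n2)) => //.
  have mono (c : R) i j : 0 <= c -> (i <= j)%N -> c * 2^-1 ^+ j <= c * 2^-1 ^+ i.
    by move=> c0 ij; rewrite ler_wpM2l // ler_wiXn2l // invf_le1 // ler1n.
  rewrite norm_pair /= gt_max subKr distrC; apply/andP; split.
    by apply: le_lt_trans n2P; apply: le_trans (sb _) _; rewrite mono ?leq_maxr.
  apply: le_lt_trans n1P; apply: le_trans (lP _) _.
  by rewrite mono ?leq_maxl // !mulr_ge0 // ltW.
by have := lP 0%N; rewrite /t /= subrr (linear0 f) sub0r normrN expr0 mulr1.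
Qed.
End completeness.

(** * The inverse function theorem *)

Section inverse_function.
Context {R : realType}.
Implicit Types E F G : normedModType R.

(** The differential of a tangent map is block triangular, with ['d f x] twice on the diagonal and
    the second derivative below it. *)
Lemma diff_tangent E F (U : set E) (f : E -> F) x v a b : open U -> smooth U f -> U x ->
  'd (fun p : E * E => (f p.1, 'd f (p.1) p.2)) (x, v) (a, b) =
  ('d f x a, 'd (fun p : E * E => 'd f (p.1) p.2) (x, v) (a, 0) + 'd f x b).
Proof.
move=> oU sf Ux.
have dd : differentiable (fun p : E * E => 'd f (p.1) p.2) (x, v).
  by apply: smooth_differentiable (smooth_diff oU sf) _.
have dfx := smooth_differentiable sf Ux.
have [d1 dE1] := diff_fst (x, v).
have df1 : differentiable (fun p : E * E => f p.1) (x, v) by exact: differentiable_comp.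
rewrite diff_pair //=; congr pair.
  by rewrite (@diff_comp _ _ _ _ fst f) //= dE1.
rewrite (diff_split (a, b) dd) /=; congr (_ + _).
have [_ <-] := diff_inr dd; rewrite /=.
have -> : (fun w => 'd f x w) = 'd f x :> (E -> F) by [].
by rewrite diff_lin //; apply: diff_continuous.
Qed.

Lemma inverse_differentiable E F (f : E -> F) (g : F -> E) (S : {linear F -> E}) y :
  differentiable f (g y) -> {for y, continuous g} ->
  (\forall z \near y, f (g z) = z) -> continuous S ->
  (forall v, S ('d f (g y) v) = v) ->
  differentiable g y /\ 'd g y = S :> (F -> E).
Proof.
move=> df cg fg cS SK; apply: near_differentiable => // e e0.
have [c c0 Sc] := linear_lipschitz cS.
(* The first bound lets half of [|g z - g y|] be absorbed, which makes [g] Lipschitz at [y] with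
   constant [2 * c]; the second turns that estimate into the error [e]. *)
pose eta := Order.min (2 * c)^-1 (e / (2 * c ^+ 2)).
have eta0 : 0 < eta by rewrite lt_min invr_gt0 divr_gt0 ?mulr_gt0 ?exprn_gt0.
have ceta : c * eta <= 2^-1.
  rewrite mulrC -ler_pdivlMr // -invfM ge_min lexx //.
have ceta2 : c * eta * (2 * c) <= e.
  have -> : c * eta * (2 * c) = eta * (2 * c ^+ 2) by ring.
  by rewrite -ler_pdivlMr ?mulr_gt0 ?exprn_gt0// ge_min lexx orbT.
have fgy := nbhs_singleton fg.
have := diff_near df eta0 => /(cg _); rewrite nbhs_simpl => near_g.
near=> z.
have fgz : f (g z) = z by near: z.
have : `|f (g z) - f (g y) - 'd f (g y) (g z - g y)| <= eta * `|g z - g y|.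
  by near: z.
rewrite fgz fgy => h.
have hS : `|g z - g y - S (z - y)| <= c * eta * `|g z - g y|.
  rewrite -[X in X - _](SK (g z - g y)) -linearB -normrN -linearN opprB.
  by apply: le_trans (Sc _) _; rewrite -mulrA ler_wpM2l // ltW.
apply: (le_trans hS).
have h2 : `|g z - g y| <= 2 * c * `|z - y|.
  have h1 : `|g z - g y| <= c * `|z - y| + 2^-1 * `|g z - g y|.
    rewrite -[X in `|X| <= _](subrK (S (z - y))) addrC.
    apply: le_trans (ler_normD _ _) _; apply: lerD; first exact: Sc.
    by apply: le_trans hS _; rewrite ler_wpM2r.
  lra.
apply: le_trans (ler_wpM2l _ h2) _; first by rewrite mulr_ge0 // ltW.
by rewrite mulrA ler_wpM2r.
Unshelve. all: by end_near. Qed.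

Definition has_inverse E F (L : E -> F) := exists S : {linear F -> E},
  [/\ continuous S, forall v, L (S v) = v & forall v, S (L v) = v].

(** The differential of [g] inverts that of [f]. Its joint continuity is estimated on vectors, in
    the form in which the [Ck] tower asks for it. *)
Lemma inverse_diff_continuous E F (U : set E) (f : E -> F) (V : set F) (g : F -> E) :
  open U -> open V -> smooth U f ->
  (forall y, V y -> U (g y) /\ f (g y) = y) ->
  (forall y, V y -> {for y, continuous g}) ->
  (forall x, U x -> has_inverse ('d f x)) ->
  forall y, V y -> [/\ differentiable g y, forall w, 'd f (g y) ('d g y w) = w &
    forall w, {for (y, w), continuous (fun p : F * F => 'd g (p.1) p.2)}].
Proof.
move=> oU oV sf fg cg inv.
have dg y : V y -> differentiable g y /\ forall w, 'd f (g y) ('d g y w) = w.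
  move=> Vy; have [Ugy fgy] := fg y Vy; have [S [cS DS SD]] := inv _ Ugy.
  have [|dgy ->] := @inverse_differentiable _ _ f g S y (smooth_differentiable sf Ugy) (cg _ Vy) _ cS SD.
    by apply: filterS (open_nbhs_nbhs (conj oV Vy)) => z /fg[].
  by split.
move=> y Vy; have [dgy fdg] := dg y Vy; split=> // w.
have [Ugy fgy] := fg y Vy; have [S [cS DS SD]] := inv _ Ugy.
have [c c0 Sc] := linear_lipschitz cS.
apply/cvgrPdist_lt => e e0 /=.
set v0 := 'd g y w.
pose eta := Order.min (2 * c)^-1 (e / (8 * c * (`|v0| + 1))).
have v01 : 0 < `|v0| + 1 by rewrite ltr_wpDl.
have eta0 : 0 < eta by rewrite lt_min invr_gt0 divr_gt0 ?mulr_gt0.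
have ceta : c * eta <= 2^-1.
  by rewrite mulrC -ler_pdivlMr // -invfM ge_min lexx.
have ceta2 : 2 * c * eta * `|v0| <= e / 4.
  apply: (@le_trans _ _ (2 * c * eta * (`|v0| + 1))).
    by rewrite ler_wpM2l ?lerDl // !mulr_ge0 // ltW.
  have -> : 2 * c * eta * (`|v0| + 1) = eta * (8 * c * (`|v0| + 1)) / 4 by field.
  by rewrite ler_pM2r ?invr_gt0// -ler_pdivlMr ?mulr_gt0// ge_min lexx orbT.
have := diff_near_norm oU sf Ugy eta0 => /(cg _ Vy); rewrite nbhs_simpl => near_g.
have near_V : \forall z \near y, V z by exact: open_nbhs_nbhs.
have near_w : \forall w' \near w, `|w - w'| < e / (4 * c).
  by apply: (@cvgr_dist_lt _ _ _ (nbhs w) _ id w); [exact: cvg_id|rewrite divr_gt0 ?mulr_gt0].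
have nV : \forall p \near (y, w), V p.1 by exact: (@fst_continuous _ F F (y, w)).
have ng : \forall p \near (y, w), forall v, `|'d f (g p.1) v - 'd f (g y) v| <= eta * `|v|.
  by have := @fst_continuous _ F F (y, w) _ near_g.
have nw : \forall p \near (y, w), `|w - p.2| < e / (4 * c).
  by have := @snd_continuous _ F F (y, w) _ near_w.
apply: filterS3 nV ng nw => -[z u] /= Vz gz uw.
set v := 'd g z u; have [_ fdgz] := dg z Vz.
(* [S] inverts ['d f (g y)], which sends [v0] to [w], while ['d f (g z)] sends [v] to [u]. *)
have E0 : v - v0 = S ((u - w) - ('d f (g z) v - 'd f (g y) v)).
  have Sw : S w = v0 by rewrite -(fdg w) SD.
  by rewrite [in 'd f (g z) v]/v fdgz opprB [X in S X]addrC subrKA linearB SD Sw.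
have h1 : `|v - v0| <= c * (e / (4 * c)) + c * eta * `|v|.
  rewrite E0 -mulrA -mulrDr; apply: (le_trans (Sc _)); rewrite ler_pM2l//.
  by rewrite (le_trans (ler_normB _ _))// lerD // distrC ltW.
have h2 : `|v| <= `|v - v0| + `|v0| by rewrite -{1}(subrK v0 v) ler_normD.
have h3 : c * (e / (4 * c)) = e / 4 by field; rewrite gt_eqF.
have h4 : c * eta * `|v| <= 2^-1 * `|v - v0| + c * eta * `|v0|.
  apply: (le_trans (ler_wpM2l _ h2)); first by rewrite mulr_ge0 // ltW.
  by rewrite mulrDr lerD2r ler_wpM2r.
rewrite distrC; move: h1 h4 ceta2; rewrite h3.
have -> : 2 * c * eta * `|v0| = 2 * (c * eta * `|v0|) by ring.
move: (c * eta * `|v0|) (c * eta * `|v|) => A B.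
lra.
Qed.

(** Back substitution in the block triangular differential of [diff_tangent]; [Q] is its
    off-diagonal block. *)
Lemma has_inverse_tangent E F (U : set E) (f : E -> F) x v : open U -> smooth U f -> U x ->
  has_inverse ('d f x) ->
  has_inverse ('d (fun p : E * E => (f p.1, 'd f (p.1) p.2)) (x, v)).
Proof.
move=> oU sf Ux [S [cS DS SD]].
pose Q a := 'd (fun p : E * E => 'd f (p.1) p.2) (x, v) (a, 0).
have dd : differentiable (fun p : E * E => 'd f (p.1) p.2) (x, v).
  by apply: smooth_differentiable (smooth_diff oU sf) _.
have [c c0 Sc] := linear_lipschitz cS.
have [k k0 Qk] := diff_lipschitz dd.
pose T (p : F * F) : E * E := (S p.1, S (p.2 - Q (S p.1))).
have QE (p : E) : Q p = ('d (fun p : E * E => 'd f (p.1) p.2) (x, v) \o @inl0 _ E E) p by [].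
have QL r a b : Q (r *: a + b) = r *: Q a + Q b by rewrite !QE linearP.
have Tl : linear T.
  move=> r p q; rewrite /T /= -[RHS]/(_, _) /=; congr pair; first exact: linearP.
  by rewrite (linearP S) QL -[RHS](linearP S) scalerBr opprD addrACA.
pose TL : {linear (F * F)%type -> (E * E)%type} :=
  HB.pack T (GRing.isLinear.Build _ _ _ _ _ Tl).
exists TL; split=> /=.
- apply: (@lipschitz_linear_continuous _ _ _ TL (c * (1 + k * c) + c)) => [|p /=].
    by rewrite ltr_wpDl // mulr_ge0 ?addr_ge0 ?mulr_ge0 // ltW.
  have c1 : `|S p.1| <= c * `|p| by rewrite (le_trans (Sc _))// ler_pM2l// norm_fst.
  rewrite (le_trans (norm_pair_le _))//= mulrDl [leRHS]addrC lerD //.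
  rewrite (le_trans (Sc _))// -mulrA ler_pM2l// mulrDl mul1r.
  rewrite (le_trans (ler_normB _ _))// lerD ?norm_snd//.
  rewrite (le_trans (Qk _))// -mulrA ler_pM2l//.
  by have := norm_inl0 E (S p.1); rewrite /inl0 => ->.
- move=> [p q]; rewrite /T (diff_tangent v _ _ oU sf Ux) /= !DS.
  by rewrite -/(Q _) addrC subrK.
- move=> [p q]; rewrite (diff_tangent v _ _ oU sf Ux) /T /= !SD.
  by rewrite -/(Q _) addrC addKr SD.
Qed.

Lemma continuous_pair_at (S T W : topologicalType) (f : S -> T) (g : S -> W) x :
  {for x, continuous f} -> {for x, continuous g} ->
  {for x, continuous (fun p => (f p, g p))}.
Proof.
move=> cf cg A [[P Q] /= [Pf Qg] PQ]; have Pf' : nbhs x (f @^-1` P) := cf _ Pf.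
have Qg' : nbhs x (g @^-1` Q) := cg _ Qg.
by apply: filterS (filterI Pf' Qg') => z [Pz Qz]; exact: (PQ (f z, g z)).
Qed.

Lemma near_inl0 E F (a : E) (S : E * F -> Prop) :
  (\forall q \near (a, 0 : F), S q) -> \forall b \near a, S (b, 0).
Proof.
move=> nS; have cp : {for a, continuous (fun b : E => (b, 0 : F))}.
  by apply: continuous_pair_at; [exact: cvg_id|exact: cvg_cst].
exact: (cp _ nS).
Qed.

Lemma near_affine_comp E F G (g : E -> F) (L : {linear F -> G}) b x y (S : G -> Prop) :
  differentiable g x -> continuous L -> b + L (g x) = y ->
  (\forall z \near y, S z) -> \forall z \near x, S (b + L (g z)).
Proof.
move=> dg cL <- nS.
have [dA _] := diff_affine b (g x) cL.
exact: (differentiable_continuous (differentiable_comp dg dA) nS).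
Qed.

Lemma diff_right_inverse E F (f : E -> F) (g : F -> E) y w :
  (\forall z \near y, f (g z) = z) -> differentiable g y -> differentiable f (g y) ->
  'd f (g y) ('d g y w) = w.
Proof.
move=> fg dg df; have dfg := differentiable_comp dg df.
have [||_ eq] := @near_diff_eq _ _ _ (f \o g) idfun y; [exact: fg|exact: dfg|].
have := congr1 (fun k => k w) (diff_comp dg df).
by rewrite /= -eq diff_val.
Qed.

Lemma near_fst E F (a : E) (b : F) (S : E -> Prop) :
  (\forall x \near a, S x) -> \forall q \near (a, b), S q.1.
Proof. by move=> nS; exact: (@fst_continuous _ E F (a, b) _ nS). Qed.

Lemma open_slice E F (a : E) (S : set (E * F)) : open S -> open [set v | S (a, v)].
Proof.
move=> oS; apply: (@open_comp _ _ (fun v : F => (a, v))) oS => v _.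
by apply: continuous_pair_at; [exact: cvg_cst|exact: cvg_id].
Qed.

Lemma diff_prod_id E F G (f : E -> F) v (w : G) : differentiable f v ->
  differentiable (fun p : E * G => (f p.1, p.2)) (v, w) /\
  forall v' w', 'd (fun p : E * G => (f p.1, p.2)) (v, w) (v', w') = ('d f v v', w').
Proof.
move=> df; have [d1 dE1] := diff_fst (v, w).
have c2 : continuous (snd : E * G -> G) by exact: snd_continuous.
have d2 : differentiable (snd : E * G -> G) (v, w) by exact: linear_differentiable.
have df1 : differentiable (fun p : E * G => f p.1) (v, w) by exact: differentiable_comp.
split=> [|v' w']; first exact: differentiable_pair.
rewrite diff_pair //= diff_lin //; congr pair.
by rewrite (@diff_comp _ _ _ _ fst f) //= dE1.
Qed.

(** The composite of [k] with [f] times the identity has zero differential on an open set, so it is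
    locally constant there. The spectator variable in [G] will hold the vector needed to return to
    the original curve. *)
Lemma countable_slices E F G G' (f : E -> F) (k : F * G -> G') (U : set E) (V : set (F * G)) :
  separable_space E -> separable_space G -> open U -> open V ->
  (forall v, U v -> differentiable f v) -> (forall q, V q -> differentiable k q) ->
  (forall v w, U v -> V (f v, w) -> forall v' w', 'd k (f v, w) ('d f v v', w') = 0) ->
  countable ((fun p => k (f p.1, p.2)) @` [set p | U p.1 /\ V (f p.1, p.2)]).
Proof.
move=> sE sG oU oV df dk k0.
pose phi (p : E * G) := (f p.1, p.2).
have dphi p : U p.1 -> differentiable phi p.
  by case: p => v w Uv; have [] := diff_prod_id w (df _ Uv).
have oZ : open [set p | U p.1 /\ V (phi p)].
  rewrite openE => -[v w] [/= Uv Vv]; apply: filterI.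
    exact: near_fst (open_nbhs_nbhs (conj oU Uv)).
  exact: (differentiable_continuous (dphi (v, w) Uv) (open_nbhs_nbhs (conj oV Vv))).
apply: locally_constant_countable; [exact: separable_prod|exact: oZ|].
move=> p Zp; apply: (diff0_locally_constant oZ Zp) => -[v w] [/= Uv Vv].
  by apply: (@differentiable_comp _ _ _ _ phi k); [exact: dphi|exact: dk].
move=> [v' w'].
rewrite (@diff_comp _ _ _ _ phi k) //=; [|exact: dphi|exact: dk].
by have [_ ->] := diff_prod_id w (df _ Uv); exact: k0.
Qed.

(** The tangent map of [g] inverts the tangent map of [f], so the induction hypothesis applies to
    the pair of tangent maps. *)
Lemma inverse_Ck k E F (U : set E) (f : E -> F) (V : set F) (g : F -> E) :
  open U -> open V -> smooth U f ->
  (forall y, V y -> U (g y) /\ f (g y) = y) ->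
  (forall y, V y -> {for y, continuous g}) ->
  (forall x, U x -> has_inverse ('d f x)) -> Ck k V g.
Proof.
elim: k E F U f V g => [|k IH] E F U f V g oU oV sf fg cg inv //=.
have H := inverse_diff_continuous oU oV sf fg cg inv.
split=> [y /H[]//|].
apply: (IH _ _ (U `*` setT) (fun p : E * E => (f p.1, 'd f (p.1) p.2))).
- exact: open_setXT.
- exact: open_setXT.
- exact: smooth_tangent.
- by move=> [y w] [/= Vy _]; have [_ -> _] := H _ Vy; have [? ->] := fg _ Vy.
- move=> [y w] [/= Vy _]; have [_ _ cdg] := H _ Vy.
  apply: continuous_pair_at.
    by apply: (@continuous_comp _ _ _ fst g); [exact: fst_continuous|exact: cg].
  exact: cdg.
- by move=> [x v] [/= Ux _]; apply: has_inverse_tangent oU _ _ _ => //; exact: inv.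
Qed.

(** The contraction is known only on the ball of radius [r]; a first displacement of at most [r / 2]
    keeps all iterates inside, since the geometric series sums to [r]. *)
Lemma contraction_fixed_point (E : completeNormedModType R) (phi : E -> E) a (r : R) :
  (forall x y, `|x - a| <= r -> `|y - a| <= r -> `|phi x - phi y| <= 2^-1 * `|x - y|) ->
  `|phi a - a| <= 2^-1 * r -> exists2 x, `|x - a| <= r & phi x = x.
Proof.
move=> lip pa.
have r0 : 0 <= r by have := le_trans (normr_ge0 _) pa; rewrite pmulr_rge0 // invr_gt0.
pose s k := iter k phi a.
have sS k : `|s k - a| <= r * (1 - 2^-1 ^+ k) /\ `|s k.+1 - s k| <= r * 2^-1 ^+ k.+1.
  elim: k => [|k [IH1 IH2]].
    by rewrite /s /= subrr normr0 expr0 subrr mulr0 expr1 mulrC.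
  have ge0 j : 0 <= (2^-1 : R) ^+ j by rewrite exprn_ge0 // invr_ge0.
  have in1 : `|s k.+1 - a| <= r * (1 - 2^-1 ^+ k.+1).
    rewrite -(subrKA (s k)) (le_trans (ler_normD _ _))//.
    rewrite (le_trans (lerD IH2 IH1))// -mulrDr ler_wpM2l // exprS.
    have := ge0 k; lra.
  have le_r j : r * (1 - 2^-1 ^+ j) <= r by rewrite ler_piMr // gerBl.
  split=> //; apply: (le_trans (lip _ _ _ _)).
  - exact: le_trans in1 (le_r _).
  - exact: le_trans IH1 (le_r _).
  - by rewrite exprS mulrCA ler_pM2l // invr_gt0.
have dist n j : `|s n - s (n + j)%N| <= r * (2^-1 ^+ n - 2^-1 ^+ (n + j)).
  elim: j => [|j IH]; first by rewrite addn0 !subrr normr0 mulr0.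
  rewrite addnS -(subrKA (s (n + j)%N)) (le_trans (ler_normD _ _))//.
  rewrite [`|s (n + j)%N - _|]distrC (le_trans (lerD IH (sS _).2))//.
  by rewrite exprS le_eqVlt; apply/orP; left; apply/eqP; field.
have [||l lP] := @dominated_sequence_limit _ _ s (fun k => r * 2^-1 ^+ k).
- move=> n m nm; rewrite -(subnKC nm) (le_trans (dist _ _))// ler_wpM2l // gerBl.
  by rewrite exprn_ge0 // invr_ge0.
- by move=> e; exact: exists_geometric_lt.
have la : `|l - a| <= r by have := lP 0%N; rewrite expr0 mulr1 distrC.
exists l => //; apply/eqP; rewrite -subr_eq0 -normr_le0; apply/ler_addgt0Pr => e e0.
have [n ne] := exists_geometric_lt (2 * r) e0.
rewrite add0r -(subrKA (s n.+1)) (le_trans (ler_normD _ _))//.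
apply: le_trans (ltW ne).
have h1 : `|phi l - s n.+1| <= 2^-1 * `|l - s n|.
  apply: lip => //; apply: (le_trans (sS n).1).
  by rewrite ler_piMr // gerBl exprn_ge0 // invr_ge0.
have h2 := lP n; rewrite distrC in h2.
have := normr_ge0 (l - s n).
have := lP n.+1; rewrite exprS mulrCA -[2 * r * _]mulrA.
lra.
Qed.

(** [L v = w] is solved as a fixed point of [v + (w - L v)], starting from [w] in the ball of radius
    [|w|]. *)
Lemma near_id_has_inverse (E : completeNormedModType R) (L : {linear E -> E}) :
  (forall v, `|L v - v| <= 2^-1 * `|v|) -> has_inverse L.
Proof.
move=> Lid.
have bound v : `|v| <= 2 * `|L v|.
  have := Lid v; have : `|v| <= `|L v - v| + `|L v|.
    by rewrite distrC -{1}[v](subrK (L v)) ler_normD.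
  lra.
have surj w : exists v, L v = w.
  have [x y _ _||v _] := @contraction_fixed_point E (fun v => v + (w - L v)) w `|w|.
  - have -> : x + (w - L x) - (y + (w - L y)) = - (L (x - y) - (x - y)).
      rewrite [RHS]opprB linearB opprB opprD addrACA; congr (_ + _).
      by rewrite opprB addrC subrKA.
    by rewrite normrN.
  - by rewrite addrC addKr distrC.
  - rewrite -[X in _ = X]addr0 => /addrI/eqP; rewrite subr_eq0 => /eqP; by exists v.
have [S SP] := choice surj.
have Linj v w : L v = L w -> v = w.
  move=> h; apply/eqP; rewrite -subr_eq0 -normr_le0 (le_trans (bound _))//.
  by rewrite linearB h subrr normr0 mulr0.
have Sl : linear S by move=> r u v; apply: Linj; rewrite linearP !SP.
pose SL : {linear E -> E} := HB.pack S (GRing.isLinear.Build _ _ _ _ _ Sl).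
exists SL; split=> //=; last by move=> v; apply: Linj; rewrite SP.
apply: (@lipschitz_linear_continuous _ _ _ SL 2) => //= v.
by rewrite -{2}(SP v).
Qed.

(** With the differential normalised to the identity at [p], the map [x - f x] is Lipschitz with
    constant 1/2 near [p], and [f x = y] is solved by iterating [x - f x + y]. *)
Theorem inverse_function (E : completeNormedModType R) (U : set E) (f : E -> E) p :
  open U -> smooth U f -> U p -> (forall v, 'd f p v = v) ->
  exists V (g : E -> E), [/\ open V, V (f p), smooth V g, g (f p) = p &
    forall y, V y -> [/\ U (g y), f (g y) = y &
      forall v, `|'d f (g y) v - v| <= 2^-1 * `|v|]].
Proof.
move=> oU sf Up dfp.
have half0 : 0 < 2^-1 :> R by rewrite invr_gt0.
have nU : nbhs p U by exact: open_nbhs_nbhs.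
have : nbhs p (U `&` [set x | forall v, `|'d f x v - 'd f p v| <= 2^-1 * `|v|]).
  by apply: filterI => //; exact: (diff_near_norm oU sf Up half0).
move=> /nbhs_ballP[r0 /= r00 rP].
have dH x v : ball p r0 x -> `|'d f x v - v| <= 2^-1 * `|v|.
  by move=> /rP[_ /= /(_ v)]; rewrite dfp; exact.
have dU x : ball p r0 x -> U x by move=> /rP[].
have dfx x : ball p r0 x -> differentiable f x.
  by move=> /dU; exact: smooth_differentiable.
have lip x y : ball p r0 x -> ball p r0 y -> `|(y - f y) - (x - f x)| <= 2^-1 * `|y - x|.
  move=> px py; apply: (@lipschitz_diff _ _ _ (fun x => x - f x) p r0) => //.
  - by move=> z pz; apply: differentiableB => //; exact: dfx.
  - move=> z pz v; rewrite diffB //=; last exact: dfx.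
    by rewrite diff_val distrC; exact: dH.
have bound x y : ball p r0 x -> ball p r0 y -> `|y - x| <= 2 * `|f y - f x|.
  move=> px py; have h := lip _ _ px py.
  have : `|y - x| <= `|(y - f y) - (x - f x)| + `|f y - f x|.
    rewrite -{1}[y - x](_ : ((y - f y) - (x - f x)) + (f y - f x) = y - x) ?ler_normD//.
    by rewrite opprB addrAC subrKA subrKA.
  lra.
(* Closed balls of radius [r] stay in the good ball. For [y] within [r / 2] of [f p] the first
   iterate moves [p] by at most [r / 2], as the fixed point lemma requires. *)
pose r := r0 / 2; have r1 : 0 < r by rewrite divr_gt0.
have rr0 : r < r0 by rewrite ltr_pdivrMr // ltr_pMr // ltr1n.
have inball x : `|x - p| <= r -> ball p r0 x.
  by rewrite -ball_normE /= distrC => h; exact: le_lt_trans rr0.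
have step y : exists x, ball (f p) (r / 2) y -> ball p r0 x /\ f x = y.
  have [yb|] := pselect (ball (f p) (r / 2) y); last by exists 0.
  have [x x' px px'||x px xE] := @contraction_fixed_point E (fun x => (x - f x) + y) p r.
  - by rewrite opprD addrACA subrr addr0; apply: lip; exact: inball.
  - move: yb; rewrite -ball_normE /= => /ltW.
    by rewrite [p - f p]addrC addrAC addrK addrC distrC mulrC.
  - exists x => _; split; first exact: inball.
    by move: xE; rewrite -addrA -[X in _ = X]addr0 => /addrI/eqP; rewrite addrC subr_eq0 => /eqP.
have [g gP] := choice step.
have pb : ball p r0 p by exact: ballxx.
have fpb : ball (f p) (r / 2) (f p) by apply: ballxx; rewrite divr_gt0.
exists (ball (f p) (r / 2)), g; split => //.
- exact: ball_open.
- move=> k; apply: (@inverse_Ck _ _ _ (ball p r0) f).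
  + exact: ball_open.
  + exact: ball_open.
  + exact: smooth_sub sf.
  + exact: gP.
  + move=> y yb; apply/cvgrPdist_le => e e0.
    have ny : \forall z \near y, ball (f p) (r / 2) z.
      by apply: open_nbhs_nbhs; split=> //; exact: ball_open.
    have nz : \forall z \near y, `|y - z| < e / 2.
      by apply: (@cvgr_dist_lt _ _ _ (nbhs y) _ id y); [exact: cvg_id|rewrite divr_gt0].
    apply: filterS2 ny nz => z zb yz.
    have [b1 f1] := gP _ yb; have [b2 f2] := gP _ zb.
    by have := bound _ _ b2 b1; rewrite f1 f2; move: yz; lra.
  + by move=> x px; apply: near_id_has_inverse => v; exact: dH.
- have [b1 f1] := gP _ fpb.
  apply/eqP; rewrite -subr_eq0 -normr_le0 (le_trans (bound _ _ pb b1))//.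
  by rewrite f1 subrr normr0 mulr0.
- by move=> y yb; have [b1 f1] := gP _ yb; split=> [||v]; [exact: dU| |exact: dH].
Qed.
End inverse_function.

(** * Smooth curves *)

Section curves.
Context {R : realType}.
Implicit Types E F G : normedModType R.

(** A remainder estimate, without division by [s - t], combines directly with Fréchet differentials;
    [smooth_curve_realify] relates it to difference quotients. *)
Definition curve_der E (A : set R) (g g' : R -> E) :=
  forall t, A t -> forall e, 0 < e -> exists2 d, 0 < d &
    forall s, A s -> `|s - t| < d -> `|g s - g t - (s - t) *: g' t| <= e * `|s - t|.

Definition curve_tower E (A : set R) (d : nat -> R -> E) :=
  forall n, curve_der A (d n) (d n.+1).

Definition smooth_on E (A : set R) (g : R -> E) :=
  exists2 d : nat -> R -> E, curve_tower A d & forall t, A t -> d 0%N t = g t.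

Lemma curve_der_lipschitz E A (g g' : R -> E) t : curve_der A g g' -> A t ->
  exists d k, [/\ 0 < d, 0 < k & forall s, A s -> `|s - t| < d -> `|g s - g t| <= k * `|s - t|].
Proof.
move=> gg At; have [d d0 dP] := gg t At 1 ltr01.
exists d, (1 + `|g' t|); split => [//|//|s As st]; rewrite -[g s - g t](subrK ((s - t) *: g' t)) (le_trans (ler_normD _ _))//.
by rewrite mulrDl lerD ?dP// normrZ mulrC.
Qed.

Lemma curve_der_near E A (g g' : R -> E) t (P : set E) : curve_der A g g' -> A t ->
  nbhs (g t) P -> exists2 d, 0 < d & forall s, A s -> `|s - t| < d -> P (g s).
Proof.
move=> gg At /nbhs_ballP[r /= r0 rP].
have [d [k [d0 k0 dk]]] := curve_der_lipschitz gg At.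
exists (Order.min d (r / k)); first by rewrite lt_min d0 divr_gt0.
move=> s As; rewrite lt_min => /andP[sd sr]; apply: rP; rewrite -ball_normE /= distrC.
by apply: le_lt_trans (dk _ As sd) _; rewrite mulrC -ltr_pdivlMr.
Qed.

Lemma curve_der_sub E (A B : set R) (g g' : R -> E) : B `<=` A ->
  curve_der A g g' -> curve_der B g g'.
Proof.
by move=> BA gg t /BA At e e0; have [d d0 H] := gg t At e e0; exists d => // s /BA; exact: H.
Qed.

Lemma curve_der_eq E (A : set R) (g g' f f' : R -> E) :
  (forall t, A t -> g t = f t) -> (forall t, A t -> g' t = f' t) ->
  curve_der A g g' -> curve_der A f f'.
Proof.
move=> gf gf' gg t At e e0; have [d d0 H] := gg t At e e0; exists d => // s As st.
by rewrite -!gf // -gf' //; exact: H.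
Qed.

Lemma smooth_on_sub E (A B : set R) (g : R -> E) : B `<=` A -> smooth_on A g -> smooth_on B g.
Proof.
move=> BA [d dd d0]; exists d => [n|t /BA]; last exact: d0.
exact: curve_der_sub BA (dd n).
Qed.

Lemma eq_smooth_on E (A : set R) (g f : R -> E) : (forall t, A t -> g t = f t) ->
  smooth_on A g -> smooth_on A f.
Proof. by move=> gf [d dd d0]; exists d => // t At; rewrite d0 // gf. Qed.

Lemma smooth_on_der E (A : set R) (g : R -> E) : smooth_on A g -> exists g', curve_der A g g'.
Proof. by move=> [d dd d0]; exists (d 1%N); apply: curve_der_eq (dd 0%N). Qed.

Lemma smooth_on_near E A (g : R -> E) t (P : set E) : smooth_on A g -> A t ->
  nbhs (g t) P -> exists2 d, 0 < d & forall s, A s -> `|s - t| < d -> P (g s).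
Proof. by move=> /smooth_on_der[g' gg]; exact: curve_der_near gg. Qed.

Lemma smooth_on_continuous E A (g : R -> E) : smooth_on A g -> {within A, continuous g}.
Proof.
move=> sg; apply/subspace_continuousP => t At; apply/cvgrPdist_lt => e e0.
have nb : nbhs (g t) (ball (g t) e) by exact: nbhsx_ballx.
have [d d0 dP] := smooth_on_near sg At nb.
apply/nbhs_ballP; exists d => //= s; rewrite -!ball_normE /= distrC => ts As.
by have := dP _ As ts; rewrite -ball_normE.
Qed.

Lemma curve_der_pair E F A (g g' : R -> E) (f f' : R -> F) :
  curve_der A g g' -> curve_der A f f' ->
  curve_der A (fun t => (g t, f t)) (fun t => (g' t, f' t)).
Proof.
move=> gg ff t At e e0; have [d d0 dP] := gg t At e e0; have [c c0 cP] := ff t At e e0.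
exists (Order.min d c); first by rewrite lt_min d0.
move=> s As; rewrite lt_min => /andP[sd sc].
rewrite (_ : _ - _ = (g s - g t - (s - t) *: g' t, f s - f t - (s - t) *: f' t)) //.
by rewrite norm_pair /= ge_max dP // cP.
Qed.

Lemma curve_der_cst E A (b : E) : curve_der A (cst b) (cst 0).
Proof.
move=> t At e e0; exists 1 => // s As st.
by rewrite /= subrr scaler0 subrr normr0 mulr_ge0 // ltW.
Qed.

Lemma curve_der_comp E F A (g g' : R -> E) (f : E -> F) : curve_der A g g' ->
  (forall t, A t -> differentiable f (g t)) ->
  curve_der A (f \o g) (fun t => 'd f (g t) (g' t)).
Proof.
move=> gg df t At e e0; have dft := df t At.
have [k k0 dk] := diff_lipschitz dft.
have [d [c [d0 c0 dc]]] := curve_der_lipschitz gg At.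
have e2 : 0 < e / 2 / c by rewrite !divr_gt0.
have [d1 d10 d1P] := curve_der_near gg At (diff_near dft e2).
have e3 : 0 < e / 2 / k by rewrite !divr_gt0.
have [d2 d20 d2P] := gg t At _ e3.
exists (Order.min d (Order.min d1 d2)); first by rewrite !lt_min d0 d10.
move=> s As; rewrite !lt_min => /andP[sd /andP[sd1 sd2]] /=.
have -> : f (g s) - f (g t) - (s - t) *: 'd f (g t) (g' t) =
    (f (g s) - f (g t) - 'd f (g t) (g s - g t)) +
    'd f (g t) (g s - g t - (s - t) *: g' t).
  by rewrite [in RHS](linearB ('d f (g t)) (g s - g t)) subrKA (linearZZ ('d f (g t))).
rewrite (le_trans (ler_normD _ _))// [e]splitr mulrDl lerD//.
  apply: le_trans (d1P _ As sd1) _; rewrite -(mulrA (e / 2)) ler_pM2l ?divr_gt0//.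
  by rewrite ler_pdivrMl // dc.
apply: le_trans (dk _) _; rewrite mulrC -ler_pdivlMr//.
by apply: le_trans (d2P _ As sd2) _; rewrite mulrAC.
Qed.

Lemma smooth_on_cst E A (b : E) : smooth_on A (cst b : R -> E).
Proof.
exists (fun n => if n is 0%N then cst b else cst 0) => // -[|n]; exact: curve_der_cst.
Qed.

Lemma smooth_on_pair E F A (g : R -> E) (f : R -> F) : smooth_on A g -> smooth_on A f ->
  smooth_on A (fun t => (g t, f t)).
Proof.
move=> [d dd d0] [c cc c0]; exists (fun n t => (d n t, c n t)) => [n|t At].
  exact: curve_der_pair.
by rewrite d0 // c0.
Qed.

Lemma smooth_on_affine E F A (g : R -> E) (b : F) (L : {linear E -> F}) : continuous L ->
  smooth_on A g -> smooth_on A (fun t => b + L (g t)).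
Proof.
move=> cL [d dd d0].
exists (fun n t => if n is 0%N then b + L (d n t) else L (d n t)) => [n|t At]; last by rewrite d0.
have H n' (b' : F) : curve_der A (fun t => b' + L (d n' t)) (fun t => L (d n'.+1 t)).
  have dA y := diff_affine b' y cL.
  apply: (curve_der_eq _ _ (@curve_der_comp _ _ _ _ _ (fun y => b' + L y) (dd n') _)).
  - by move=> t At.
  - by move=> t At; rewrite (dA _).2.
  - by move=> t _; exact: (dA _).1.
case: n => [|n]; first exact: H.
apply: curve_der_eq (H n.+1 0) => t At //=; by rewrite add0r.
Qed.

(* The derivatives of [f \o g] are obtained by iterating [(f, g) |-> ('d f, (g, g'))]. *)
Record composite (F : normedModType R) (A : set R) := Composite {
  comp_space : normedModType R;
  comp_dom : set comp_space;
  comp_map : comp_space -> F;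
  comp_tower : nat -> R -> comp_space;
  _ : open comp_dom;
  _ : smooth comp_dom comp_map;
  _ : forall t, A t -> comp_dom (comp_tower 0%N t);
  _ : curve_tower A comp_tower }.

Definition composite_fun F A (C : composite F A) : R -> F :=
  fun t => comp_map (comp_tower C 0%N t).

Lemma composite_der F A (C : composite F A) :
  exists C' : composite F A, curve_der A (composite_fun C) (composite_fun C').
Proof.
case: C => E U f d oU sf Ud dd.
have T0 t : A t -> (U `*` [set: E]) (d 0%N t, d 1%N t) by move=> At; split => //=; exact: Ud.
have dd' : curve_tower A (fun n t => (d n t, d n.+1 t)) by move=> n; exact: curve_der_pair.
exists (Composite (open_setXT oU) (smooth_diff oU sf) T0 dd').
apply: curve_der_comp => // t At; exact: smooth_differentiable sf (Ud _ At).
Qed.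

Lemma smooth_on_comp E F A (U : set E) (f : E -> F) (g : R -> E) : open U -> smooth U f ->
  smooth_on A g -> (forall t, A t -> U (g t)) -> smooth_on A (fun t => f (g t)).
Proof.
move=> oU sf [d dd d0] Ug.
have [next nextP] := choice (@composite_der F A).
have Ud t : A t -> U (d 0%N t) by move=> At; rewrite d0 //; exact: Ug.
pose C := Composite oU sf Ud dd.
exists (fun n => composite_fun (iter n next C)) => [n|t At /=]; first exact: nextP.
by rewrite /composite_fun /= d0.
Qed.

Definition window (t d : R) : set R := [set s | 0 <= s <= 1 /\ `|s - t| < d].

Lemma window_center t d : 0 <= t <= 1 -> 0 < d -> window t d t.
Proof. by move=> t01 d0; split=> //; rewrite subrr normr0. Qed.

Lemma window_sub t d d' : d <= d' -> window t d `<=` window t d'.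
Proof. by move=> dd s [s01 sd]; split=> //; exact: lt_le_trans dd. Qed.

Lemma window_segment t d s s' : window t d s -> window t d s' -> `[s, s'] `<=` window t d.
Proof.
move=> [/andP[s0 s1] st] [/andP[s'0 s'1] s't] u /=; rewrite in_itv /= => /andP[su us'].
split; first by rewrite (le_trans s0)//= (le_trans us').
move: st s't; rewrite !ltr_distl => /andP[h1 h2] /andP[h3 h4].
by rewrite (lt_le_trans h1)//= (le_lt_trans us').
Qed.

Lemma smooth_on_window_near E (g : R -> E) t d (P : set E) : smooth_on (window t d) g ->
  0 <= t <= 1 -> 0 < d -> nbhs (g t) P ->
  exists d', [/\ 0 < d', d' <= d & forall s, window t d' s -> P (g s)].
Proof.
move=> sg t01 d0 nP.
have [e e0 eP] := smooth_on_near sg (window_center t01 d0) nP.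
exists (Order.min d e); split; first by rewrite lt_min d0.
  by rewrite ge_min lexx.
move=> s [s01]; rewrite lt_min => /andP[sd se].
exact: eP.
Qed.

Lemma countable_curve_constant E (g : R -> E) t d : 0 <= t <= 1 -> 0 < d ->
  smooth_on (window t d) g -> countable (g @` window t d) ->
  forall s, window t d s -> g s = g t.
Proof.
move=> t01 d0 sg cg s As; have At := window_center t01 d0.
have const a b : a <= b -> window t d a -> window t d b -> g b = g a.
  move=> ab Aa Ab; apply: countable_continuous_constant => //.
    by apply: continuous_subspaceW (smooth_on_continuous sg); exact: window_segment.
  apply: sub_countable cg; apply: subset_card_le; apply: image_subset; exact: window_segment.
by have [st|ts] := leP s t; [rewrite (const s t)|rewrite (const t s)// ltW].
Qed.
End curves.

(** * Algebras over the tangent functor monad in charts *)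

Section min_modulus.
Context {R : realType} {Y : normedModType R}.
Implicit Types P Q tau A : {linear Y -> Y}.

Lemma norm_le_double (u v : Y) : `|u - v| <= 2^-1 * `|v| -> `|v| <= 2 * `|u|.
Proof.
have : `|v| <= `|u - v| + `|u| by rewrite distrC -{1}[v](subrK u) ler_normD.
lra.
Qed.

(* [Q] is bounded below by [n^-1] modulo its kernel, up to arbitrarily small
   errors; these make the condition closed in [Q]. *)
Definition min_modulus (n : nat) (Q : Y -> Y) := forall u e, 0 < e ->
  exists u', `|u'| <= n%:R * `|Q u| + e * `|u| /\ `|Q (u - u')| <= e * `|u|.

Lemma generalized_inverse_min_modulus P tau : continuous tau ->
  (forall u, P (tau (P u)) = P u) -> exists n, min_modulus n P.
Proof.
move=> ctau tauP; have [c c0 cP] := linear_lipschitz ctau.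
exists (Num.truncn c).+1 => u e e0; exists (tau (P u)); split.
  apply: (le_trans (cP _)); apply: ler_wpDr; first by rewrite mulr_ge0 // ltW.
  by rewrite ler_wpM2r // ltW // truncnS_gt.
by rewrite linearB tauP subrr normr0 mulr_ge0 // ltW.
Qed.

(** The same [n] survives the limit: the witness of a nearby [Qb] with error [e / 2] also serves
    [Q], and replacing [Qb] by [Q] costs at most another [e / 2]. *)
Lemma min_modulus_limit n Q (k : R) : 0 <= k -> (forall u, `|Q u| <= k * `|u|) ->
  (forall d, 0 < d -> exists2 Qb : {linear Y -> Y}, min_modulus n Qb &
     forall u, `|Qb u - Q u| <= d * `|u|) -> min_modulus n Q.
Proof.
move=> k0 kP H u e e0.
(* [K - 1] bounds the ratio of [|u'|] to [|u|], so [K] bounds that of [|u - u'|]; [d] is chosen to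
   pay for both conditions of [min_modulus]. *)
pose K := n%:R * (k + 1) + e + 2.
have nk0 : 0 <= n%:R * (k + 1) by rewrite mulr_ge0 // addr_ge0.
have K2 : 2 <= K by rewrite /K; lra.
pose d := Order.min 1 (e / 2 / (n%:R + K)).
have K0 : 0 < K by exact: lt_le_trans K2.
have nK0 : 0 < n%:R + K by rewrite ltr_wpDl.
have d0 : 0 < d by rewrite lt_min ltr01 !divr_gt0.
have d1 : d <= 1 by rewrite ge_min lexx.
have dnK : d * (n%:R + K) <= e / 2 by rewrite -ler_pdivlMr // ge_min lexx orbT.
have [Qb Mb bP] := H d d0.
have e2 : 0 < e / 2 by rewrite divr_gt0.
have [u' [u'1 u'2]] := Mb u _ e2.
have Pbu : `|Qb u| <= `|Q u| + d * `|u|.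
  by rewrite -[Qb u](subrK (Q u)) addrC (le_trans (ler_normD _ _))// lerD.
have nu : 0 <= `|u| by [].
have Pau := kP u.
have u'K : `|u'| <= (K - 1) * `|u|.
  apply: (le_trans u'1).
  have h1 : n%:R * `|Qb u| <= n%:R * ((k + 1) * `|u|).
    by rewrite ler_wpM2l // (le_trans Pbu)// mulrDl lerD // ler_wpM2r.
  have -> : (K - 1) * `|u| = n%:R * ((k + 1) * `|u|) + (e + 1) * `|u| by rewrite /K; ring.
  by rewrite lerD // ler_wpM2r //; lra.
exists u'; split.
  apply: (le_trans u'1).
  have h1 : n%:R * `|Qb u| <= n%:R * `|Q u| + n%:R * d * `|u|.
    by rewrite -mulrA -mulrDr ler_wpM2l.
  have h2 : n%:R * d * `|u| <= e / 2 * `|u|.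
    rewrite ler_wpM2r // (le_trans _ dnK)// mulrC ler_pM2l //.
    by rewrite lerDl ltW.
  have h3 : e * `|u| = e / 2 * `|u| + e / 2 * `|u| by field.
  rewrite h3; lra.
have h1 : `|u - u'| <= K * `|u|.
  rewrite (le_trans (ler_normB _ _))//.
  have -> : K * `|u| = `|u| + (K - 1) * `|u| by ring.
  by rewrite lerD.
have h2 : `|Q (u - u')| <= `|Qb (u - u')| + d * `|u - u'|.
  rewrite -[Q _](subrK (Qb (u - u'))) addrC (le_trans (ler_normD _ _))// lerD //.
  by rewrite distrC.
have h3 : d * `|u - u'| <= e / 2 * `|u|.
  apply: (@le_trans _ _ (d * (K * `|u|))); first by rewrite ler_pM2l.
  by rewrite mulrA ler_wpM2r // (le_trans _ dnK)// ler_pM2l // lerDr.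
have h4 : e * `|u| = e / 2 * `|u| + e / 2 * `|u| by field.
rewrite h4; lra.
Qed.

(** The uniform [n] acts here. [Q] is small on the kernel of [P], so by the lower bound its value
    there is nearly taken at a small vector [k1]. Thus [u] may be exchanged for [A (tau (P u))] plus
    a vector of norm at most [|u| / 4], and repeating this halves the relative error [t] each
    time. *)
Lemma transversal_approx P tau Q A (n : nat) (B eta : R) :
  0 <= B -> 0 <= eta -> n.+1%:R * eta * (1 + B * B) <= 8^-1 ->
  (forall v, `|tau v| <= B * `|v|) -> (forall v, `|P v| <= B * `|v|) ->
  (forall v, P (tau (P v)) = P v) ->
  (forall v, `|Q v - P v| <= eta * `|v|) -> (forall v, `|A v - v| <= eta * `|v|) ->
  min_modulus n Q ->
  forall u e, 0 < e -> exists w, `|Q u - Q (A (tau (P w)))| <= e.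
Proof.
move=> B0 eta0 small tauB PB PtauP QP AI modQ.
pose good t := forall u, exists w, `|Q u - Q (A (tau (P w)))| <= t * `|u|.
have good0 : good (B + eta + 1).
  move=> u; exists 0; rewrite !linear0 ?subr0 ?addr0 mulrDl.
  have : `|Q u| <= `|Q u - P u| + `|P u| by rewrite -{1}(subrK (P u) (Q u)) ler_normD.
  have := QP u; have := PB u; have : 0 <= `|u| by [].
  rewrite mulrDl; lra.
have step t : 0 < t -> good t -> good (t * 2^-1).
  move=> t0 gt u.
  have B2 : 0 <= B * B by rewrite mulr_ge0.
  pose C := 1 + B * B; have C1 : 1 <= C by rewrite lerDl.
  have C0 : 0 < C by exact: lt_le_trans C1.
  pose e := Order.min (8 * C)^-1 (t / (4 * C)).
  have e0 : 0 < e by rewrite lt_min invr_gt0 divr_gt0 ?mulr_gt0.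
  have eC : e * C <= 8^-1.
    apply: (@le_trans _ _ ((8 * C)^-1 * C)); first by rewrite ler_pM2r // ge_min lexx.
    by rewrite invfM -mulrA mulVf ?mulr1 // gt_eqF.
  have etC : e * C <= t / 4.
    apply: (@le_trans _ _ (t / (4 * C) * C)); first by rewrite ler_pM2r // ge_min lexx orbT.
    by rewrite invfM mulrA -mulrA mulVf ?mulr1 // gt_eqF.
  set h := tau (P u); pose k := u - h.
  have nu : 0 <= `|u| by [].
  have hB : `|h| <= B * B * `|u|.
    by rewrite (le_trans (tauB _))// -mulrA ler_wpM2l.
  have kC : `|k| <= C * `|u|.
    by rewrite (le_trans (ler_normB _ _))// mulrDl mul1r lerD.
  have Pk : P k = 0 by rewrite linearB PtauP subrr.
  have Qk : `|Q k| <= eta * `|k| by have := QP k; rewrite Pk subr0.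
  have [k1 [k1n Qkk]] := modQ k e e0.
  (* The vector left over by the exchange is small, and the previous bound [t] is applied to it. *)
  have [w' w'P] := gt (k1 + (h - A h)).
  exists (u + w').
  have -> : Q u - Q (A (tau (P (u + w')))) =
      Q (k - k1) + (Q (k1 + (h - A h)) - Q (A (tau (P w')))).
    have e1 : Q u = Q (k - k1) + Q (k1 + (h - A h)) + Q (A h).
      by rewrite -!(linearD Q) addrA subrK -addrA subrK subrK.
    have e2 : A (tau (P (u + w'))) = A h + A (tau (P w')) by rewrite !linearD.
    by rewrite e2 (linearD Q (A h)) e1 opprD addrA addrK -addrA.
  rewrite (le_trans (ler_normD _ _))//.
  have h1 : e * `|k| <= t / 4 * `|u|.
    apply: (@le_trans _ _ (e * (C * `|u|))); first by rewrite ler_pM2l.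
    by rewrite mulrA ler_wpM2r.
  have h2 : `|k1 + (h - A h)| <= 4^-1 * `|u|.
    rewrite (le_trans (ler_normD _ _))//.
    have a1 : `|h - A h| <= eta * (B * B) * `|u|.
      by rewrite distrC (le_trans (AI _))// -mulrA ler_wpM2l.
    have a2 : `|k1| <= n%:R * eta * C * `|u| + e * C * `|u|.
      rewrite (le_trans k1n)// lerD //; last by rewrite -mulrA ler_pM2l.
      rewrite -!mulrA ler_wpM2l // (le_trans Qk)// ler_wpM2l //.
    have a3 : e * C * `|u| <= 8^-1 * `|u| by rewrite ler_wpM2r.
    have a4 : n%:R * eta * C * `|u| + eta * (B * B) * `|u| <= 8^-1 * `|u|.
      rewrite -mulrDl ler_wpM2r // (le_trans _ small)// -natr1 !mulrDl mul1r.
      by rewrite -/C /C; have : 0 <= eta by []; lra.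
    lra.
  have h3 : t * `|k1 + (h - A h)| <= t / 4 * `|u|.
    by rewrite -mulrA ler_pM2l.
  lra.
have goodn m : good ((B + eta + 1) * 2^-1 ^+ m).
  elim: m => [|m IH]; first by rewrite expr0 mulr1.
  rewrite exprSr mulrA; apply: step => //.
  by rewrite mulr_gt0 ?exprn_gt0 ?invr_gt0 // ltr_wpDl // addr_ge0.
move=> u e e0.
have [m mP] : exists m, (B + eta + 1) * 2^-1 ^+ m * `|u| < e.
  have [m mP] := exists_geometric_lt ((B + eta + 1) * `|u|) e0.
  by exists m; rewrite mulrAC.
by have [w wP] := goodn m u; exists w; exact: le_trans wP (ltW mP).
Qed.

End min_modulus.

(** * Coordinate identities of an algebra, the foliation box and the lift *)

Section algebra_in_charts.
Context {R : realType} {M I : Type} {X : I -> completeNormedModType R}.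
Variables (dom : I -> set M) (ch : forall i, M -> X i) (pa : forall i, X i -> M).
Variable hl : forall i, X i * X i -> M.

(** The image of chart [i], described without an existential as the points that [pa] and [ch]
    reproduce. *)
Definition chart_image i : set (X i) := [set a | dom i (pa a) /\ ch i (pa a) = a].
Local Notation W := (@chart_image _).
Definition local_dom i j : set (X i * X i) := [set p | W p.1 /\ dom j (hl p)].
Local Notation D i j := (@local_dom i j).
Definition local_alg i j (p : X i * X i) : X j := ch j (hl p).
Local Notation H i j := (@local_alg i j).
Definition vertical_diff i (a u : X i) : X i := 'd (H i i) (a, 0) (0, u).
Local Notation P := (@vertical_diff _).
Definition vertical_lin i (a : X i) : {linear X i -> X i} := 'd (H i i) (a, 0) \o @inr0 _ (X i) (X i).
Definition horizontal_lin i (p : X i * X i) : {linear X i -> X i} := 'd (H i i) p \o @inl0 _ (X i) (X i).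

Hypothesis chK : forall i m, dom i m -> pa (ch i m) = m.
Hypothesis atlas : forall m, exists i, dom i m.
Hypothesis D_open : forall i j, open (D i j).
Hypothesis H_smooth : forall i j, smooth (D i j) (H i j).
Hypothesis hl0 : forall i a, W a -> hl (a, 0 : X i) = pa a.
Hypothesis law : forall i j p q, D i j p ->
  hl (H i j p, 'd (H i j) p q) = hl (p.1, p.2 + q.1).

Lemma W_ch i m : dom i m -> W (ch i m).
Proof. by move=> im; rewrite /chart_image /= chK. Qed.

Lemma W_H i j p : D i j p -> W (H i j p).
Proof. by move=> [_ /W_ch]. Qed.

Lemma H_diff i j p : D i j p -> differentiable (H i j) p.
Proof. exact: smooth_differentiable. Qed.

Lemma law1 i j p w : D i j p -> hl (H i j p, 'd (H i j) p (w, 0)) = hl (p.1, p.2 + w).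
Proof. by move=> /law ->. Qed.

Lemma D0 i a : W a -> D i i (a, 0).
Proof. by move=> Wa; split=> //=; rewrite hl0 //; case: Wa. Qed.

Lemma H0 i a : W a -> H i i (a, 0) = a.
Proof. by move=> Wa; rewrite /local_alg hl0 //; case: Wa. Qed.

Lemma W_open i : open (@chart_image i).
Proof.
have -> : @chart_image i = (fun a => (a, 0)) @^-1` D i i.
  by apply/seteqP; split=> a; [exact: D0|case].
apply: open_comp; last exact: D_open.
by move=> a _; exact: (@inl0_continuous _ (X i) (X i) a).
Qed.

Lemma dH0 i a w : W a -> 'd (H i i) (a, 0) (w, 0) = w.
Proof.
move=> Wa; have [_ <-] := diff_inl (H_diff (D0 Wa)).
have [||_ ->] := @near_diff_eq _ _ _ idfun (fun w => H i i (w, 0)) a.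
- by apply: filterS (open_nbhs_nbhs (conj (@W_open i) Wa)) => b /H0 ->.
- exact: ex_diff.
- by rewrite diff_val.
Qed.

Lemma dH0E i a w u : W a -> 'd (H i i) (a, 0) (w, u) = w + P a u.
Proof.
move=> Wa; rewrite (diff_split (w, u) (H_diff (D0 Wa))) /=.
by rewrite dH0.
Qed.

(** The law at the zero vector over [a]: the left side sees [w + P a u], while the right side
    depends on [w] alone. *)
Lemma hl_invariant i a w u : W a -> hl (a, w + P a u : X i) = hl (a, w).
Proof.
move=> Wa; have := law (w, u) (D0 Wa).
by rewrite H0 // dH0E //= add0r.
Qed.

(** Differentiate [law1] in [w] at 0. In particular, derivatives along a fibre take values in the
    range of [P] at the image point. *)
Lemma dH_vertical i j p v : D i j p ->
  'd (H i j) p (0, v) = P (H i j p) ('d (H i j) p (v, 0)).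
Proof.
move=> Dp; have dH := H_diff Dp.
pose L : {linear X i -> X j} := 'd (H i j) p \o @inl0 _ (X i) (X i).
pose L2 : {linear X i -> (X j * X j)%type} := @inr0 _ (X j) (X j) \o L.
have cL2 : continuous L2.
  move=> w; apply: continuous_comp; last exact: inr0_continuous.
  by apply: continuous_comp; [exact: inl0_continuous|exact: diff_continuous].
have dHH : differentiable (H j j) ((H i j p, 0) + L2 0).
  by rewrite (linear0 L2) addr0; exact/H_diff/D0/W_H.
have dH' : differentiable (H i j) (p + @inr0 _ (X i) (X i) 0).
  by rewrite (linear0 (@inr0 _ (X i) (X i))) addr0.
have [_ /(_ v) e1] := differentiable_affine_comp (@inr0_continuous _ (X i) (X i)) dH'.
have [_ /(_ v) e2] := differentiable_affine_comp cL2 dHH.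
have eq : (fun w => H i j (p + inr0 (X i) w)) = (fun w => H j j ((H i j p, 0) + L2 w)).
  apply/funext => w; rewrite /local_alg; congr (ch j _).
  have := law1 w Dp; rewrite /L2 /L /=.
  rewrite (_ : (_, _) + inr0 _ _ = (H i j p, 'd (H i j) p (w, 0))) => [->|]; last first.
    by rewrite -[LHS]/(_, _) /= addr0 add0r.
  by congr hl; case: p {Dp dH L L2 cL2 dHH dH' e1 e2} => a b; rewrite -[LHS]/(_, _) /= addr0.
move: e1 e2; rewrite eq => -> .
rewrite (linear0 (@inr0 _ (X i) (X i))) addr0 (linear0 L2) addr0.
exact.
Qed.

(** The vector [w0] leads from [c] back to [a], so [law1] at [(c, w0)] expresses the fibre over [c]
    through the fibre over [a], as [B (w - w0)]. It remains to see that [- B w0] is [u] modulo the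
    range of [P a], which [hl_invariant] ignores. *)
Lemma glue_back i j a u : D i j (a, u) -> exists2 B : {linear X j -> X i},
  continuous B & forall w, hl (H i j (a, u), w) = hl (a, u + B w).
Proof.
move=> Dau; have Wa : W a by case: Dau.
set c := H i j (a, u); have Wc : W c by exact: W_H.
pose w0 := 'd (H i j) (a, u) (- u, 0).
have hw0 : hl (c, w0) = pa a by rewrite law1 //= subrr hl0.
have Dc : D j i (c, w0) by split=> //=; rewrite hw0; case: Wa.
have Hc : H j i (c, w0) = a by rewrite /local_alg hw0; case: Wa.
pose B : {linear X j -> X i} := 'd (H j i) (c, w0) \o @inl0 _ (X j) (X j).
exists B => [w|w].
  by apply: continuous_comp; [exact: inl0_continuous|exact/diff_continuous/H_diff].
have : hl (c, w) = hl (a, B (w - w0)) by rewrite -{1}Hc law1 //= addrC subrK.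
move=> ->.
pose TH (p : (X i * X i) * (X i * X i)) := (H i j p.1, 'd (H i j) (p.1) p.2).
pose L : {linear X i -> ((X i * X i) * (X i * X i))%type} :=
  @inl0 _ (X i * X i)%type (X i * X i)%type \o @inl0 _ (X i) (X i).
have cL : continuous L by move=> y; apply: continuous_comp; exact: inl0_continuous.
pose p0 : (X i * X i) * (X i * X i) := ((0, u), (- u, 0)).
have pL a' : p0 + L a' = ((a', u), (- u, 0)).
  by rewrite -[LHS]/((_, _), (_, _)) /= add0r !addr0.
have dTH : differentiable TH (p0 + L a).
  by rewrite pL; apply: smooth_differentiable (smooth_tangent (@H_smooth i j)) _.
have [dTL /(_ u) TLE] := differentiable_affine_comp cL dTH.
have dHji : differentiable (H j i) (TH (p0 + L a)) by rewrite pL; exact: H_diff.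
(* Going out along [u] and back along the transported [- u] is the identity in the base point. *)
have fg : \forall a' \near a, H j i (TH (p0 + L a')) = a'.
  have nD : \forall a' \near a, D i j (a', u).
    have cp : {for a, continuous (fun a' : X i => (a', u))}.
      by apply: continuous_pair_at; [exact: cvg_id|exact: cvg_cst].
    exact/cp/open_nbhs_nbhs.
  apply: filterS nD => a' Da'; have Wa' : W a' by case: Da'.
  by rewrite /= pL /TH /local_alg law1 //= subrr hl0 //; case: Wa'.
(* That identity is differentiated in the direction [u]. The second derivative of [H] falls into the
   vertical slot, which [dH_vertical] sends into the range of [P a]; what remains is
   [B q + P a z = u], with [w0 = - q]. *)
have := diff_right_inverse u fg dTL dHji; rewrite TLE pL /TH /=.
rewrite /inl0 (diff_tangent _ _ _ (@D_open i j) (@H_smooth i j) Dau) /=.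
rewrite (diff_split _ (H_diff Dc)) /= (dH_vertical _ Dc) Hc.
pose q := 'd (H i j) (a, u) (u, 0).
move=> eq; have {eq}[z eq] : exists z, B q + P a z = u by eexists; exact: eq.
change (hl (a, B (w - w0)) = hl (a, u + B w)).
have w0E : w0 = - q by rewrite -linearN; congr ('d _ _ _); rewrite -[RHS]/(_, _) /= oppr0.
rewrite -[in RHS]eq addrAC hl_invariant // w0E opprK (linearD B).
by rewrite [B w + _]addrC.
Qed.

(** Both vectors end at one point, read in a common chart [j]: [law1] goes from [b] to that point
    and [glue_back] from there to [a]. *)
Lemma glue i k a u b v : W a -> W b -> hl (b, v : X k) = hl (a, u : X i) ->
  exists2 T : {linear X k -> X i},
    continuous T & forall w, hl (b, v + w) = hl (a, u + T w).
Proof.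
move=> Wa Wb vu; have [j jm] := atlas (hl (a, u)).
have Da : D i j (a, u) by [].
have Db : D k j (b, v) by split=> //=; rewrite vu.
have [B cB BE] := glue_back Da.
have hE : H k j (b, v) = H i j (a, u) by rewrite /local_alg vu.
pose T : {linear X k -> X i} := B \o ('d (H k j) (b, v) \o @inl0 _ (X k) (X k)).
exists T => [w|w].
  apply: continuous_comp; last exact: cB.
  by apply: continuous_comp; [exact: inl0_continuous|exact/diff_continuous/H_diff].
by rewrite -BE -hE /= law1.
Qed.

Variables (i0 : I) (a0 : X i0).
Hypothesis Wa0 : W a0.
Local Notation L := (range (fun u : X i0 => hl (a0, u))).

Lemma leaf_stable k (b v w : X k) : W b -> L (hl (b, v)) -> L (hl (b, w)).
Proof.
move=> Wb [u _ e]; have [T _ TE] := glue Wa0 Wb (esym e).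
by exists (u + T (w - v)) => //=; rewrite -TE addrC subrK.
Qed.

Lemma leaf_covered k (b v : X k) m : W b -> L (hl (b, v)) -> L m ->
  exists w, hl (b, w) = m.
Proof.
move=> Wb [u _ e] [u' _ <-]; have [T _ TE] := glue Wb Wa0 e.
by exists (v + T (u' - u)); rewrite -TE addrC subrK.
Qed.

Lemma vertical_diff_near i (a : X i) e : W a -> 0 < e ->
  \forall b \near a, forall u, `|P b u - P a u| <= e * `|u|.
Proof.
move=> Wa e0.
have := near_inl0 (diff_near_norm (@D_open i i) (@H_smooth i i) (D0 Wa) e0).
apply: filterS => b H u; have := H (0, u).
by have := norm_inr0 (X i) u; rewrite /inr0 => ->.
Qed.

Lemma vertical_diff_lipschitz i (a : X i) : W a ->
  exists2 k, 0 < k & forall u, `|P a u| <= k * `|u|.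
Proof.
move=> Wa; have [k k0 kP] := diff_lipschitz (H_diff (D0 Wa)).
exists k => // u; apply: le_trans (kP _) _.
by have := norm_inr0 (X i) u; rewrite /inr0 => ->.
Qed.

Hypothesis tame_charts : forall i (a : X i), W a ->
  exists2 tau : {linear X i -> X i}, continuous tau & forall u, P a (tau (P a u)) = P a u.

Lemma tame_min_modulus i (a : X i) : W a -> exists n, min_modulus n (vertical_lin a).
Proof.
by move=> /tame_charts[tau ctau tauP]; exact: (@generalized_inverse_min_modulus _ _ (vertical_lin a) tau ctau tauP).
Qed.

Lemma min_modulus_closed i n (a : X i) : W a ->
  (forall e, 0 < e -> exists2 b : X i, min_modulus n (vertical_lin b) & `|a - b| < e) ->
  min_modulus n (vertical_lin a).
Proof.
move=> Wa H; have [k k0 kP] := vertical_diff_lipschitz Wa.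
apply: (@min_modulus_limit _ _ _ (vertical_lin a) _ (ltW k0) kP) => d d0.
have /nbhs_ballP[r /= r0 rP] := vertical_diff_near Wa d0.
have [b Mb ab] := H r r0; exists (vertical_lin b) => //.
by apply: rP; rewrite -ball_normE.
Qed.

(** Tameness holds at all points of the chart, so the sets [N n] cover the closure of the local
    leaf, where Baire applies; [min_modulus_limit] makes them closed. The ball obtained is then
    recentred at a point of the leaf itself. *)
Lemma exists_uniform_point : exists a1 r n, [/\ W a1, L (pa a1), 0 < r &
  forall a : X i0, ball a1 r a -> W a -> L (pa a) -> min_modulus n (vertical_lin a)].
Proof.
have /nbhs_ballP[rho /= rho0 rhoW] := open_nbhs_nbhs (conj (@W_open i0) Wa0).
(* Half the radius keeps the closure of [S] inside the chart. *)
pose r := rho / 2; have r0 : 0 < r by rewrite divr_gt0.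
have rrho : r < rho by rewrite ltr_pdivrMr // ltr_pMr // ltr1n.
pose S := [set a : X i0 | ball a0 r a /\ L (pa a)].
have clS a : closure S a -> ball a0 rho a.
  move=> /(_ (ball a (rho - r)))[|b [[b0 _] ab]].
    by apply: nbhsx_ballx; rewrite subr_gt0.
  move: b0 ab; rewrite -!ball_normE /= => b0 ab.
  by rewrite -(subrKA b) (le_lt_trans (ler_normD _ _))// -[rho](subrKC r) ltrD // distrC.
have Sa0 : S a0.
  by split; [exact: ballxx|exists 0 => //; rewrite hl0].
pose N n := [set a | closure S a /\ min_modulus n (vertical_lin a)].
have [||||n [a [d [Ca d0 dN]]]] := @Baire_closed R (X i0) (closure S) N.
- exact: closed_closure.
- by exists a0; exact: subset_closure.
- move=> n a cla.
  have Sa : closure S a.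
    rewrite [X in X _](closure_id _).1; last exact: closed_closure.
    by apply: closure_subset cla => b [].
  split=> //; apply: min_modulus_closed; first exact/rhoW/clS.
  move=> e e0; have [|b [[_ Mb] ab]] := cla (ball a e); first exact: nbhsx_ballx.
  by exists b => //; move: ab; rewrite -ball_normE.
- move=> a Ca; have [n nP] := tame_min_modulus (rhoW _ (clS _ Ca)).
  by exists n.
have [|a1 [[a1b La1] aa1]] := Ca (ball a d); first exact: nbhsx_ballx.
have nb : nbhs a1 (ball a0 r `&` ball a d).
  by apply: filterI; apply: open_nbhs_nbhs; split => //; exact: ball_open.
have /nbhs_ballP[r1 /= r10 r1P] := nb.
exists a1, r1, n; split=> //.
  by apply: rhoW; apply: le_ball a1b; exact: ltW.
move=> b /r1P[b0 bd] Wb Lb.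
by have [] := dN b (conj bd (subset_closure (conj b0 Lb))).
Qed.

(* Near a uniform point the slice through [a1] and the leaves give coordinates:
   [g] inverts [(z, xi) |-> (h (a1 + pi z, tau z), d h (a1 + pi z, tau z) (xi, 0))],
   and the slice coordinate [pi z] is constant along the leaf. *)
Lemma foliation_box (a1 : X i0) r n : W a1 -> L (pa a1) -> 0 < r ->
  (forall a : X i0, ball a1 r a -> W a -> L (pa a) -> min_modulus n (vertical_lin a)) ->
  exists (tau pi : {linear X i0 -> X i0}) (V : set (X i0 * X i0))
         (g : X i0 * X i0 -> X i0 * X i0),
    [/\ continuous tau, continuous pi, [/\ open V, V (a1, 0) & smooth V g],
     forall q, V q -> let p := (a1 + pi (g q).1, tau (g q).1) in
       [/\ D i0 i0 p, H i0 i0 p = q.1 & 'd (H i0 i0) p ((g q).2, 0) = q.2] &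
     forall q, V q -> L (pa q.1) -> forall u w, pi ('d g q (P q.1 u, w)).1 = 0].
Proof.
move=> Wa1 La1 r0 modr.
have [tau ctau tauP] := tame_charts Wa1.
pose P1 := vertical_lin a1.
have [c c0 tauc] := linear_lipschitz ctau.
have [k k0 Pk] := vertical_diff_lipschitz Wa1.
(* Since [P tau P = P], the map [pi] kills the range of [P1], and [pi v + P1 (tau v) = v]. *)
pose pi : {linear X i0 -> X i0} := idfun \- (P1 \o tau).
have piE v : pi v = v - P a1 (tau v) by [].
pose B := c + k + (1 + k * c).
have kc0 : 0 < k * c by rewrite mulr_gt0.
have B0 : 0 < B by rewrite /B !addr_gt0.
have tauB v : `|tau v| <= B * `|v|.
  by rewrite (le_trans (tauc _))// ler_wpM2r // /B; lra.
have PB v : `|P1 v| <= B * `|v|.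
  by rewrite (le_trans (Pk _))// ler_wpM2r // /B; lra.
have piB v : `|pi v| <= B * `|v|.
  apply: (@le_trans _ _ ((1 + k * c) * `|v|)); last by rewrite ler_wpM2r // /B; lra.
  rewrite piE (le_trans (ler_normB _ _))// mulrDl mul1r lerD //.
  by rewrite (le_trans (Pk _))// -mulrA ler_pM2l.
have cpi : continuous pi by exact: (lipschitz_linear_continuous B0 piB).
pose PLf (v : X i0) : X i0 * X i0 := (pi v, tau v).
have PLl : linear PLf by move=> s u v; rewrite /PLf !linearP.
pose PL : {linear X i0 -> (X i0 * X i0)%type} := HB.pack PLf (GRing.isLinear.Build _ _ _ _ _ PLl).
have PLB v : `|PL v| <= B * `|v| by rewrite norm_pair /= ge_max piB tauB.
pose Lf (q : X i0 * X i0) := (PL q.1, inl0 (X i0) q.2).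
have Ll : linear Lf by move=> s u v; rewrite /Lf !linearP.
pose Lm : {linear (X i0 * X i0)%type -> ((X i0 * X i0) * (X i0 * X i0))%type} :=
  HB.pack Lf (GRing.isLinear.Build _ _ _ _ _ Ll).
have cLm : continuous Lm.
  apply: (@lipschitz_linear_continuous _ _ _ Lm (B + 1)); first by rewrite addr_gt0.
  move=> q; rewrite (le_trans (norm_pair_le _))//= mulrDl mul1r lerD //.
    by rewrite (le_trans (PLB _))// ler_pM2l // norm_fst.
  by rewrite norm_inl0 norm_snd.
pose b : (X i0 * X i0) * (X i0 * X i0) := ((a1, 0), (0, 0)).
have bL q : b + Lm q = ((a1 + pi q.1, tau q.1), (q.2, 0)).
  by rewrite -[LHS]/((_, _), (_, _)) /= !add0r.
pose TH (p : (X i0 * X i0) * (X i0 * X i0)) := (H i0 i0 p.1, 'd (H i0 i0) (p.1) p.2).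
pose U0 := D i0 i0 `*` [set: (X i0 * X i0)].
have oU0 : open U0 by apply: open_setXT; exact: D_open.
have sTH : smooth U0 TH by apply: smooth_tangent; exact: H_smooth.
pose Xi (q : X i0 * X i0) := TH (b + Lm q).
pose U := [set q | U0 (b + Lm q)].
have sXi : smooth U Xi by exact: smooth_affine_comp.
have oU : open U.
  apply: open_comp oU0 => q _.
  by apply: differentiable_continuous; have [] := diff_affine b q cLm.
have dXi q v : U q ->
    ('d Xi q v).1 = 'd (H i0 i0) (a1 + pi q.1, tau q.1) (PL v.1).
  move=> Uq; have dTH := smooth_differentiable sTH Uq.
  have [_ ->] := differentiable_affine_comp cLm dTH.
  move: Uq; rewrite /U /= bL => -[/= Dq _].
  by rewrite (diff_tangent _ _ _ (@D_open i0 i0) (@H_smooth i0 i0) Dq).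
have D1 : D i0 i0 (a1, 0) by exact: D0.
have b0 : b + Lm 0 = b by rewrite linear0 addr0.
have U00 : U 0 by rewrite /U /= b0.
(* The decomposition [v = pi v + P1 (tau v)] makes the differential the identity, as
   [inverse_function] requires. *)
have dXi0 v : 'd Xi 0 v = v.
  have dTH : differentiable TH (b + Lm 0) by exact: (smooth_differentiable sTH U00).
  have [_ ->] := differentiable_affine_comp cLm dTH.
  rewrite b0 (diff_tangent _ _ _ (@D_open i0 i0) (@H_smooth i0 i0) D1) /=.
  rewrite (diff_diff0 _ _ (@D_open i0 i0) (@H_smooth i0 i0) D1) (linear0 ('d _ _)) add0r.
  rewrite /PLf dH0E // piE subrK /inl0 dH0 //; by case: v.
have Xi0 : Xi 0 = (a1, 0).
  by rewrite /Xi b0 /TH /= H0 // linear0.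
have [V0 [g [oV0]]] := inverse_function oU sXi U00 dXi0.
rewrite Xi0 => V00 sg g0 gP.
(* The first bound is the smallness hypothesis of [transversal_approx]; the second keeps the map [m]
   below within half of the identity. *)
pose eta := Order.min (8 * n.+1%:R * (1 + B * B))^-1 (2 * B)^-1.
have BB : 0 < 1 + B * B by rewrite addr_gt0 // mulr_gt0.
have n0 : 0 < n.+1%:R :> R by rewrite ltr0n.
have eta0 : 0 < eta by rewrite lt_min !invr_gt0 !mulr_gt0.
have eta1 : n.+1%:R * eta * (1 + B * B) <= 8^-1.
  rewrite mulrAC mulrC -ler_pdivlMr ?mulr_gt0//.
  by rewrite -invfM mulrA ge_min lexx.
have eta2 : eta * B <= 2^-1.
  by rewrite -ler_pdivlMr // -invfM ge_min lexx orbT.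
pose good (q : X i0 * X i0) := let p := (a1 + pi (g q).1, tau (g q).1) in
  (forall v, `|'d (H i0 i0) p v - 'd (H i0 i0) (a1, 0) v| <= eta * `|v|) /\
  ((forall u, `|P q.1 u - P a1 u| <= eta * `|u|) /\ ball a1 r q.1).
have near_good : \forall q \near (a1, 0 : X i0), good q.
  apply: filterI.
    have cPL : continuous PL by exact: (lipschitz_linear_continuous B0 PLB).
    pose PL1 : {linear (X i0 * X i0)%type -> (X i0 * X i0)%type} := PL \o fst.
    have cPL1 : continuous PL1.
      move=> q; apply: (@continuous_comp _ _ _ fst PL); last exact: cPL.
      exact: fst_continuous.
    have fE q : (a1, 0) + PL1 q = (a1 + pi q.1, tau q.1).
      by rewrite -[LHS]/(_, _) /= add0r.
    have f0 : (a1, 0) + PL1 (g (a1, 0)) = (a1, 0).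
      by rewrite fE g0 (linear0 pi) (linear0 tau) addr0.
    have := near_affine_comp (smooth_differentiable sg V00) cPL1 f0
      (diff_near_norm (@D_open i0 i0) (@H_smooth i0 i0) D1 eta0).
    by apply: filterS => q; rewrite fE.
  apply: filterI.
    exact: near_fst (vertical_diff_near Wa1 eta0).
  apply: near_fst; exact: nbhsx_ballx.
have /nbhs_ballP[d /= d0 dP] : nbhs (a1, 0 : X i0) (V0 `&` good).
  by apply: filterI => //; exact: open_nbhs_nbhs.
exists tau, pi, (ball (a1, 0 : X i0) d), g.
have gE q : V0 q -> let p := (a1 + pi (g q).1, tau (g q).1) in
       [/\ D i0 i0 p, H i0 i0 p = q.1 & 'd (H i0 i0) p ((g q).2, 0) = q.2].
  move=> V0q; have [Ugq Xiq _] := gP q V0q.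
  move: Ugq Xiq; rewrite /U /Xi /= bL => -[/= Dq _].
  by rewrite /TH /=; case: q V0q Dq => q1 q2 /= V0q Dq [e1 e2].
split=> //.
- split; [exact: ball_open|exact: ballxx|apply: smooth_sub sg => q /dP[]//].
- by move=> q /dP[/gE].
move=> q qd Lq u w; have [V0q [good1 [good2 good3]]] := dP q qd.
have [Dp Hp _] := gE q V0q; have [Uq Xq _] := gP q V0q.
set p := (_, _) in Dp Hp good1; set z := ('d g q _).1.
have Wq : W q.1 by rewrite -Hp; exact: W_H.
(* First component of the differentiated identity [Xi (g q) = q]. *)
have mz : 'd (H i0 i0) p (PL z) = P q.1 u.
  have dg := smooth_differentiable sg V0q.
  have dX : differentiable Xi (g q) by exact: (smooth_differentiable sXi Uq).
  have fg : \forall q' \near q, Xi (g q') = q'.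
    by apply: filterS (open_nbhs_nbhs (conj oV0 V0q)) => q' V0q'; have [] := gP q' V0q'.
  have := congr1 fst (diff_right_inverse (P q.1 u, w) fg dg dX).
  by rewrite dXi.
clearbody p; pose A := horizontal_lin p.
have AI v : `|A v - v| <= eta * `|v|.
  rewrite -[X in _ - X](dH0 v Wa1) -(norm_inl0 (X i0) v); exact: good1.
pose m : {linear X i0 -> X i0} := 'd (H i0 i0) p \o PL.
have mI v : `|v| <= 2 * `|m v|.
  apply: norm_le_double.
  have PLv : 'd (H i0 i0) (a1, 0) (PL v) = v.
    by rewrite [LHS](dH0E (pi v) (tau v) Wa1) piE subrK.
  rewrite -[X in _ - X]PLv; apply: (le_trans (good1 (PL v))); apply: (@le_trans _ _ (eta * (B * `|v|))).
    by rewrite ler_pM2l //; exact: PLB.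
  by rewrite mulrA ler_wpM2r.
(* As [pi] kills [P1 v], only the vertical part [tau (P1 v)] remains, and [dH_vertical] applies. *)
have mP v : m (P1 v) = vertical_lin q.1 (A (tau (P1 v))).
  rewrite -Hp -[RHS](dH_vertical _ Dp); congr ('d _ _ _).
  by rewrite /PL /= /PLf piE tauP subrr.
apply/eqP; rewrite -normr_le0; apply/ler_addgt0Pr => e e0; rewrite add0r.
have e1 : 0 < e / (2 * B) by rewrite divr_gt0 ?mulr_gt0.
(* Thus [m z] is nearly [m (P1 v)], so [z] is nearly [P1 v], which [pi] kills; the error
   [e / (2 * B)] compensates the bounds on [pi] and on the inverse of [m]. *)
have [v vP] := @transversal_approx R (X i0) P1 tau (vertical_lin q.1) A n B eta
  (ltW B0) (ltW eta0) eta1 tauB PB tauP good2 AI (modr _ good3 Wq Lq) u _ e1.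
have pi0 : pi (P1 v) = 0 by rewrite piE tauP subrr.
rewrite -[pi z]subr0 -pi0 -linearB (le_trans (piB _))//.
rewrite (le_trans (ler_wpM2l (ltW B0) (mI _)))//.
have hm : `|m (z - P1 v)| <= e / (2 * B) by rewrite (linearB m) mP (mz : m z = vertical_lin q.1 u).
by move: hm; rewrite ler_pdivlMr ?mulr_gt0// mulrC mulrA [B * 2]mulrC.
Qed.

Hypothesis separable_charts : forall i, separable_space (X i).

(** The leaf is parametrised by the fibre over [a0]. By [dH_vertical] this parametrisation moves in
    the range of [P], along which [k] has zero derivative. *)
Lemma countable_slice (k : X i0 * X i0 -> X i0) (V : set (X i0 * X i0)) : open V ->
  (forall q, V q -> differentiable k q) ->
  (forall q, V q -> L (pa q.1) -> forall u w, 'd k q (P q.1 u, w) = 0) ->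
  countable (k @` [set q | V q /\ exists2 u, D i0 i0 (a0, u) & H i0 i0 (a0, u) = q.1]).
Proof.
move=> oV dk k0.
have oU : open [set u | D i0 i0 (a0, u)] by exact/open_slice/D_open.
have df u : D i0 i0 (a0, u) -> differentiable (fun u => H i0 i0 (a0, u)) u.
  by move=> /H_diff/diff_inr[].
have : countable ((fun p => k (H i0 i0 (a0, p.1), p.2)) @`
    [set p | D i0 i0 (a0, p.1) /\ V (H i0 i0 (a0, p.1), p.2)]).
  apply: (@countable_slices _ _ _ _ _ (fun u => H i0 i0 (a0, u)) k _ V _ _ oU oV df dk).
  - exact: separable_charts.
  - exact: separable_charts.
  - move=> u w Du Vuw u' w'.
    have [_ ->] := diff_inr (H_diff Du).
    have Ly : L (pa (H i0 i0 (a0, u))) by exists u => //=; rewrite chK //; case: Du.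
    have kz := k0 (H i0 i0 (a0, u), w) Vuw Ly ('d (H i0 i0) (a0, u) (u', 0)) w'.
    exact: (etrans (congr1 (fun z => 'd k (H i0 i0 (a0, u), w) (z, w')) (dH_vertical u' Du)) kz).
apply: sub_countable; apply: subset_card_le => _ [[y w] /= [Vyw [u Du Hu]] <-].
by exists (u, w); rewrite /= Hu.
Qed.

Variable gamma : R -> M.
Hypothesis gamma_charts : forall t, 0 <= t <= 1 -> exists j e,
  [/\ 0 < e, forall s, window t e s -> dom j (gamma s) &
      smooth_on (window t e) (fun s => ch j (gamma s))].
Hypothesis gamma_leaf : forall t, 0 <= t <= 1 -> L (gamma t).

(* Translating by a tangent vector [v] moves [gamma] near a uniform point; the
   translated curve [q] stays in one slice since it meets countably many. *)
Lemma local_lift t : 0 <= t <= 1 -> exists d (b : X i0) (beta : R -> X i0),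
  [/\ 0 < d, W b, smooth_on (window t d) beta &
      forall s, window t d s -> hl (b, beta s) = gamma s].
Proof.
move=> t01; have [a1 [r [n [Wa1 La1 r0 modr]]]] := exists_uniform_point.
have [tau [pi [V [g [ctau cpi [oV Va1 sg] gP dg0]]]]] := foliation_box Wa1 La1 r0 modr.
have [j [e0 [e00 dome sc]]] := gamma_charts t01.
pose c s := ch j (gamma s).
have dj s : window t e0 s -> W (c s) by move=> /dome; exact: W_ch.
have pac s : window t e0 s -> pa (c s) = gamma s by move=> /dome; exact: chK.
have At := window_center t01 e00.
(* [gamma t] and the uniform point lie in the same leaf, so a vector over [gamma t] reaches [a1]. *)
have [v hv] : exists v, hl (c t, v) = pa a1.
  apply: (@leaf_covered _ (c t) 0) => //; first exact: dj.
  by rewrite hl0 ?pac //; [exact: gamma_leaf|exact: dj].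
have Dt : D j i0 (c t, v) by split; [exact: dj|rewrite hv; case: Wa1].
have sc1 : smooth_on (window t e0) (fun s => (c s, v)).
  by apply: smooth_on_pair => //; exact: smooth_on_cst.
have [e1 [e10 e1e0 De]] := smooth_on_window_near sc1 t01 e00
  (open_nbhs_nbhs (conj (@D_open j i0) Dt)).
have sub1 := window_sub (t := t) e1e0.
(* [om s] is [- v] transported to [q s]; by [law1] it leads back to [gamma s]. *)
pose q s := H j i0 (c s, v); pose om s := 'd (H j i0) (c s, v) (- v, 0).
have {}sc1 := smooth_on_sub sub1 sc1.
have sq : smooth_on (window t e1) q.
  exact: (smooth_on_comp (@D_open j i0) (@H_smooth j i0) sc1 De).
have som : smooth_on (window t e1) om.
  have sTD : smooth_on (window t e1) (fun s => ((c s, v), (- v, 0 : X j))).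
    by apply: smooth_on_pair => //; exact: smooth_on_cst.
  have oT : open (D j i0 `*` [set: X j * X j]) by apply: open_setXT; exact: D_open.
  apply: (smooth_on_comp oT (smooth_diff (@D_open j i0) (@H_smooth j i0)) sTD).
  by move=> s As; split => //=; exact: De.
have qt : q t = a1 by rewrite /q /local_alg hv; case: Wa1.
have hq s : window t e1 s -> hl (q s, om s) = gamma s.
  by move=> As; rewrite law1 /= ?subrr ?hl0 ?pac //; [exact: sub1|exact/dj/sub1|exact: De].
have /nbhs_ballP[rho /= rho0 rhoV] := open_nbhs_nbhs (conj oV Va1).
have no1 : 0 < `|om t| + 1 by rewrite ltr_wpDl.
(* [om t] may be large, whereas [V] is only a neighbourhood of [(a1, 0)]; the scaling is undone by
   [kap^-1] in [Lam]. *)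
pose kap := rho / 2 / (`|om t| + 1); have kap0 : 0 < kap by rewrite !divr_gt0.
pose qo s := (q s, kap *: om s).
have Vt : V (qo t).
  apply: rhoV; rewrite /qo qt; split; first exact: ballxx.
  rewrite -ball_normE /= sub0r normrN normrZ gtr0_norm // /kap mulrAC ltr_pdivrMr//.
  have h : rho / 2 * `|om t| <= rho / 2 * (`|om t| + 1).
    by rewrite ler_pM2l ?divr_gt0// lerDl.
  apply: (le_lt_trans h); rewrite ltr_pM2r // ltr_pdivrMr // ltr_pMr //.
  by rewrite ltr1n.
have sqo : smooth_on (window t e1) qo.
  apply: smooth_on_pair => //.
  have := smooth_on_affine 0 (@scaler_continuous _ (X i0) kap) som.
  by apply: eq_smooth_on => s _; rewrite add0r.
have [e2 [e20 e2e1 Ve]] := smooth_on_window_near sqo t01 e10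
  (open_nbhs_nbhs (conj oV Vt)).
have sub2 := window_sub (t := t) e2e1.
have {}sqo := smooth_on_sub sub2 sqo.
have sG := smooth_on_comp oV sg sqo Ve.
have At2 := window_center t01 e20.
pose pi1 : {linear (X i0 * X i0)%type -> X i0} := pi \o fst.
have cpi1 : continuous pi1.
  by move=> p; apply: (@continuous_comp _ _ _ fst pi); [exact: fst_continuous|exact: cpi].
pose k p := pi1 (g p).
have dk p : V p -> differentiable k p /\ forall w, 'd k p w = pi ('d g p w).1.
  by move=> Vp; exact: (diff_lin_comp cpi1 (smooth_differentiable sg Vp)).
have ck : countable ((k \o qo) @` window t e2).
  apply: (@sub_countable _ _ _ _ _ (@countable_slice k V oV (fun p Vp => (dk p Vp).1) _)); last first.
    by move=> p Vp Lp u w; rewrite (dk p Vp).2; exact: dg0.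
  apply: subset_card_le => _ [s As <-].
  suff Q : V (qo s) /\ exists2 u, D i0 i0 (a0, u) & H i0 i0 (a0, u) = (qo s).1.
    exact: (ex_intro2 _ _ (qo s) Q erefl).
  split; first exact: Ve.
  have Ds : D j i0 (c s, v) by exact/De/sub2.
  have Ls : L (hl (c s, v)).
    apply: (@leaf_stable _ _ 0); first by case: Ds.
    rewrite hl0; last by case: Ds.
    by rewrite pac; [apply: gamma_leaf; case: As|exact/sub1/sub2].
  have [u _ hu] := Ls; exists u; last by rewrite /= /q /local_alg hu.
  by split=> //=; rewrite hu; case: Ds.
have sk : smooth_on (window t e2) (k \o qo).
  have := smooth_on_affine 0 cpi1 sG.
  by apply: eq_smooth_on => s _; rewrite add0r.
have kc := countable_curve_constant t01 e20 sk ck.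
(* The slice coordinate is constant along the window, so this is the base point for every [s]. *)
pose b := a1 + k (qo t).
have gs s : window t e2 s -> let p := (b, tau (g (qo s)).1) in
    [/\ D i0 i0 p, H i0 i0 p = q s & 'd (H i0 i0) p ((g (qo s)).2, 0) = kap *: om s].
  by move=> As; rewrite /b -[k (qo t)](kc _ As); exact: (gP (qo s) (Ve _ As)).
(* By [law1], following [tau z] from [b] and then the horizontal image of [kap^-1 *: xi] amounts to
   following their sum from [b]. *)
pose Lam : {linear (X i0 * X i0)%type -> X i0} := (tau \o fst) \+ (kap^-1 \*: snd).
have cLam : continuous Lam.
  move=> p; apply: cvgD.
    by apply: (@continuous_comp _ _ _ fst tau); [exact: fst_continuous|exact: ctau].
  by apply: cvgZr; exact: snd_continuous.
exists e2, b, (fun s => 0 + Lam (g (qo s))); split => //.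
- by have [[]] := gs t At2.
- exact: smooth_on_affine.
move=> s As; have [Dp Hp dHp] := gs s As.
rewrite add0r -(hq s (sub2 _ As)) -Hp.
have -> : om s = 'd (H i0 i0) (b, tau (g (qo s)).1) (kap^-1 *: (g (qo s)).2, 0).
  have -> : (kap^-1 *: (g (qo s)).2, 0) = kap^-1 *: ((g (qo s)).2, 0 : X i0) :> X i0 * X i0.
    by rewrite -[RHS]/(_, _) /= scaler0.
  by rewrite linearZZ dHp scalerA mulVf ?scale1r // gt_eqF.
by rewrite law1.
Qed.

Hypothesis gamma0 : gamma 0 = hl (a0, 0).

Definition lifted (t : R) := exists (gt : R -> X i0) (s : seq R),
  [/\ itv_partition 0 t s, gt 0 = 0, {within `[0, t], continuous gt},
    forall k, (k < size s)%N -> smooth_on `[nth 0 (0 :: s) k, nth 0 s k] gt &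
    forall u, 0 <= u <= t -> hl (a0, gt u) = gamma u].

(** The local lift lives over [b]. At time [s] it ends where the lift over [a0] ends, so [glue]
    carries it affinely into the fibre over [a0]. *)
Lemma lift_step t d (b : X i0) (beta : R -> X i0) s s' : W b ->
  smooth_on (window t d) beta ->
  (forall u, window t d u -> hl (b, beta u) = gamma u) ->
  0 <= s -> t - d < s -> s <= t -> t <= s' -> s' < t + d -> s' <= 1 ->
  lifted s -> lifted s'.
Proof.
move=> Wb sb hb s0 ds st ts' ds' s'1 [gt [l [pl gt0 cgt sgt hgt]]].
(* Partitions are strictly increasing, so no degenerate piece may be added. *)
have [<-|ss'n] := eqVneq s s'; first by exists gt, l.
have ss' : s < s' by rewrite lt_neqAle ss'n (le_trans st).
have win u : s <= u <= s' -> window t d u.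
  move=> /andP[su us']; split; first by rewrite (le_trans s0)//= (le_trans us').
  by rewrite ltr_distl (lt_le_trans ds)//= (le_lt_trans us').
have Ws : window t d s by apply: win; rewrite lexx ltW.
have e : hl (b, beta s) = hl (a0, gt s) by rewrite hb // hgt // s0 lexx.
have [T cT TE] := glue Wa0 Wb e.
(* The constant term makes [nu] start at [gt s], hence the glued path is continuous. *)
pose nu u := (gt s - T (beta s)) + T (beta u).
have nus : nu s = gt s by rewrite /nu subrK.
pose gt' u := if u <= s then gt u else nu u.
have gt'l u : u <= s -> gt' u = gt u by rewrite /gt' => ->.
have gt'r u : s <= u -> gt' u = nu u.
  rewrite /gt'; case: ifP => // us su; have -> : u = s by apply/eqP; rewrite eq_le us.
  by rewrite nus.
have snu : smooth_on `[s, s'] nu.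
  apply: smooth_on_affine => //; apply: smooth_on_sub sb => u /=.
  by rewrite in_itv /=; exact: win.
have sgt' : smooth_on `[s, s'] gt'.
  by apply: eq_smooth_on snu => u /=; rewrite in_itv /= => /andP[su _]; rewrite gt'r.
have [ppl lastl] := pl; have lastE : last 0 l = s by apply/eqP.
exists gt', (rcons l s'); split.
- by split; rewrite ?last_rcons // rcons_path ppl lastE.
- by rewrite gt'l.
- have -> : `[0, s']%classic = `[0, s] `|` `[s, s'] :> set R.
    apply/seteqP; split=> u /=; rewrite !in_itv /=.
      by move=> /andP[u0 us']; have [us|/ltW su] := leP u s; [left|right]; rewrite ?u0 ?su.
    by move=> [/andP[u0 us]|/andP[su us']]; rewrite ?u0 ?us' ?(le_trans us (ltW ss')) // (le_trans s0).
  apply: withinU_continuous; [exact: interval_closed|exact: interval_closed| |exact: smooth_on_continuous].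
  apply: subspace_eq_continuous cgt => u; rewrite inE /= in_itv /= => /andP[_ us].
  by apply/esym; exact: gt'l.
- move=> k; rewrite size_rcons ltnS leq_eqVlt => /orP[/eqP ->|kl].
    (* The last piece: its left end is the last point of [0 :: l], that is [s]. *)
    rewrite -rcons_cons !nth_rcons /= ltnS leqnn ltnn eqxx.
    by rewrite -[X in nth _ _ X]/(size (0 :: l)).-1 nth_last /= lastE.
  rewrite -rcons_cons !nth_rcons /= kl ltnS (ltnW kl).
  apply: eq_smooth_on (sgt k kl) => u /=; rewrite in_itv /= => /andP[_ un].
  rewrite gt'l // (le_trans un) //.
  by rewrite (set_nth_default s) //; exact: (@itv_partition_nth_le _ _ _ _ _ k.+1 kl pl).
- move=> u /andP[u0 us']; have [us|/ltW su] := leP u s.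
    by rewrite gt'l // hgt // u0.
  rewrite gt'r // /nu -addrA [- _ + _]addrC -linearB -TE [beta s + _]addrC subrK hb //.
  by apply: win; rewrite su.
Qed.

Theorem lift_in_charts : lifted 1.
Proof.
apply: real_induction => [|t t01].
  (* On the degenerate interval the empty sequence is a partition. *)
  exists (cst 0), [::]; split=> //.
  - by move=> u; exact: cvg_cst.
  - by move=> u; rewrite -eq_le => /eqP <-; rewrite gamma0.
have [d [b [beta [d0 Wb sb hb]]]] := local_lift t01.
by exists d => // s s'; exact: (lift_step Wb sb hb).
Qed.

End algebra_in_charts.

(** * Restriction of scalars to the real numbers *)

Section ground.
Context {R : realType} {c : bool}.
Local Notation K := (ground_field R c).

Definition ground_to_real : K -> R :=
  if c as b return (ground_field R b -> R) then (fun z : complex R => complex.Re z) else id.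

Local Notation iota := (@real_to_ground R c).
Local Notation rn := ground_to_real.

Lemma real_to_groundK : cancel iota rn.
Proof. by rewrite /ground_to_real /real_to_ground; case: c => x. Qed.

Lemma ground_to_realK (k : K) : 0 <= k -> iota (rn k) = k.
Proof.
rewrite /ground_to_real /real_to_ground; case: c k => //= -[a b] /=.
by rewrite lecE /= => /andP[/eqP ->].
Qed.

Lemma real_to_groundD x y : iota (x + y) = iota x + iota y.
Proof. by rewrite /real_to_ground; case: c => //=; exact: (rmorphD (real_complex R)). Qed.

Lemma real_to_groundM x y : iota (x * y) = iota x * iota y.
Proof. by rewrite /real_to_ground; case: c => //=; exact: (rmorphM (real_complex R)). Qed.

Lemma real_to_ground0 : iota 0 = 0.
Proof. by rewrite /real_to_ground; case: c. Qed.

Lemma real_to_ground1 : iota 1 = 1.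
Proof. by rewrite /real_to_ground; case: c. Qed.

Lemma real_to_ground_le x y : (iota x <= iota y) = (x <= y).
Proof. by rewrite /real_to_ground; case: c => //=; rewrite lecR. Qed.

Lemma real_to_ground_lt x y : (iota x < iota y) = (x < y).
Proof. by rewrite /real_to_ground; case: c => //=; rewrite ltcR. Qed.

Lemma real_to_ground_norm x : `|iota x| = iota `|x|.
Proof.
have [x0|x0] := leP 0 x.
  by rewrite !ger0_norm // -real_to_ground0 real_to_ground_le.
rewrite !ltr0_norm // -?real_to_ground0 ?real_to_ground_lt //.
by apply/eqP; rewrite eq_sym -subr_eq0 opprK -real_to_groundD addNr real_to_ground0.
Qed.

Lemma real_to_ground_eq0 x : (iota x == 0) = (x == 0).
Proof.
apply/eqP/eqP => [|->]; last exact: real_to_ground0.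
by rewrite -{1}real_to_ground0 => /(can_inj real_to_groundK).
Qed.

(** An alias of the carrier, so that the real module and norm structures do not clash with those
    over [K]. *)
Definition realify (E : completeNormedModType K) : Type := E.

Section realify.
Variable E : completeNormedModType K.
Local Notation E' := (realify E).

HB.instance Definition _ := GRing.Zmodule.on E'.

Definition real_scale (r : R) (v : E') : E' := iota r *: (v : E).

Fact real_scaleA a b v : real_scale a (real_scale b v) = real_scale (a * b) v.
Proof. by rewrite /real_scale scalerA -real_to_groundM. Qed.
Fact real_scale1 : left_id 1 real_scale.
Proof. by move=> v; rewrite /real_scale real_to_ground1 scale1r. Qed.
Fact real_scaleDr : right_distributive real_scale +%R.
Proof. by move=> r u v; rewrite /real_scale -scalerDr. Qed.
Fact real_scaleDl v : {morph real_scale^~ v : a b / a + b}.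
Proof. by move=> a b; rewrite /real_scale real_to_groundD -scalerDl. Qed.

HB.instance Definition _ := GRing.Zmodule_isLmodule.Build R E'
  real_scaleA real_scale1 real_scaleDr real_scaleDl.

Definition real_norm (v : E') : R := rn `|v : E|.

Lemma real_normE v : iota (real_norm v) = `|v : E|.
Proof. exact/ground_to_realK/normr_ge0. Qed.

Fact real_norm_triangle u v : real_norm (u + v) <= real_norm u + real_norm v.
Proof. by rewrite -real_to_ground_le real_to_groundD !real_normE ler_normD. Qed.
Fact real_normZ r v : real_norm (r *: v) = `|r| * real_norm v.
Proof.
apply: (can_inj real_to_groundK); rewrite real_to_groundM !real_normE.
by rewrite -real_to_ground_norm -normrZ.
Qed.
Fact real_norm0 v : real_norm v = 0 -> v = 0.
Proof.
move=> v0; apply/eqP; rewrite -(@normr_eq0 _ E) -real_normE v0.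
by rewrite real_to_ground0.
Qed.

HB.instance Definition _ := Lmodule_isNormed.Build R E'
  real_norm_triangle real_normZ real_norm0.

Lemma realify_normE (v : E') : iota `|v| = `|v : E|.
Proof. exact: real_normE. Qed.

Lemma nbhs_realify (v : E') (A : set E) : nbhs v A <-> nbhs (v : E) A.
Proof.
split=> /nbhs_ballP[e /= e0 eA]; apply/nbhs_ballP.
  exists (iota e); first by rewrite /= -real_to_ground0 real_to_ground_lt.
  move=> u; rewrite -ball_normE /= => uv; apply: eA; rewrite -ball_normE /=.
  by rewrite -real_to_ground_lt realify_normE.
exists (rn e); first by rewrite /= -real_to_ground_lt real_to_ground0 ground_to_realK // ltW.
move=> u; rewrite -ball_normE /= => uv; apply: eA; rewrite -ball_normE /=.
by move: uv; rewrite -real_to_ground_lt realify_normE ground_to_realK // ltW.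
Qed.

Fact realify_complete (F : set_system E') : ProperFilter F -> cauchy F -> cvg F.
Proof.
move=> FF cF.
have FF' : ProperFilter (F : set_system E) by [].
have cF' : cauchy (F : set_system E).
  apply/cauchyP => e e0.
  have e1 : 0 < rn e by rewrite -real_to_ground_lt real_to_ground0 ground_to_realK // ltW.
  have [v Fv] := (cauchyP F).1 cF _ e1; exists v.
  apply: filterS Fv => u; rewrite -!ball_normE /= -real_to_ground_lt realify_normE.
  by rewrite ground_to_realK // ltW.
have /cvg_ex[l /= Fl] : cvg (F : set_system E) by exact: cauchy_cvg.
by apply/cvg_ex; exists (l : E') => A /nbhs_realify; exact: Fl.
Qed.

HB.instance Definition _ := Uniform_isComplete.Build E' realify_complete.
End realify.
End ground.

(** * Transfer of smoothness from the ground field to the real numbers *)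

Section transfer.
Context {R : realType} {c : bool}.
Local Notation K := (ground_field R c).
Local Notation iota := (@real_to_ground R c).
Implicit Types E F : normedModType K.
Implicit Types G J : normedModType R.

(** Isometries between arbitrary spaces, rather than the mere identity on [realify E], are stable
    under products, as the [Ck] tower demands. *)
Record real_iso E G (phi : G -> E) (psi : E -> G) : Prop := RealIso {
  real_isoK : cancel phi psi;
  real_isoVK : cancel psi phi;
  real_isoD : forall u v, phi (u + v) = phi u + phi v;
  real_isoZ : forall r u, phi (r *: u) = iota r *: phi u;
  real_iso_norm : forall u, `|phi u| = iota `|u| }.

Lemma real_isoVD E G phi psi (iE : @real_iso E G phi psi) u v :
  psi (u + v) = psi u + psi v.
Proof. by apply: (can_inj (real_isoK iE)); rewrite (real_isoD iE) !(real_isoVK iE). Qed.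

Lemma real_isoVZ E G phi psi (iE : @real_iso E G phi psi) r u :
  psi (iota r *: u) = r *: psi u.
Proof. by apply: (can_inj (real_isoK iE)); rewrite (real_isoZ iE) !(real_isoVK iE). Qed.

Lemma real_isoN E G phi psi (iE : @real_iso E G phi psi) u : phi (- u) = - phi u.
Proof.
apply: (addrI (phi u)); rewrite -(real_isoD iE) !subrr -[0](scale0r (0 : G)).
by rewrite (real_isoZ iE) real_to_ground0 scale0r.
Qed.

Lemma real_isoVN E G phi psi (iE : @real_iso E G phi psi) u : psi (- u) = - psi u.
Proof. by apply: (can_inj (real_isoK iE)); rewrite (real_isoN iE) !(real_isoVK iE). Qed.

Lemma real_isoV_norm E G phi psi (iE : @real_iso E G phi psi) u :
  iota `|psi u| = `|u|.
Proof. by rewrite -(real_iso_norm iE) (real_isoVK iE). Qed.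

Lemma near_real_iso E G phi psi (iE : @real_iso E G phi psi) x (S : E -> Prop) :
  (\forall y \near phi x, S y) -> \forall y \near x, S (phi y).
Proof.
move=> /nbhs_ballP[e /= e0 eS]; apply/nbhs_ballP.
exists (ground_to_real e).
  by rewrite /= -(real_to_ground_lt (c := c)) real_to_ground0 ground_to_realK // ltW.
move=> y; rewrite -ball_normE /= => xy; apply: eS; rewrite -ball_normE /=.
rewrite -(real_isoN iE) -(real_isoD iE) (real_iso_norm iE).
by move: xy; rewrite -(real_to_ground_lt (c := c)) ground_to_realK // ltW.
Qed.

Lemma continuous_real_iso E G phi psi (iE : @real_iso E G phi psi) : continuous phi.
Proof. by move=> x A /= nA; exact: (near_real_iso iE). Qed.

Lemma open_real_iso E G phi psi (iE : @real_iso E G phi psi) U :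
  open U -> open (phi @^-1` U).
Proof. by move=> oU; apply: open_comp => // x _; exact: (continuous_real_iso iE). Qed.

(** The real differential is the differential over [K] with restricted scalars. *)
Lemma diff_real_iso E G F J phi psi phi' psi' (iE : @real_iso E G phi psi)
    (iF : @real_iso F J phi' psi') (f : E -> F) x : differentiable f (phi x) ->
  differentiable (psi' \o f \o phi) x /\
  forall v, 'd (psi' \o f \o phi) x v = psi' ('d f (phi x) (phi v)).
Proof.
move=> df; have [k k0 kP] := diff_lipschitz df.
pose T v := psi' ('d f (phi x) (phi v)).
have Tl : linear T.
  move=> r u v; rewrite /T (real_isoD iE) (real_isoZ iE) linearP.
  by rewrite (real_isoVD iF) (real_isoVZ iF).
pose TL : {linear G -> J} := HB.pack T (GRing.isLinear.Build _ _ _ _ _ Tl).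
have cTL : continuous TL.
  apply: (@lipschitz_linear_continuous _ _ _ TL (ground_to_real k)).
    by rewrite -(real_to_ground_lt (c := c)) real_to_ground0 ground_to_realK // ltW.
  move=> v; rewrite -(real_to_ground_le (c := c)) real_to_groundM (ground_to_realK (ltW k0)).
  by rewrite (real_isoV_norm iF) -(real_iso_norm iE); exact: kP.
have [] := @near_differentiable _ _ _ (psi' \o f \o phi) x TL cTL.
  move=> e e0.
  have e1 : 0 < iota e by rewrite -real_to_ground0 real_to_ground_lt.
  apply: filterS (near_real_iso iE (diff_near df e1)) => y /= H.
  rewrite -(real_to_ground_le (c := c)) real_to_groundM -(real_iso_norm iE).
  rewrite (real_isoD iE) (real_isoN iE) (le_trans _ H)// /T.
  rewrite -!(real_isoVN iF) -!(real_isoVD iF) (real_isoV_norm iF).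
  by rewrite (real_isoD iE) (real_isoN iE).
by move=> dT TE; split=> // v; rewrite TE.
Qed.

Lemma real_iso_prod E G F J phi psi phi' psi' : @real_iso E G phi psi ->
  @real_iso F J phi' psi' ->
  @real_iso (E * F)%type (G * J)%type (fun p => (phi p.1, phi' p.2)) (fun p => (psi p.1, psi' p.2)).
Proof.
move=> iE iF; split.
- by move=> [u v] /=; rewrite (real_isoK iE) (real_isoK iF).
- by move=> [u v] /=; rewrite (real_isoVK iE) (real_isoVK iF).
- by move=> [u v] [u' v'] /=; rewrite (real_isoD iE) (real_isoD iF).
- by move=> r [u v] /=; rewrite (real_isoZ iE) (real_isoZ iF).
- move=> [u v]; rewrite norm_pair [X in iota X]norm_pair /= (real_iso_norm iE) (real_iso_norm iF).
  have [uv|vu] := leP `|u| `|v|.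
    by rewrite max_r // real_to_ground_le.
  by rewrite max_l // real_to_ground_le ltW.
Qed.

Lemma Ck_real_iso k E G F J phi psi phi' psi' (iE : @real_iso E G phi psi)
    (iF : @real_iso F J phi' psi') U (f : E -> F) : open U ->
  Ck k U f -> Ck k (phi @^-1` U) (psi' \o f \o phi).
Proof.
elim: k E G F J phi psi phi' psi' iE iF U f => [|k IH] E G F J phi psi phi' psi' iE iF U f oU.
  move=> cf x Ux A /= nA.
  have nphi : \forall y \near f (phi x), A (psi' y).
    have e : phi' (psi' (f (phi x))) = f (phi x) by rewrite (real_isoVK iF).
    move: nA => /nbhs_ballP[e' /= e0 eA]; apply/nbhs_ballP; exists (iota e').
      by rewrite /= -real_to_ground0 real_to_ground_lt.
    move=> y; rewrite -ball_normE /= => xy; apply: eA; rewrite -ball_normE /=.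
    rewrite -(real_to_ground_lt (c := c)) -(real_isoVN iF) -(real_isoVD iF).
    by rewrite (real_isoV_norm iF).
  have := near_real_iso iE (cf _ Ux _ nphi).
  exact.
move=> [df cf]; split=> [x Ux|]; first by have [] := diff_real_iso iE iF (df _ Ux).
have := IH _ _ _ _ _ _ _ _ (real_iso_prod iE iE) (real_iso_prod iF iF) _ _ (open_setXT oU) cf.
have -> : (fun p : G * G => (phi p.1, phi p.2)) @^-1` (U `*` setT) = (phi @^-1` U) `*` setT.
  by apply/seteqP; split=> p [].
apply: eq_Ck; first by apply: open_setXT; exact: (open_real_iso iE).
move=> [x v] [/= Ux _]; congr pair.
by have [_ ->] := diff_real_iso iE iF (df _ Ux).
Qed.

Lemma smooth_real_iso E G F J phi psi phi' psi' (iE : @real_iso E G phi psi)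
    (iF : @real_iso F J phi' psi') U (f : E -> F) : open U ->
  smooth U f -> smooth (phi @^-1` U) (psi' \o f \o phi).
Proof. by move=> oU sf k; exact: (Ck_real_iso iE iF oU (sf k)). Qed.

Variable X : completeNormedModType K.

Lemma realify_iso : @real_iso X (realify X) id id.
Proof. by split=> // u; exact: (esym (realify_normE _)). Qed.

Lemma realify_separable : separable_space X -> separable_space (realify X).
Proof.
move=> [D cD dD]; exists D => // O [x Ox] oO.
have [|y [Oy Dy]] := dD O (ex_intro _ x Ox); last by exists y.
by rewrite openE => y Oy; apply/nbhs_realify; apply: open_nbhs_nbhs.
Qed.

Lemma realify_closed (A : set X) : closed A -> closed (A : set (realify X)).
Proof.
move=> cA x clx; apply: cA => B /nbhs_realify; exact: clx.
Qed.

(** The remainder estimate is the difference quotient multiplied by [s - t]; the point [s = t],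
    absent from the punctured filter, satisfies it trivially. *)
Lemma smooth_curve_realify (A : set R) (g : R -> X) :
  @smooth_curve R c X A g <-> smooth_on A (g : R -> realify X).
Proof.
have H (f f' : R -> X) t : A t ->
    ((iota (s - t))^-1 *: (f s - f t) @[s --> within A t^'] --> f' t) <->
    (forall e, 0 < e -> exists2 d, 0 < d & forall s, A s -> `|s - t| < d ->
      `|(f s - f t : realify X) - (s - t) *: (f' t : realify X)| <= e * `|s - t|).
  move=> At.
  have sE s : (f s - f t : realify X) - (s - t) *: (f' t : realify X) =
    ((f s - f t) - iota (s - t) *: f' t : X) by [].
  split.
    move=> /cvgrPdist_le cv e e0.
    have e1 : 0 < iota e by rewrite -real_to_ground0 real_to_ground_lt.
    have := cv _ e1; rewrite /within /= /dnbhs => /nbhs_ballP[d /= d0 dP].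
    exists d => // s As st; have [->|sn] := eqVneq s t.
      by rewrite !subrr scale0r subrr !normr0 mulr0.
    have := dP s; rewrite -ball_normE /= distrC => /(_ st sn As) h.
    rewrite -(real_to_ground_le (c := c)) realify_normE real_to_groundM -real_to_ground_norm (sE s).
    have st0 : iota (s - t) != 0 by rewrite real_to_ground_eq0 subr_eq0.
    rewrite -ler_pdivrMr ?normr_gt0// (le_trans _ h)//.
    by rewrite mulrC -normfV -normrZ scalerBr scalerA mulVf // scale1r distrC.
  move=> ev; apply/cvgrPdist_le => e e0.
  have e1 : 0 < ground_to_real e.
    by rewrite -(real_to_ground_lt (c := c)) real_to_ground0 ground_to_realK // ltW.
  have [d d0 dP] := ev _ e1.
  rewrite /within /= /dnbhs; apply/nbhs_ballP; exists d => // s.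
  rewrite -ball_normE /= distrC => st sn As.
  have := dP s As st.
  rewrite -(real_to_ground_le (c := c)) realify_normE real_to_groundM -real_to_ground_norm (sE s).
  rewrite (ground_to_realK (ltW e0)).
  have st0 : iota (s - t) != 0 by rewrite real_to_ground_eq0 subr_eq0.
  rewrite -ler_pdivrMr ?normr_gt0//; apply: le_trans.
  by rewrite [leRHS]mulrC -normfV -normrZ [in leRHS]scalerBr scalerA mulVf // scale1r distrC.
split=> [[d [d0 dd]]|[d dd d0]].
  by exists d => // n t At e e0; have /H := dd n t At; apply.
by exists d; split=> // n t At; apply/H => //; exact: dd.
Qed.
End transfer.

(** * From manifolds to charts *)

Section manifolds.
Context {K : numFieldType}.
Implicit Types M N : premanifold K.

Lemma coord_change_chart M i j (x : M) : pm_dom i x ->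
  @coord_change K M i j (pm_chart i x) = pm_chart j x.
Proof. by move=> ix; rewrite /coord_change /local_expr pm_chartK. Qed.

Lemma differentiable_coord_change M i j (x : M) : pm_dom i x -> pm_dom j x ->
  differentiable (@coord_change K M i j) (pm_chart i x).
Proof. by move=> ix jx; apply: smooth_differentiable (@pm_smooth K M i j) _; exists x. Qed.

Lemma nbhs_chart M i j (x : M) : pm_dom i x -> pm_dom j x ->
  nbhs (pm_chart i x) (@pm_chart K M i @` (@pm_dom K M i `&` @pm_dom K M j)).
Proof. by move=> ix jx; apply: open_nbhs_nbhs; split; [exact: pm_open|exists x]. Qed.

Section maps.
Variables (M N : premanifold K) (U : set M) (f : M -> N).
Hypothesis sf : smooth_map_on U f.

Lemma smooth_map_differentiable i j x : pm_dom i x -> pm_dom j (f x) -> U x ->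
  differentiable (@local_expr K M N f i j) (pm_chart i x).
Proof.
move=> ix jfx Ux; have [_ sD] := sf i j.
by apply: smooth_differentiable sD _; exists x.
Qed.

Lemma nbhs_smooth_map i j x : pm_dom i x -> pm_dom j (f x) -> U x ->
  nbhs (pm_chart i x) (@pm_chart K M i @` [set y | [/\ pm_dom i y, U y & pm_dom j (f y)]]).
Proof.
move=> ix jfx Ux; have [oD _] := sf i j.
by apply: open_nbhs_nbhs; split=> //; exists x.
Qed.

(** Chain rule applied to the two equal composites of the local expressions of [f] with the
    coordinate changes: the tangent map does not depend on the charts. *)
Lemma diff_local_expr_change i i' j j' x u : pm_dom i x -> pm_dom i' x ->
  pm_dom j (f x) -> pm_dom j' (f x) -> U x ->
  'd (@local_expr K M N f i' j') (pm_chart i' x) (@coord_diff K M i i' (pm_chart i x) u) =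
  @coord_diff K N j j' (pm_chart j (f x)) ('d (@local_expr K M N f i j) (pm_chart i x) u).
Proof.
move=> ix i'x jx j'x Ux.
have dc := differentiable_coord_change ix i'x.
have dc' := differentiable_coord_change jx j'x.
have df := smooth_map_differentiable ix jx Ux.
have df' : differentiable (@local_expr K M N f i' j') (@coord_change K M i i' (pm_chart i x)).
  by rewrite coord_change_chart //; exact: smooth_map_differentiable.
have fx : @local_expr K M N f i j (pm_chart i x) = pm_chart j (f x).
  by rewrite /local_expr pm_chartK.
have dc2 : differentiable (@coord_change K N j j') (@local_expr K M N f i j (pm_chart i x)).
  by rewrite fx.
have nb : \forall a \near pm_chart i x,
    (@local_expr K M N f i' j' \o @coord_change K M i i') a =
    (@coord_change K N j j' \o @local_expr K M N f i j) a.
  apply: filterS (filterI (nbhs_chart ix i'x) (nbhs_smooth_map ix jx Ux)).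
  move=> _ [[y [iy i'y] <-] [z [iz _ jfz] zy]].
  have yz : z = y by rewrite -(pm_chartK iz) zy pm_chartK.
  rewrite {}yz in jfz.
  by rewrite /= coord_change_chart // /local_expr /coord_change /local_expr !pm_chartK.
have [_ e] := near_diff_eq nb (differentiable_comp dc df').
have e1 := congr1 (fun k => k u) (diff_comp dc df').
have e2 := congr1 (fun k => k u) (diff_comp df dc2).
move: e1 e2; rewrite /= coord_change_chart // fx => e1 e2.
by rewrite /coord_diff -[LHS]e1 -[RHS]e2 e.
Qed.
End maps.

(** The base point on the left equals [x] only through [pm_chartK]; it is generalised to [y] so that
    the dependent pair can be rewritten. *)
Lemma tangent_param_vec M i (x : M) u : pm_dom i x ->
  @tangent_param K M i (pm_chart i x, u) =
  tangent_vec (@coord_diff K M i (pm_at x) (pm_chart i x) u).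
Proof.
move=> ix; have H (y : M) : y = x -> existT (fun x : M => tangent_space x) y
    (@coord_diff K M i (pm_at y) (pm_chart i x) u) =
    tangent_vec (@coord_diff K M i (pm_at x) (pm_chart i x) u) by move=> ->.
exact/H/pm_chartK.
Qed.

Lemma tangent_map_param M N (f : M -> N) i j (x : M) u : smooth_map f ->
  pm_dom i x -> pm_dom j (f x) ->
  tangent_map f (@tangent_param K M i (pm_chart i x, u)) =
  @tangent_param K N j (pm_chart j (f x), 'd (@local_expr K M N f i j) (pm_chart i x) u).
Proof.
move=> sf ix jx; rewrite !tangent_param_vec // /tangent_map /= /tangent_map_at /=.
congr tangent_vec.
exact: (diff_local_expr_change sf u ix (pm_atP x) jx (pm_atP (f x)) I).
Qed.

(** Coordinate changes of the tangent bundle lie over those of [M]; differentiate this commutation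
    with [fst]. *)
Lemma coord_diff_tangent_fst M i k (x : M) (p q : @pm_model K M i * @pm_model K M i) : pm_dom i x -> pm_dom k x -> p.1 = pm_chart i x ->
  (@coord_diff K (tangent_bundle M) i k p q).1 = @coord_diff K M i k p.1 q.1.
Proof.
move=> ix kx px.
have dF : differentiable (@coord_change K (tangent_bundle M) i k) p.
  apply: smooth_differentiable (@pm_smooth K (tangent_bundle M) i k) _.
  suff : (@tangent_chart K M i @` (@tangent_dom K M i `&` @tangent_dom K M k)) p by [].
  by rewrite tangent_image; split=> //=; rewrite px; exists x.
have dc : differentiable (@coord_change K M i k) p.1.
  by rewrite px; exact: differentiable_coord_change.
have [d1 dE1] := diff_fst p.
have [d2 dE2] := diff_fst (@coord_change K (tangent_bundle M) i k p).
have e1 := congr1 (fun g => g q) (diff_comp dF d2).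
have e2 := congr1 (fun g => g q) (diff_comp d1 dc).
move: e1 e2 => /=; rewrite dE1 dE2 => e1 e2.
rewrite /coord_diff -[LHS]e1 -[RHS]e2; congr ('d _ _ _).
Qed.

(** [tangent_muE] is the formula in the preferred chart. Moving there, the horizontal component
    transforms like a tangent vector of [M], by [coord_diff_tangent_fst], so the sum commutes with
    the move. *)
Lemma tangent_mu_param M i (p q : @pm_model K M i * @pm_model K M i) :
  (pm_chart i @` pm_dom i) p.1 ->
  tangent_mu (@tangent_param K (tangent_bundle M) i (p, q)) =
  @tangent_param K M i (p.1, p.2 + q.1).
Proof.
move=> [x ix xp].
set k := pm_at (pm_param p.1).
have kx : pm_dom k x by rewrite /k -xp pm_chartK //; exact: pm_atP.
have := @coord_diff_tangent_fst M i k x p q ix kx (esym xp).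
rewrite /tangent_param /=.
case E : (@coord_diff K (tangent_bundle M) i k p q) => [v w] /= vE.
transitivity (tangent_vec (@coord_diff K M i k p.1 p.2 + v)).
  rewrite -(@tangent_muE K M (pm_param p.1 : M) (@coord_diff K M i k p.1 p.2) v w) -E.
  by [].
by rewrite vE /tangent_vec /coord_diff -linearD.
Qed.

Lemma tangent_vec_param M (x : M) (v : tangent_space x) :
  tangent_vec v = @tangent_param K M (pm_at x) (pm_chart (pm_at x) x, v).
Proof. by rewrite tangent_param_vec ?coord_diff_id //; exact: pm_atP. Qed.

End manifolds.

(** * Continuous one-sided inverses from splittings *)

Section split_inverses.
Context {R : realType} {E F : completeNormedModType R}.

(** The inverse takes the unique preimage lying in the complement [G]. Its graph is cut out by
    closed conditions, so the closed graph theorem applies. *)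
Lemma split_right_inverse (S : {linear E -> F}) (G : set E) : continuous S ->
  (forall w, exists v, S v = w) -> closed_subspace G -> [set v | S v = 0] `&` G = [set 0] ->
  (forall u, exists v w, [/\ S v = 0, G w & u = v + w]) ->
  exists2 T : {linear F -> E}, continuous T & forall w, S (T w) = w.
Proof.
move=> cS surj [cG G0 GD GZ] SG dec.
have uniq u v : G u -> G v -> S u = S v -> u = v.
  move=> Gu Gv uv; apply/eqP; rewrite -subr_eq0; apply/eqP.
  suff : ([set v | S v = 0] `&` G) (u - v) by rewrite SG.
  split; first by rewrite /= linearB uv subrr.
  by apply: GD => //; rewrite -scaleN1r; exact: GZ.
have step w : exists x, G x /\ S x = w.
  have [u uw] := surj w; have [v [x [Sv Gx ux]]] := dec u.
  by exists x; split=> //; rewrite -uw ux linearD Sv add0r.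
have [T TP] := choice step.
have Tl : linear T.
  move=> r u v; have [Gu Su] := TP u; have [Gv Sv] := TP v; have [Guv Suv] := TP (r *: u + v).
  by apply: uniq => //; [apply: GD => //; exact: GZ|rewrite linearP Su Sv].
pose TL : {linear F -> E} := HB.pack T (GRing.isLinear.Build _ _ _ _ _ Tl).
exists TL => [|w]; last by have [] := TP w.
apply: closed_graph.
have -> : [set p : F * E | p.2 = TL p.1] =
    (snd @^-1` G) `&` ((fun p : F * E => S p.2 - p.1) @^-1` [set 0]).
  apply/seteqP; split=> -[w x] /=.
    by move=> ->; have [Gx Sx] := TP w; split; rewrite // Sx subrr.
  move=> [Gx /eqP]; rewrite subr_eq0 => /eqP Sx.
  by have [Gw Sw] := TP w; apply: uniq => //; rewrite Sx.
apply: closedI; first by apply: closed_comp => // p _; exact: snd_continuous.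
apply: closed_comp; last first.
  by apply/accessible_closed_set1/hausdorff_accessible; exact: norm_hausdorff.
move=> p _; apply: cvgB; last exact: fst_continuous.
by apply: (@continuous_comp _ _ _ snd S); [exact: snd_continuous|exact: cS].
Qed.

(** The inverse is the projection along [G] read through [J]; its graph is the preimage of the
    closed set [G]. *)
Lemma split_left_inverse (J : {linear E -> F}) (G : set F) : continuous J ->
  injective J -> closed_subspace G -> range J `&` G = [set 0] ->
  (forall u, exists v w, [/\ range J v, G w & u = v + w]) ->
  exists2 T : {linear F -> E}, continuous T & forall v, T (J v) = v.
Proof.
move=> cJ inj [cG G0 GD GZ] JG dec.
have GB u v : G u -> G v -> G (u - v).
  by move=> Gu Gv; apply: GD => //; rewrite -scaleN1r; exact: GZ.
have uniq y u v : G (y - J u) -> G (y - J v) -> u = v.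
  move=> Gu Gv; apply: inj; apply/eqP; rewrite -subr_eq0; apply/eqP.
  suff : (range J `&` G) (J u - J v) by rewrite JG.
  split; first by exists (u - v) => //; rewrite linearB.
  have -> : J u - J v = (y - J v) - (y - J u) by rewrite opprB [RHS]addrC subrKA.
  exact: GB.
have step y : exists x, G (y - J x).
  have [v [w [[x _ <-] Gw ->]]] := dec y.
  by exists x; rewrite addrAC subrr add0r.
have [T TP] := choice step.
have Tl : linear T.
  move=> r u v; apply: (uniq (r *: u + v)) => //.
  have -> : r *: u + v - J (r *: T u + T v) = r *: (u - J (T u)) + (v - J (T v)).
    by rewrite linearP scalerBr opprD addrACA.
  by apply: GD => //; exact: GZ.
pose TL : {linear F -> E} := HB.pack T (GRing.isLinear.Build _ _ _ _ _ Tl).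
exists TL => [|v]; last by apply: (uniq (J v)); [exact: TP|rewrite subrr].
apply: closed_graph.
have -> : [set p : F * E | p.2 = TL p.1] = (fun p : F * E => p.1 - J p.2) @^-1` G.
  apply/seteqP; split=> -[y x] /=; first by move=> ->; exact: TP.
  by move=> Gx; apply: (uniq y) => //; exact: TP.
apply: closed_comp => // p _; apply: cvgB; first exact: fst_continuous.
by apply: (@continuous_comp _ _ _ snd J); [exact: snd_continuous|exact: cJ].
Qed.
End split_inverses.

Section tame_charts.
Context {R : realType} {c : bool}.
Local Notation K := (ground_field R c).

Lemma realify_linear (E F : completeNormedModType K) (L : {linear E -> F}) : continuous L ->
  exists2 T : {linear (realify E) -> (realify F)}, continuous T & T = L :> (E -> F).
Proof.
move=> cL; have Tl : linear (L : realify E -> realify F).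
  by move=> r u v; exact: (linearP L (@real_to_ground R c r)).
pose TL : {linear (realify E) -> (realify F)} :=
  HB.pack (L : realify E -> realify F) (GRing.isLinear.Build _ _ _ _ _ Tl).
by exists TL => // x A /nbhs_realify nA; apply/nbhs_realify; exact: cL.
Qed.

Lemma realify_closed_subspace (E : completeNormedModType K) (G : set E) :
  closed_subspace G -> closed_subspace (G : set (realify E)).
Proof.
move=> [cG G0 GD GZ]; split=> //; first exact: realify_closed.
by move=> r u Gu; exact: (GZ (@real_to_ground R c r)).
Qed.

Lemma split_linear_right_inverse (E F : completeNormedModType K) (S : {linear E -> F}) :
  continuous S -> (forall w, exists v, S v = w) -> splits [set v | S v = 0] ->
  exists2 T : {linear (realify F) -> (realify E)}, continuous T & forall w, S (T w) = w.
Proof.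
move=> cS surj [_ [G [sG SG dec]]]; have [S' cS' SE] := realify_linear cS.
have [||||T cT TE] := @split_right_inverse R _ _ S' G cS'.
- by move=> w; have [v] := surj w; exists v; rewrite SE.
- exact: realify_closed_subspace.
- by rewrite SE.
- by move=> u; have [v [w [? ? ?]]] := dec u; exists v, w; rewrite SE.
by exists T => // w; have := TE w; rewrite SE.
Qed.

Lemma split_linear_left_inverse (E F : completeNormedModType K) (J : {linear E -> F}) :
  continuous J -> injective J -> splits (range J) ->
  exists2 T : {linear (realify F) -> (realify E)}, continuous T & forall v, T (J v) = v.
Proof.
move=> cJ inj [_ [G [sG JG dec]]]; have [J' cJ' JE] := realify_linear cJ.
have [||||T cT TE] := @split_left_inverse R _ _ J' G cJ'.
- by rewrite JE.
- exact: realify_closed_subspace.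
- by rewrite JE.
- by move=> u; have [v [w [? ? ?]]] := dec u; exists v, w; rewrite JE.
by exists T => // w; have := TE w; rewrite JE.
Qed.
End tame_charts.

(** * Tameness and the algebra law in real charts *)

Section tame_algebra.
Context {R : realType} {c : bool}.
Local Notation K := (ground_field R c).
Variables (M : premanifold K) (h : tangent_bundle M -> M).
Hypothesis h_algebra : tangent_algebra h.
Local Notation H i j := (@local_expr K (tangent_bundle M) M h i j).

Lemma coord_diff_continuous i j (x : M) : pm_dom i x -> pm_dom j x ->
  continuous (@coord_diff K M i j (pm_chart i x)).
Proof. by move=> ix jx; exact: (diff_continuous (differentiable_coord_change ix jx)). Qed.

Lemma algebra_smooth : smooth_map h. Proof. by case: h_algebra. Qed.
Lemma algebra_unit x : h (@tangent_vec K M x 0) = x. Proof. by case: h_algebra. Qed.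

(** Differentiate the factorisation of [h] on the fibre over [x] at the origin: [S] and [J] are the
    tangent maps of the submersion and of the immersion, and the coordinate changes pass between
    their preferred charts and [i]. *)
Lemma vertical_factorization (x : M) i : tame h -> pm_dom i x ->
  exists (Z : completeNormedModType K) (S : {linear tangent_space x -> Z}) (k : pm_idx M)
      (J : {linear Z -> @pm_model K M k}),
    [/\ pm_dom k x, continuous S /\ continuous J,
     (forall w, exists v, S v = w) /\ splits [set v | S v = 0],
     injective J /\ splits (range J) &
     forall u, 'd (H i i) (pm_chart i x, 0) (0, u) =
       @coord_diff K M k i (pm_chart k x)
         (J (S (@coord_diff K M i (pm_at x) (pm_chart i x) u)))].
Proof.
move=> h_tame ix; have [U [Pm [s [ii [[oU U0] _ [ss subm] [si imm] fE]]]]] := h_tame x.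
set V := tangent_space x in s oU U0 ss subm fE.
pose f : vector_manifold V -> M := fiber_map h (x := x).
have f0 : f (0 : V) = x by exact: algebra_unit.
(* [ii y = x] is only a propositional equality, so the tangent map of [ii] lands in the chart [k],
   not in the preferred chart at [x]. *)
pose y := s (0 : V); pose k := pm_at (ii y).
have iiy : ii y = x by rewrite -f0 /f (fE _ U0).
have kx : pm_dom k x by rewrite -iiy; exact: pm_atP.
have [surjS splitS] := subm _ U0; have [injJ splitJ] := imm y.
pose ls := @local_expr K (vector_manifold V) Pm s tt (pm_at y).
pose li := @local_expr K Pm M ii (pm_at y) k.
have dls : differentiable ls (0 : V).
  exact: (@smooth_map_differentiable K (vector_manifold V) Pm U s ss tt (pm_at y) (0 : V) I (pm_atP y) U0).
have ls0 : ls 0 = pm_chart (pm_at y) y by [].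
have dli : differentiable li (pm_chart (pm_at y) y).
  exact: (@smooth_map_differentiable K Pm M setT ii si (pm_at y) k y (pm_atP y) (pm_atP (ii y)) I).
exists (tangent_space y), ('d ls (0 : V)), k, ('d li (pm_chart (pm_at y) y)).
split.
- exact: kx.
- by split; exact: diff_continuous.
- by split; [exact: surjS|exact: splitS].
- by split; [exact: injJ|exact: splitJ].
move=> u.
pose C : {linear @pm_model K M i -> V} := 'd (@coord_change K M i (pm_at x)) (pm_chart i x).
have cC : continuous C by exact: (coord_diff_continuous ix (pm_atP x)).
pose phi v := li (ls v).
have dphi : differentiable phi (0 : V) by apply: (differentiable_comp dls); rewrite ls0.
have phiE v : 'd phi (0 : V) v = 'd li (pm_chart (pm_at y) y) ('d ls (0 : V) v).
  by rewrite (diff_comp dls) // ls0.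
have near_phi : \forall v \near (0 : V), pm_dom k (f v) /\ phi v = pm_chart k (f v).
  have n1 := @nbhs_smooth_map K (vector_manifold V) Pm U s ss tt (pm_at y) (0 : V) I (pm_atP y) U0.
  have n2 := @nbhs_smooth_map K Pm M setT ii si (pm_at y) k y (pm_atP y) (pm_atP (ii y)) I.
  have n3 := differentiable_continuous dls n2.
  apply: filterS (filterI n1 n3) => v [[v' [_ Uv' sv'] /= vv'] [z [iz _ kz] zv]].
  rewrite {}vv' in Uv' sv'.
  have zs : z = s v by rewrite -(pm_chartK iz) zv /ls /local_expr /= pm_chartK.
  rewrite {}zs in kz.
  rewrite /f (fE _ Uv'); split=> //.
  by rewrite /phi /li /ls /local_expr /= pm_chartK.
have dCk : differentiable (@coord_change K M k i) (pm_chart k x).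
  exact: differentiable_coord_change.
have phi0 : phi 0 = pm_chart k x by rewrite /phi ls0 /li /local_expr pm_chartK ?iiy //; exact: pm_atP.
have dH : differentiable (H i i) (pm_chart i x, 0).
  have := @smooth_map_differentiable K (tangent_bundle M) M setT h algebra_smooth i i
    (@tangent_param K M i (pm_chart i x, 0)).
  rewrite [X in differentiable _ X](_ : _ = (pm_chart i x, 0)).
    apply=> //; first by rewrite /= /tangent_dom /= pm_chartK.
    by rewrite tangent_param_vec // /coord_diff linear0 algebra_unit.
  rewrite tangent_param_vec //= /tangent_chart /= coord_diffK ?coord_diff_id //.
  exact: pm_atP.
have [_ <-] := diff_inr dH.
have C0 : C 0 = 0 by exact: linear0.
pose psi u := @coord_change K M k i (phi (0 + C u)).
have dphi' : differentiable phi (0 + C 0) by rewrite C0 addr0.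
have [dpC dpCE] := differentiable_affine_comp cC dphi'.
have dCk' : differentiable (@coord_change K M k i) (phi (0 + C 0)).
  by rewrite C0 addr0 phi0.
have dpsi : differentiable psi 0 by exact: (differentiable_comp dpC dCk').
have [|_ ->] := @near_diff_eq _ _ _ psi (fun w => H i i (pm_chart i x, w)) 0 _ dpsi.
  have nC : \forall v \near C 0, pm_dom k (f v) /\ phi v = pm_chart k (f v) by rewrite C0.
  have nw : \forall w \near (0 : @pm_model K M i), pm_dom k (f (C w)) /\ phi (C w) = pm_chart k (f (C w)).
    exact: (cC _ _ nC).
  apply: filterS nw => w [kw phiw].
  rewrite /psi add0r phiw coord_change_chart // /local_expr.
  by rewrite [pm_param _](tangent_param_vec w ix).
rewrite (diff_comp dpC dCk') /= dpCE C0 addr0 phi0 phiE.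
by [].
Qed.
End tame_algebra.

Section realified_atlas.
Context {R : realType} {c : bool}.
Local Notation K := (ground_field R c).
Variables (M : premanifold K) (h : tangent_bundle M -> M).
Hypothesis h_algebra : tangent_algebra h.
Local Notation HK i j := (@local_expr K (tangent_bundle M) M h i j :
  (@pm_model K M i * @pm_model K M i)%type -> @pm_model K M j).

Definition real_model (i : pm_idx M) : completeNormedModType R := realify (@pm_model K M i).
Definition real_alg (i : pm_idx M) (p : real_model i * real_model i) : mspace M :=
  h (@tangent_param K M i p).

Local Notation D i j := (@local_dom R (mspace M) (pm_idx M) real_model
  (@pm_dom K M) (@pm_chart K M) (@pm_param K M) real_alg i j).
Local Notation H i j := (@local_alg R (mspace M) (pm_idx M) real_model
  (@pm_chart K M) real_alg i j).

Lemma tangent_paramK i (p : @pm_model K M i * @pm_model K M i) :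
  (pm_chart i @` pm_dom i) p.1 -> tangent_chart i (@tangent_param K M i p) = p.
Proof.
case: p => _ u [x ix /= <-]; rewrite tangent_param_vec // /tangent_chart /=.
by rewrite coord_diffK ?coord_diff_id //; exact: pm_atP.
Qed.

Lemma real_domE i j p : D i j p <-> (@pm_chart K (tangent_bundle M) i @`
  [set x | [/\ @pm_dom K (tangent_bundle M) i x, [set: tangent_bundle M] x & pm_dom j (h x)]]) p.
Proof.
split=> [[[ip pp] jp]|[x [ix _ jx] <-]].
  exists (@tangent_param K M i p) => //.
  by apply: tangent_paramK; exists (pm_param p.1).
have e : @tangent_param K M i (tangent_chart i x) = x by exact: tangent_chartK.
by split; [rewrite /chart_image /= pm_chartK|rewrite /real_alg e].
Qed.

(** The identity on pairs, in the expanded form that [real_iso_prod] produces. *)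
Definition real_pair i (p : real_model i * real_model i) : @pm_model K M i * @pm_model K M i :=
  (p.1, p.2).

Lemma real_pair_iso i : @real_iso R c (@pm_model K M i * @pm_model K M i)%type
  (real_model i * real_model i)%type (@real_pair i) (fun p => (p.1, p.2)).
Proof. exact: (real_iso_prod (realify_iso _) (realify_iso _)). Qed.

Lemma real_algE i j : H i j = id \o HK i j \o @real_pair i.
Proof. by apply/funext => -[a u]. Qed.

Lemma real_dom_preimage i j : D i j = @real_pair i @^-1` (@pm_chart K (tangent_bundle M) i @`
  [set x | [/\ @pm_dom K (tangent_bundle M) i x, [set: tangent_bundle M] x & pm_dom j (h x)]]).
Proof. by apply/seteqP; split=> -[a u] /real_domE. Qed.

Lemma real_dom_open i j : open (D i j).
Proof.
have [oD _] := algebra_smooth h_algebra i j.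
rewrite real_dom_preimage; exact: (open_real_iso (real_pair_iso i) oD).
Qed.

Lemma real_alg_smooth i j : smooth (D i j) (H i j).
Proof.
have [oD sD] := algebra_smooth h_algebra i j.
rewrite real_dom_preimage real_algE.
exact: (smooth_real_iso (real_pair_iso i) (realify_iso _) oD sD).
Qed.

Lemma real_alg_diff i j p q : D i j p ->
  'd (H i j) p q = 'd (HK i j) (real_pair p) (real_pair q).
Proof.
move=> Dp; have [oD sD] := algebra_smooth h_algebra i j.
have dK : differentiable (HK i j) (real_pair p).
  by apply: (smooth_differentiable sD); move: Dp; rewrite real_dom_preimage.
have [_ e] := diff_real_iso (real_pair_iso i) (realify_iso _) dK.
by rewrite real_algE e.
Qed.

Lemma real_alg_unit i (a : real_model i) :
  @chart_image R (mspace M) (pm_idx M) real_model (@pm_dom K M) (@pm_chart K M) (@pm_param K M) i a ->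
  real_alg (a, 0) = pm_param a.
Proof.
move=> [ia aa]; rewrite -{1}aa /real_alg.
have -> : @tangent_param K M i (pm_chart i (pm_param a), 0) = @tangent_vec K M (pm_param a) 0.
  by rewrite tangent_param_vec // /coord_diff linear0.
exact: (algebra_unit h_algebra).
Qed.

(** The monad law at the vector with coordinates [(p, q)], read through [tangent_map_param] and
    [tangent_mu_param]. *)
Lemma real_alg_law i j p q : D i j p ->
  real_alg (H i j p, 'd (H i j) p q) = real_alg (p.1, p.2 + q.1).
Proof.
move=> Dp; have [[ip pp] jp] := Dp.
have Wp : (pm_chart i @` pm_dom i) p.1 by exists (pm_param p.1).
pose x := @tangent_param K M i p.
have cx : @pm_chart K (tangent_bundle M) i x = p by exact: tangent_paramK.
have ix : @pm_dom K (tangent_bundle M) i x by [].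
rewrite (real_alg_diff _ Dp).
have := @tangent_map_param K (tangent_bundle M) M h i j x q (algebra_smooth h_algebra) ix jp.
rewrite cx => e; have [_ _ law] := h_algebra.
have [rp rq] : real_pair p = p /\ real_pair q = q by case: (p) (q) => ? ? [].
rewrite rp rq.
have := law (@tangent_param K (tangent_bundle M) i (p, q)).
by rewrite e tangent_mu_param.
Qed.

Hypothesis h_tame : tame h.

(** [tau] composes one-sided inverses of the factors of [P], in reverse order: [T' J = id] and
    [S T = id] give [P tau P = P]. *)
Lemma real_alg_tame i (a : real_model i) :
  @chart_image R (mspace M) (pm_idx M) real_model (@pm_dom K M) (@pm_chart K M) (@pm_param K M) i a ->
  exists2 tau : {linear real_model i -> real_model i}, continuous tau &
    let P := @vertical_diff R (mspace M) (pm_idx M) real_model (@pm_chart K M) real_alg i a in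
    forall u, P (tau (P u)) = P u.
Proof.
move=> Wa; have [ix xa] := Wa; set x : mspace M := pm_param a in ix xa.
have [Z [S [k [J [kx [cS cJ] [surjS splitS] [injJ splitJ] PE]]]]] :=
  vertical_factorization h_algebra h_tame ix.
have [T cT ST] := split_linear_right_inverse cS surjS splitS.
have [T' cT' TJ] := split_linear_left_inverse cJ injJ splitJ.
pose C' : {linear tangent_space x -> @pm_model K M i} :=
  'd (@coord_change K M (pm_at x) i) (pm_chart (pm_at x) x).
pose Q' : {linear @pm_model K M i -> @pm_model K M k} := 'd (@coord_change K M i k) (pm_chart i x).
have [C1 cC1 C1E] := realify_linear (coord_diff_continuous (pm_atP x) ix : continuous C').
have [Q1 cQ1 Q1E] := realify_linear (coord_diff_continuous ix kx : continuous Q').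
pose tau : {linear real_model i -> real_model i} := C1 \o (T \o (T' \o Q1)).
exists tau.
  move=> v; apply: continuous_comp; last exact: cC1.
  apply: continuous_comp; last exact: cT.
  by apply: continuous_comp; [exact: cQ1|exact: cT'].
have D0 : D i i (a, 0) by split=> //; rewrite /= real_alg_unit.
have PaE u : @vertical_diff R (mspace M) (pm_idx M) real_model (@pm_chart K M) real_alg i a u =
    @coord_diff K M k i (pm_chart k x) (J (S (@coord_diff K M i (pm_at x) (pm_chart i x) u))).
  have := PE u; rewrite xa => <-; exact: (real_alg_diff (0, u) D0).
move=> P u; rewrite /P !PaE.
have tauE v : tau v = @coord_diff K M (pm_at x) i (pm_chart (pm_at x) x)
    (T (T' (@coord_diff K M i k (pm_chart i x) v))) by rewrite /tau /= C1E Q1E.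
rewrite tauE !coord_diffK ?coord_diff_id ?ST //; try exact: pm_atP.
by rewrite TJ.
Qed.

End realified_atlas.

Theorem proposition4p4p1 (R : realType) (c : bool)
    (M : premanifold (ground_field R c)) (M_manifold : manifold M)
    (h : tangent_bundle M -> M)
    (h_algebra : tangent_algebra h) (h_tame : tame h)
    (x : M) (gamma : R -> M)
    (gamma_smooth : smooth_path 0 1 gamma)
    (gamma_leaf : forall t : R, 0 <= t <= 1 -> leaf h x (gamma t))
    (gamma0 : gamma 0 = x) :
  exists gammat : R -> tangent_space x,
    [/\ piecewise_smooth 0 1 gammat,
        gammat 0 = 0 &
        forall t : R, 0 <= t <= 1 -> h (tangent_vec (gammat t)) = gamma t].
Proof.
have [_ _ sepM] := M_manifold.
pose i0 := pm_at x; pose a0 : real_model i0 := pm_chart i0 x.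
have ix : pm_dom i0 x by exact: pm_atP.
have algE (u : tangent_space x) : @real_alg R c M h i0 (a0, u) = h (tangent_vec u).
  by rewrite /real_alg -tangent_vec_param.
have Wa0 : @chart_image R (mspace M) (pm_idx M) (@real_model R c M)
    (@pm_dom _ M) (@pm_chart _ M) (@pm_param _ M) i0 a0.
  by rewrite /chart_image /= /a0 pm_chartK.
have charts t : 0 <= t <= 1 -> exists j e, [/\ 0 < e, forall s, window t e s -> pm_dom j (gamma s) &
    @smooth_on R (@real_model R c M j) (window t e) (fun s => pm_chart j (gamma s))].
  move=> /gamma_smooth[j [e [e0 dj sj]]].
  have win : window t e = `[0, 1]%classic `&` ball t e.
    apply/seteqP; split=> s /=; rewrite in_itv -ball_normE /=.
      by move=> [s01 st]; rewrite distrC.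
    by move=> [s01 st]; split=> //; rewrite distrC.
  by exists j, e; rewrite win; split=> //; exact/smooth_curve_realify.
have leafP t : 0 <= t <= 1 -> range (fun u : real_model i0 => real_alg h (a0, u)) (gamma t).
  by move=> /gamma_leaf[u _ <-]; exists u => //=; rewrite algE.
have start : gamma 0 = real_alg h (a0, 0) by rewrite algE (algebra_unit h_algebra).
have [gt [s [ps gt0 cgt sgt hgt]]] := @lift_in_charts R (mspace M) (pm_idx M) (@real_model R c M)
  (@pm_dom _ M) (@pm_chart _ M) (@pm_param _ M) (@real_alg R c M h)
  (@pm_chartK _ M) (fun m => ex_intro _ (pm_at m) (pm_atP m))
  (real_dom_open h_algebra) (real_alg_smooth h_algebra)
  (real_alg_unit h_algebra) (real_alg_law h_algebra) i0 a0 Wa0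
  (real_alg_tame h_algebra h_tame) (fun i => realify_separable (sepM i))
  gamma charts leafP start.
exists gt; split=> // [|t t01]; last by rewrite -algE hgt.
split; first by move=> t B nB; apply: (cgt t); exact/nbhs_realify.
exists s => // k ks; apply/smooth_curve_realify.
(* The defaults of [nth] differ, 0 in [lifted] and 1 in [piecewise_smooth]; the indices are in
   range. *)
have := sgt k ks; rewrite (set_nth_default 1) ?(ltn_trans ks) //=.
by rewrite (set_nth_default 1 0 ks).
Qed.
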